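(* Let $(\Sigma,g)$ be a complete, non-compact hyperbolic surface of finite volume, and let $LS_g$ be the set of lengths of closed geodesics of $(\Sigma,g)$. If $$\lim_{n\to \infty}\frac{\#(LS_g\cap[0,n])}{e^{n/2}\log\log n}=0,$$ then $(\Sigma,g)$ is arithmetic.
   Context: $(\Sigma,g)$ is arithmetic if $\Sigma=\mathbf{H}^2/\Gamma$ with $\Gamma$ an arithmetic Fuchsian group, i.e. $\Gamma$ is commensurable with a group $P\rho(\mathcal{O}^1)$, where $k$ is a totally real number field, $A$ a quaternion algebra over $k$ ramified at all real places except the identity one, $\rho:A\otimes_{\mathbb{Q}}\mathbb{R}\cong M(2,\mathbb{R})\oplus\mathbf{H}\oplus\cdots\oplus\mathbf{H}$, $P$ the projection to the first factor, $\mathcal{O}$ an order in $A$ and $\mathcal{O}^1$ its elements of reduced norm $1$. *)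

(* Defs.v *)
From HB Require Import structures.
From mathcomp Require Import all_boot all_order all_algebra.
From mathcomp Require Import all_classical all_reals all_analysis.
From mathcomp Require Import finmap.
From mathcomp.real_closed Require Import complex.

Set Implicit Arguments.
Unset Strict Implicit.
Unset Printing Implicit Defensive.

Import Order.TTheory GRing.Theory Num.Theory.
Import numFieldNormedType.Exports.

Local Open Scope classical_set_scope.
Local Open Scope ring_scope.

Section HyperbolicSurfaces.
Variable R : realType.
Local Notation M := 'M[R]_2.

Definition i0 : 'I_2 := ord0.
Definition i1 : 'I_2 := ord_max.

(* ---------- Fuchsian groups ----------
   A subgroup Gamma of PSL(2,R) is represented by its full preimage
   G in SL(2,R) (so G contains -1). *)
Definition SL2_subgroup (G : set M) : Prop :=
  [/\ G 1, G (-1), (forall A, G A -> \det A = 1),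
      (forall A B, G A -> G B -> G (A * B)) & (forall A, G A -> G A^-1)].

Definition discrete_mx (G : set M) : Prop :=
  forall A, G A -> exists e : R, 0 < e /\
    forall B, G B -> (forall i j, `|A i j - B i j| < e) -> B = A.

Definition torsion_free_P (G : set M) : Prop :=
  forall A (n : nat), G A -> (0 < n)%N -> (A ^+ n = 1 \/ A ^+ n = -1) ->
    A = 1 \/ A = -1.

(* Sigma = H^2 / Gamma with Gamma a torsion-free Fuchsian group:
   a complete (orientable) hyperbolic surface. *)
Definition surface_group (G : set M) : Prop :=
  [/\ SL2_subgroup G, discrete_mx G & torsion_free_P G].

Definition H2 : set (R * R) := [set p | 0 < p.2].

(* Moebius action of A in SL(2,R) on x + i y *)
Definition mobius (A : M) (p : R * R) : R * R :=
  let a := A i0 i0 in let b := A i0 i1 in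
  let c := A i1 i0 in let d := A i1 i1 in
  let x := p.1 in let y := p.2 in
  let D := (c * x + d) ^+ 2 + (c * y) ^+ 2 in
  (((a * x + b) * (c * x + d) + a * c * y ^+ 2) / D, y / D).

Definition arcosh (u : R) : R := ln (u + Num.sqrt (u ^+ 2 - 1)).

Definition hdist (p q : R * R) : R :=
  arcosh (1 + ((p.1 - q.1) ^+ 2 + (p.2 - q.2) ^+ 2) / (2 * p.2 * q.2)).

Definition transl_length (A : M) : R :=
  inf [set hdist p (mobius A p) | p in H2].

(* LS_g: lengths of closed geodesics of H^2/Gamma, i.e. the (positive)
   translation lengths of the (hyperbolic) elements of Gamma. *)
Definition length_set (G : set M) : set R :=
  [set l | 0 < l /\ exists A, G A /\ l = transl_length A].

Definition count_lengths (G : set M) (n : nat) : nat :=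
  #|` fset_set (length_set G `&` `[0, n%:R]) |.

Definition hyp_area (F : set (R * R)) : \bar R :=
  (\int[(@lebesgue_measure R \x @lebesgue_measure R)%E]_(p in F)
      ((p.2 ^-2)%:E))%E.

Definition covers_quotient (G : set M) (F : set (R * R)) : Prop :=
  forall p, H2 p -> exists A q, [/\ G A, F q & p = mobius A q].

Definition finite_area (G : set M) : Prop :=
  exists F : set (R * R), [/\ measurable F, F `<=` H2,
    (hyp_area F < +oo)%E & covers_quotient G F].

Definition compact_quotient (G : set M) : Prop :=
  exists K : set (R * R), [/\ compact K, K `<=` H2 & covers_quotient G K].

(* k : a number field, given as a subfield of R (the identity place) *)
Definition subfield_R (k : set R) : Prop :=
  [/\ k 1, (forall x y, k x -> k y -> k (x - y) /\ k (x * y))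
      & (forall x, k x -> k x^-1)].

Definition finite_over_Q (k : set R) : Prop :=
  exists s : seq R, (forall i : 'I_(size s), k s`_i) /\
    forall x, k x -> exists q : 'I_(size s) -> rat,
      x = \sum_(i < size s) ratr (q i) * s`_i.

Definition real_embedding (k : set R) (s : R -> R) : Prop :=
  s 1 = 1 /\ forall x y, k x -> k y ->
    s (x + y) = s x + s y /\ s (x * y) = s x * s y.

Definition complex_embedding (k : set R) (s : R -> R[i]) : Prop :=
  s 1 = 1 /\ forall x y, k x -> k y ->
    s (x + y) = s x + s y /\ s (x * y) = s x * s y.

Definition totally_real (k : set R) : Prop :=
  forall s, complex_embedding k s -> forall x, k x -> 'Im (s x) = 0.

Definition number_field_in_R (k : set R) : Prop :=
  [/\ subfield_R k, finite_over_Q k & totally_real k].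

(* B : a k-subalgebra of M(2,R) (the image P rho(A) of A) *)
Definition k_subalgebra (k : set R) (B : set M) : Prop :=
  [/\ B 1, (forall X Y, B X -> B Y -> B (X + Y) /\ B (X * Y))
      & (forall c X, k c -> B X -> B (c *: X))].

Definition k_basis (k : set R) (B : set M) (e : 'I_4 -> M) : Prop :=
  [/\ (forall i, B (e i)),
      (forall X, B X -> exists c : 'I_4 -> R,
          (forall i, k (c i)) /\ X = \sum_i c i *: e i)
    & (forall c : 'I_4 -> R, (forall i, k (c i)) ->
          \sum_i c i *: e i = 0 -> forall i, c i = 0)].

(* the natural map B (x)_k R -> M(2,R) is onto (hence an isomorphism):
   A splits at the identity place *)
Definition R_spans (e : 'I_4 -> M) : Prop :=
  forall X : M, exists c : 'I_4 -> R, X = \sum_i c i *: e i.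

Definition struct_consts (k : set R) (e : 'I_4 -> M)
    (c : 'I_4 -> 'I_4 -> 'I_4 -> R) : Prop :=
  (forall i j l, k (c i j l)) /\
  forall i j, e i * e j = \sum_l c i j l *: e l.

Definition mul_sc (c : 'I_4 -> 'I_4 -> 'I_4 -> R) (x y : 'rV[R]_4) : 'rV[R]_4 :=
  \row_l \sum_i \sum_j x ord0 i * y ord0 j * c i j l.

Definition q0 : 'I_4 := inord 0.
Definition q1 : 'I_4 := inord 1.
Definition q2 : 'I_4 := inord 2.
Definition q3 : 'I_4 := inord 3.
Definition qmul (x y : 'rV[R]_4) : 'rV[R]_4 :=
  let a1 := x ord0 q0 in let b1 := x ord0 q1 in
  let c1 := x ord0 q2 in let d1 := x ord0 q3 in
  let a2 := y ord0 q0 in let b2 := y ord0 q1 in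
  let c2 := y ord0 q2 in let d2 := y ord0 q3 in
  \row_l (if l == q0 then a1 * a2 - b1 * b2 - c1 * c2 - d1 * d2
     else if l == q1 then a1 * b2 + b1 * a2 + c1 * d2 - d1 * c2
     else if l == q2 then a1 * c2 - b1 * d2 + c1 * a2 + d1 * b2
     else a1 * d2 + b1 * c2 - c1 * b2 + d1 * a2).

(* A (x)_{k,s} R is isomorphic (as an R-algebra) to Hamilton's quaternions:
   A is ramified at the real place s *)
Definition ramified_at (c : 'I_4 -> 'I_4 -> 'I_4 -> R) (s : R -> R) : Prop :=
  exists T : 'M[R]_4, \det T != 0 /\
    forall x y : 'rV[R]_4,
      mul_sc (fun i j l => s (c i j l)) x y *m T = qmul (x *m T) (y *m T).

Definition order_in (B O : set M) : Prop :=
  [/\ O `<=` B, O 1,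
      (forall X Y, O X -> O Y -> O (X - Y) /\ O (X * Y)),
      (exists s : seq M, (forall i : 'I_(size s), O s`_i) /\
         forall X, O X -> exists z : 'I_(size s) -> int,
           X = \sum_(i < size s) (z i)%:~R *: s`_i)
    & (forall X, B X -> exists (n : nat) (q : 'I_n -> rat) (Y : 'I_n -> M),
         (forall i, O (Y i)) /\ X = \sum_(i < n) ratr (q i) *: Y i)].

Definition finite_index (H K : set M) : Prop :=
  exists s : seq M, forall X, H X ->
    exists i : 'I_(size s), K ((s`_i)^-1 * X).

Definition commensurable (G D : set M) : Prop :=
  finite_index G (G `&` D) /\ finite_index D (G `&` D).

Definition arithmetic_fuchsian (G : set M) : Prop :=
  exists (k : set R) (B O : set M) (e : 'I_4 -> M)
         (c : 'I_4 -> 'I_4 -> 'I_4 -> R),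
  [/\ number_field_in_R k /\ k_subalgebra k B,
      [/\ k_basis k B e, R_spans e & struct_consts k e c],
      (forall s, real_embedding k s -> (exists x, k x /\ s x != x) ->
                 ramified_at c s),
      order_in B O
    & commensurable G [set X | O X /\ \det X = 1]].

End HyperbolicSurfaces.

(* Main.v *)
Require Import Defs.
From HB Require Import structures.
From mathcomp Require Import all_boot all_order all_algebra.
From mathcomp Require Import all_classical all_reals all_analysis.
From mathcomp Require Import measurable_realfun.
From mathcomp Require Import cyclic.
From mathcomp Require Import ring lra zify.
Import Order.TTheory GRing.Theory Num.Theory.
Import numFieldNormedType.Exports.
Local Open Scope ring_scope.
Set Implicit Arguments.
Unset Strict Implicit.
Unset Printing Implicit Defensive.

(* An element of trace t > 2 has length 2 arcosh (t / 2), so the lengths up to n can be counted as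
   the traces up to x = exp (n / 2).

   Area is invariant under SL(2,R), so finite area bounds every packing of the quotient; with
   Zassenhaus' lemma this gives finiteness of the set of bounded traces, and a parabolic
   element when the quotient is not compact.  Conjugate it to T = [[1, 1], [0, 1]].

   For A, B in G with lower left entries c, c', the traces of A T^n B T^m, m in Z, form a
   progression of difference c c' (n + b), b = a_B / c' + d_A / c.  If b is irrational, two such
   progressions meet at most once, so there are at least const * x log x traces up to x, too many.
   Hence all the b are rational, and after a translation G consists of multiples of rational
   matrices.

   Suppose t = tr A has t^2 not in Z, and put E = A^2.  The traces of E^k T^n E T^m are
   k0 (n + u / v)(m + u / v) - s with k0 = O(tr(E)^k), while the reduced denominator v exceeds
   k0 by a factor exponential in k.  Among the integers w + i v, w = u^2 mod v, a positive
   proportion (independent of v) factors as X Y with X = Y = u mod v: by Turan's inequality almost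
   all of them have many prime factors in each class k mod v whose primes up to L have a large
   sum of reciprocals, and these classes generate (Z/v)^* once L > exp (exp (C v^2)).  Indeed, if g is
   not generated, let F be the indicator of the generated classes and f(n) = F(n) - F(g n): f has
   mean zero, which bounds the sum of f(n) / n over the n <= L without prime factors in the remaining
   classes, but f = 1 at every such n prime to v.  So too many traces occur up to
   x = exp (exp (exp (O(k)))); this is where log log n enters.

   Hence all squared traces are integers, and a fixed S makes S times any product of two entries
   of an element an integer.  So G lies in the union of M_2(Z) / sqrt n, n <= S, whence
   G and SL(2,Z) are commensurable: one index is bounded by reduction mod n, the other one by
   packing. *)

(** * Sieving residue classes *)

(** The quantitative core is a single inequality. Among the integers [w + i v] with i < I, at least
    I/4 usable products give distinct traces, all at most x = k0 I / v, so the hypothesis forces v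
    <= 4 k0 log log (3 log x). Now v / k0 grows exponentially in k, whereas the right-hand logarithm
    grows linearly in k as long as x is at most triply exponential in k, that is, doubly exponential
    in a power of v. Hence the sieve needs an explicit threshold and a density that does not depend
    on v.

    Equidistribution of primes in the classes modulo v is avoided. It is enough that the classes
    rich in primes generate all units: a typical integer has many prime divisors in each rich class,
    and a divisor congruent to u can be assembled from them.

    A trace may be irrational even when its square is rational. Passing from A to E = A^2 makes both
    the trace and the lower left entry rational, so that reduced denominators can be compared. The
    arithmetic structure reached at the end has field Q and a conjugate of M_2(Z) as order. *)

Section sieve.
Context (R : realType).
Implicit Types (Q : seq nat) (f : nat -> R) (M v : nat).

Definition free Q (n : nat) := all (fun q => ~~ (q %| n)%N) Q.

(* The term n = 0 vanishes, since 0^-1 = 0. *)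
Definition lsum Q M f : R := \sum_(n < M.+1 | free Q n) f n / n%:R.

(** One step of the Legendre sieve: the multiples of q free of Q are the q m with m free of Q, since
    q is a prime outside Q, and a factor 1 / q comes out of the weight. *)
Lemma lsum_cons q Q M f : prime q -> q \notin Q -> all prime Q ->
  lsum (q :: Q) M f = lsum Q M f - q%:R^-1 * lsum Q (M %/ q)%N (fun n => f (q * n)%N).
Proof.
move=> pq qQ pQ.
have q0 := prime_gt0 pq.
have freeM n : free Q (q * n) = free Q n.
  apply: eq_in_all => p pin; have pp : prime p := allP pQ p pin.
  rewrite Euclid_dvdM// dvdn_prime2//; have [pE|//] := eqVneq p q.
  by rewrite -pE pin in qQ.
rewrite {2}/lsum (bigID (fun n : 'I_M.+1 => (q %| n)%N)) /=.
set A := (X in _ = X + _ - _); suff -> : A = q%:R^-1 * lsum Q (M %/ q)%N (fun n => f (q * n)%N).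
  by rewrite addrAC subrr add0r; apply: eq_bigl => n; rewrite /free/= andbC.
rewrite /A /lsum.
rewrite big_distrr/=.
rewrite (reindex_omap (fun i : 'I_(M %/ q).+1 => inord (q * i) : 'I_M.+1)
   (fun n : 'I_M.+1 => Some (inord (n %/ q) : 'I_(M %/ q).+1))).
  have val i : (i < (M %/ q).+1)%N -> (q * i < M.+1)%N.
    by rewrite !ltnS => h; rewrite mulnC; apply: leq_trans (leq_trunc_div M q); rewrite leq_mul2r h orbT.
  apply: eq_big => [i|i _].
    rewrite inordK ?val// freeM dvdn_mulr// andbT mulKn// inord_val eqxx andbT//.
  by rewrite inordK ?val// natrM invfM mulrCA.
move=> n /andP[_ qn]; congr Some.
have nq : (n %/ q < (M %/ q).+1)%N by rewrite ltnS leq_div2r// -ltnS.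
by rewrite (inordK nq) mulnC divnK// inord_val.
Qed.

Definition modperiodic v f := forall n, f (n + v)%N = f n.

Lemma periodic_mod v f n : modperiodic v f -> f (n %% v)%N = f n.
Proof.
move=> pf; rewrite [in RHS](divn_eq n v); elim: (n %/ v)%N => [|k IH]; first by rewrite mul0n.
by rewrite mulSn -addnA addnC pf.
Qed.

Lemma periodic_mul v q f : modperiodic v f -> modperiodic v (fun n => f (q * n)%N).
Proof.
move=> pf n /=; rewrite mulnDr -[RHS](periodic_mod _ pf) -[LHS](periodic_mod _ pf).
by rewrite addnC modnMDl.
Qed.

(* Multiplication by q permutes the residues. *)
Lemma sum_residues_mul (T : nmodType) v q (g : nat -> T) : (0 < v)%N -> coprime q v ->
  (forall n, g (n %% v)%N = g n) ->
  \sum_(r < v) g (q * r)%N = \sum_(r < v) g r.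
Proof.
case: v => // v _ qv pg.
pose h (r : 'I_v.+1) : 'I_v.+1 := inord ((q * r) %% v.+1).
have hi : injective h.
  move=> r r' /(congr1 val); rewrite /= !inordK ?ltn_mod// => E.
  apply: val_inj => /=.
  have : (q * r = q * r' %[mod v.+1])%N by [].
  wlog le : r r' {E} / (r <= r')%N => [W E'|].
    by case/orP: (leq_total r r') => l; [exact: W|apply/esym/W].
  move/eqP; rewrite eq_sym eqn_mod_dvd ?leq_mul2l ?le ?orbT// -mulnBr Gauss_dvdr 1?coprime_sym//.
  have [/eqP|pos dv] := posnP (r' - r); first by rewrite subn_eq0 => le' _; apply/eqP; rewrite eqn_leq le le'.
  have := dvdn_leq pos dv; have := ltn_ord r'; lia.
rewrite [RHS](reindex_inj hi); apply: eq_bigr => r _.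
by rewrite /h inordK ?ltn_mod// pg.
Qed.

(** Full periods cancel, which leaves the first [n %% v] terms of one period. *)
Lemma partial_sum_bound v f (B : R) n : (0 < v)%N -> modperiodic v f -> \sum_(r < v) f r = 0 ->
  \sum_(r < v) `|f r| <= B -> `|\sum_(k < n) f k| <= B.
Proof.
move=> v0 pf f0 fB.
have red m : \sum_(k < v + m) f k = \sum_(k < m) f k.
  rewrite big_split_ord/= f0 add0r; apply: eq_bigr => k _ /=.
  by rewrite addnC pf.
have -> : \sum_(k < n) f k = \sum_(k < n %% v) f k.
  rewrite [in LHS](divn_eq n v); elim: (n %/ v)%N => [|k IH]; first by rewrite mul0n.
  by rewrite mulSn -addnA red.
apply: le_trans (ler_norm_sum _ _ _) _; apply: le_trans fB.
have le : (n %% v <= v)%N by rewrite ltnW// ltn_mod.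
rewrite (big_ord_widen v (fun k => `|f k|) le) [leRHS](bigID (fun k : 'I_v => (k < n %% v)%N))/=.
by rewrite lerDl sumr_ge0.
Qed.

Lemma abel_bound f (B : R) M : f 0 = 0 -> (forall n, `|\sum_(k < n) f k| <= B) ->
  `|\sum_(n < M.+1) f n / n%:R| <= B.
Proof.
move=> f0 AB; have B0 : 0 <= B by apply: le_trans (AB 0); rewrite big_ord0 normr0.
(* Summation by parts with the boundary term moved to the left; in this form the bounds telescope in
   the induction on M. *)
suff : `|\sum_(n < M.+1) f n / n%:R - (\sum_(n < M.+1) f n) / M.+1%:R| <= B * (1 - M.+1%:R^-1).
  move=> h; rewrite -[X in `|X|](subrK ((\sum_(n < M.+1) f n) / M.+1%:R)).
  apply: le_trans (ler_normD _ _) _.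
  have : `|(\sum_(n < M.+1) f n) / M.+1%:R| <= B * M.+1%:R^-1.
    by rewrite normrM [ `|_^-1|]ger0_norm ?invr_ge0 ?ler0n// ler_wpM2r ?invr_ge0 ?ler0n.
  move=> h'; have -> : B = B * (1 - M.+1%:R^-1) + B * M.+1%:R^-1 by ring.
  exact: lerD.
elim: M => [|M IH].
  by rewrite !big_ord_recl !big_ord0 f0 mul0r !addr0 mul0r subrr normr0 invr1 subrr mulr0.
rewrite big_ord_recr/= [X in _ - X / _]big_ord_recr/=.
set S := \sum_(i < M.+1) f i / i%:R in IH *; set A := \sum_(i < M.+1) f i in IH *.
have -> : S + f M.+1 / M.+1%:R - (A + f M.+1) / M.+2%:R =
  (S - A / M.+1%:R) + (A + f M.+1) * (M.+1%:R^-1 - M.+2%:R^-1).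
  by move: (M.+1%:R^-1) (M.+2%:R^-1) => a b; ring.
apply: le_trans (ler_normD _ _) _.
have d0 : 0 <= M.+1%:R^-1 - M.+2%:R^-1 :> R.
  by rewrite subr_ge0 lef_pV2 ?posrE ?ltr0n// ler_nat.
have : `|(A + f M.+1) * (M.+1%:R^-1 - M.+2%:R^-1)| <= B * (M.+1%:R^-1 - M.+2%:R^-1).
  rewrite normrM (ger0_norm d0) ler_wpM2r//.
  by have := AB M.+2; rewrite big_ord_recr/=.
move=> h'; have -> : B * (1 - M.+2%:R^-1) = B * (1 - M.+1%:R^-1) + B * (M.+1%:R^-1 - M.+2%:R^-1) by ring.
exact: lerD.
Qed.

(** Removing q replaces f by n -> f (q n). As q is invertible modulo v, this keeps the period, the
    vanishing sum and the bound B, so each prime costs a factor 1 + 1 / q, uniformly in M. *)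
Lemma lsum_zero_sum v Q M f (B : R) : (1 < v)%N -> uniq Q -> all prime Q -> all (coprime^~ v) Q ->
  modperiodic v f -> \sum_(r < v) f r = 0 -> \sum_(r < v) `|f r| <= B -> f 0 = 0 ->
  `|lsum Q M f| <= B * \prod_(q <- Q) (1 + q%:R^-1).
Proof.
move=> v1; have v0 : (0 < v)%N by exact: ltnW.
elim: Q M f => [|q Q IH] M f.
  move=> _ _ _ pf f0 fB fz; rewrite big_nil mulr1 /lsum.
  by apply: abel_bound => // n; exact: (partial_sum_bound _ v0 pf f0 fB).
move=> /=/andP[qQ uQ] /andP[pq pQ] /andP[qv cQ] pf f0 fB fz.
rewrite lsum_cons// big_cons.
have -> (x P : R) : B * ((1 + x) * P) = B * P + x * (B * P) by ring.
apply: le_trans (ler_normB _ _) _; apply: lerD; first by rewrite IH.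
rewrite normrM ger0_norm ?invr_ge0 ?ler0n// ler_wpM2l ?invr_ge0 ?ler0n//.
have pm : forall n, `|f (n %% v)%N| = `|f n| by move=> n; rewrite periodic_mod.
apply: IH => //.
- exact: periodic_mul.
- by rewrite (sum_residues_mul v0 qv) => // n; exact: periodic_mod.
- by rewrite (sum_residues_mul (g := fun n => `|f n|) v0 qv).
- by rewrite muln0.
Qed.

Lemma lsum_monotone Q M M' f : (forall n, 0 <= f n) -> (M <= M')%N -> lsum Q M f <= lsum Q M' f.
Proof.
move=> f0 MM; rewrite /lsum.
rewrite (big_ord_widen_cond M'.+1 (free Q) (fun n => f n / n%:R)) ?ltnS//.
rewrite [leRHS](bigID (fun n : 'I_M'.+1 => (n < M.+1)%N))/= lerDl sumr_ge0// => i _.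
by rewrite divr_ge0 ?ler0n.
Qed.

(** The multiples of q give a sum of the same shape over the shorter range M / q, hence at most 1 /
    q times the whole because f is nonnegative. *)
Lemma lsum_free_ge v Q M f : uniq Q -> all prime Q -> all (coprime^~ v) Q ->
  (forall n, 0 <= f n) -> (forall q n, coprime q v -> f (q * n)%N = f n) ->
  \prod_(q <- Q) (1 - q%:R^-1) * lsum [::] M f <= lsum Q M f.
Proof.
move=> + + + f0 fq; elim: Q => [|q Q IH]; first by rewrite big_nil mul1r.
move=> /=/andP[qQ uQ] /andP[pq pQ] /andP[qv cQ].
rewrite lsum_cons// big_cons.
have q0 : 0 <= 1 - q%:R^-1 :> R.
  by rewrite subr_ge0 invf_le1 ?ltr0n ?prime_gt0// ler1n prime_gt0.
apply: (@le_trans _ _ ((1 - q%:R^-1) * lsum Q M f)).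
  by rewrite -mulrA ler_wpM2l// IH.
rewrite mulrBl mul1r lerD2l lerN2 ler_wpM2l ?invr_ge0 ?ler0n//.
have -> : lsum Q (M %/ q) (fun n => f (q * n)%N) = lsum Q (M %/ q) f.
  by apply: eq_bigr => n _; rewrite fq.
by apply: lsum_monotone => //; exact: leq_div.
Qed.

(** Dyadic blocks: each doubling of the range adds at least 1 / 2. *)
Lemma harmonic_ge K : K%:R / 2 <= \sum_(j < 2 ^ K) j.+1%:R^-1 :> R.
Proof.
elim: K => [|K IH]; first by rewrite mul0r sumr_ge0// => i _; rewrite invr_ge0 ler0n.
rewrite expnS mul2n -addnn big_split_ord/= -natr1 mulrDl.
apply: lerD; first exact: IH.
apply: (@le_trans _ _ (\sum_(j < 2 ^ K) ((2 ^ K.+1)%:R : R)^-1)).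
  have y0 : (2 ^ K)%:R != 0 :> R by rewrite pnatr_eq0 expn_eq0.
  rewrite sumr_const card_ord -[leRHS]mulr_natr expnS natrM.
  by move: y0; move: (2 ^ K)%:R => y y0; have -> : (2 * y)^-1 * y = 1 / 2 by field.
apply: ler_sum => j _; rewrite lef_pV2 ?posrE ?ltr0n ?expn_gt0// ler_nat.
by have := ltn_ord j; rewrite expnS; lia.
Qed.

(** The terms n = 1 + v j are enough: they are coprime to v, and 1 + v j <= v (j + 1) leaves a
    harmonic sum. *)
Lemma coprime_lsum_ge v K : (0 < v)%N ->
  K%:R / (2 * v%:R) <= lsum [::] (v * 2 ^ K) (fun n => (coprime n v)%:R) :> R.
Proof.
move=> v0; rewrite /lsum.
apply: (@le_trans _ _ (\sum_(j < 2 ^ K) ((1 + v * j)%N%:R : R)^-1)).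
  have -> : K%:R / (2 * v%:R) = v%:R^-1 * (K%:R / 2) :> R by rewrite invfM mulrC; ring.
  apply: le_trans (ler_wpM2l _ (harmonic_ge K)) _; first by rewrite invr_ge0 ler0n.
  rewrite mulr_sumr; apply: ler_sum => j _.
  rewrite -invfM -natrM lef_pV2 ?posrE ?ltr0n ?muln_gt0 ?v0// ler_nat mulnS leq_add2r//.
pose N := (v * 2 ^ K)%N.
have lt (j : 'I_(2 ^ K)) : (1 + v * j < N.+1)%N.
  by rewrite add1n ltnS /N ltn_mul2l v0/= ltn_ord.
pose h (j : 'I_(2 ^ K)) : 'I_N.+1 := inord (1 + v * j).
have hi : injective h.
  move=> j j' /(congr1 val); rewrite /= !inordK// => /addnI/eqP.
  by rewrite eqn_pmul2l// => /eqP; exact: val_inj.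
rewrite [leRHS](bigID (fun n => n \in [set h j | j in [set: 'I_(2 ^ K)]]))/=.
apply: ler_wpDr; first by apply: sumr_ge0 => n _; rewrite divr_ge0 ?ler0n.
rewrite big_imset/=; last by move=> j j' _ _; exact: hi.
rewrite big_mkcond [leRHS]big_mkcond/=.
apply: ler_sum => j _; rewrite finset.in_setT inordK//.
have -> : coprime (1 + v * j) v by rewrite -coprime_modl addnC mulnC modnMDl coprime_modl coprime1n.
by rewrite mul1r.
Qed.

End sieve.

(** * Residue classes rich in primes generate the units modulo v *)

Section generation.
Context (R : realType).

Definition class_primes (L v k : nat) : seq nat :=
  [seq p <- iota 0 L.+1 | prime p && (p %% v == k)%N].

Definition class_sum L v k : R := \sum_(p <- class_primes L v k) p%:R^-1.

Definition large (s0 : R) L v k : bool := (s0 <= class_sum L v k) && coprime k v.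

(** Natural exponents describe the whole generated subgroup because the group of units is finite. *)
Definition gen_large s0 L v (h : nat) : Prop :=
  exists e : nat -> nat, (\prod_(k < v | large s0 L v k) k ^ e k = h %[mod v])%N.

Lemma eq_prod_mod (I : finType) (P : pred I) (F G : I -> nat) v :
  (forall i, P i -> F i = G i %[mod v])%N -> (\prod_(i | P i) F i = \prod_(i | P i) G i %[mod v])%N.
Proof.
move=> FG; apply: (big_ind2 (fun a b => a = b %[mod v])%N) => // a b c d ab cd.
by rewrite -modnMm ab cd modnMm.
Qed.

(** Euler's theorem reduces the exponents modulo [totient v]. So fewer than v primes of each class
    are needed, a number that Turan's inequality can guarantee. *)
Lemma gen_large_bounded s0 L v h : (1 < v)%N -> gen_large s0 L v h ->
  exists e : nat -> nat, (forall k, e k < v)%N /\ (\prod_(k < v | large s0 L v k) k ^ e k = h %[mod v])%N.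
Proof.
move=> v1 [e he]; exists (fun k => e k %% totient v)%N; split.
  move=> k; apply: (@leq_trans (totient v)); first by rewrite ltn_mod totient_gt0; lia.
  rewrite totient_count_coprime big_mkord.
  by apply: (@leq_trans (\sum_(i < v) 1)); [apply: leq_sum => i _; exact: leq_b1|rewrite sum1_card card_ord].
rewrite -he; apply: eq_prod_mod => k /andP[_ kv].
have E q : ((k ^ totient v) ^ q = 1 %[mod v])%N by rewrite -modnXm Euler_exp_totient// modnXm exp1n.
rewrite [in RHS](divn_eq (e k) (totient v)) expnD [(_ %/ _ * _)%N]mulnC expnM.
by rewrite -modnMml E modnMml mul1n.
Qed.

Lemma gen_large1 s0 L v : gen_large s0 L v 1.
Proof. by exists (fun=> 0%N); rewrite big1. Qed.

Lemma gen_large_mod s0 L v h h' : (h = h' %[mod v])%N -> gen_large s0 L v h -> gen_large s0 L v h'.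
Proof. by move=> hh [e he]; exists e; rewrite he. Qed.

Lemma gen_largeM s0 L v h h' : gen_large s0 L v h -> gen_large s0 L v h' -> gen_large s0 L v (h * h').
Proof.
move=> [e he] [e' he']; exists (fun k => e k + e' k)%N.
under eq_bigr do rewrite expnD.
by rewrite big_split/= -modnMm he he' modnMm.
Qed.

Lemma gen_largeX s0 L v h n : gen_large s0 L v h -> gen_large s0 L v (h ^ n).
Proof.
by move=> hh; elim: n => [|n IH]; [exact: gen_large1|rewrite expnS; exact: gen_largeM].
Qed.

Lemma gen_large_self s0 L v k : (k < v)%N -> large s0 L v k -> gen_large s0 L v k.
Proof.
move=> kv lk; exists (fun j => (j == k) : nat).
rewrite (bigD1 (Ordinal kv))//= eqxx expn1 big1 ?muln1// => j /andP[_ jk].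
by rewrite -[_ == k]/(j == Ordinal kv) (negbTE jk).
Qed.

Lemma gen_large_prod s0 L v n : (0 < n)%N ->
  (forall p, prime p -> (p %| n)%N -> gen_large s0 L v p) -> gen_large s0 L v n.
Proof.
elim/ltn_ind: n => n IH n0 H.
have [n1|n1] := leqP n 1; first by have -> : n = 1%N by [lia]; exact: gen_large1.
have pp := pdiv_prime n1; have pn := pdiv_dvd n.
rewrite -(divnK pn); apply: gen_largeM; last exact: H.
apply: IH.
- by rewrite ltn_Pdiv// prime_gt1.
- by rewrite divn_gt0 ?prime_gt0// dvdn_leq.
- by move=> p ppr pd; apply: H => //; apply: dvdn_trans pd (dvdn_div pn).
Qed.

(** The sieving set: an n <= L that is coprime to v and free of these primes is a product of primes
    from large classes. *)
Definition small_primes (s0 : R) L v : seq nat :=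
  [seq p <- iota 0 L.+1 | [&& prime p, coprime p v & ~~ large s0 L v (p %% v)]].

Lemma small_primes_sum s0 L v : (0 < v)%N -> 0 <= s0 ->
  \sum_(p <- small_primes s0 L v) p%:R^-1 <= v%:R * s0 :> R.
Proof.
case: v => // v _ s00.
rewrite /small_primes big_filter.
rewrite (partition_big (fun p => inord (p %% v.+1) : 'I_v.+1) predT)//=.
rewrite mulr_natl -[X in _ *+ X](card_ord v.+1) -sumr_const; apply: ler_sum => k _.
have inE p : (inord (p %% v.+1) == k) = (p %% v.+1 == k)%N.
  by rewrite -val_eqE/= inordK ?ltn_mod.
have [lk|nlk] := boolP (large s0 L v.+1 k).
  rewrite big1// => p /andP[/and3P[_ _ +]]; rewrite inE => + /eqP pk.
  by rewrite pk lk.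
have [ck|nck] := boolP (coprime k v.+1); last first.
  rewrite big1// => p /andP[/and3P[_ cp _]]; rewrite inE => /eqP pk.
  by rewrite -coprime_modl pk (negbTE nck) in cp.
move: nlk; rewrite /large ck andbT -ltNge => /ltW; apply: le_trans.
rewrite /class_sum /class_primes big_filter big_mkcond [leRHS]big_mkcond/=.
apply: ler_sum => p _; rewrite inE.
case: (prime p) => //=; case: (p %% v.+1 == k)%N; rewrite ?andbF// andbT.
by case: ifP => // _; rewrite invr_ge0 ler0n.
Qed.

(** Compares the Euler products of the upper and the lower sieve bound: 1 + x <= (1 - x)(1 + 4 x)
    for 0 <= x <= 1 / 2, the range of reciprocals of primes. *)
Lemma prod_1p_le Q : all prime Q ->
  \prod_(q <- Q) (1 + q%:R^-1) <= \prod_(q <- Q) (1 - q%:R^-1) * expR (4 * \sum_(q <- Q) q%:R^-1) :> R.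
Proof.
elim: Q => [|q Q IH] /=; first by rewrite !big_nil mulr0 expR0 mulr1.
move=> /andP[pq /IH {}IH]; rewrite !big_cons mulrDr expRD.
set x := q%:R^-1; have x0 : 0 <= x by rewrite invr_ge0 ler0n.
have x2 : x <= 1 / 2.
  by rewrite mul1r lef_pV2 ?posrE ?ltr0n ?prime_gt0// ler_nat prime_gt1.
have h : 1 + x <= (1 - x) * expR (4 * x).
  apply: (@le_trans _ _ ((1 - x) * (1 + 4 * x))); first by nra.
  by rewrite ler_wpM2l ?expR_ge1Dx//; lra.
set P := \prod_(_ <- _) _ in IH *; set P' := \prod_(_ <- _) _ in IH *; set E := expR _ in IH *.
have -> : (1 - x) * P' * (expR (4 * x) * E) = ((1 - x) * expR (4 * x)) * (P' * E) by ring.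
apply: ler_pM => //; first by lra.
by apply: prodr_ge0 => q' _; rewrite addr_ge0// invr_ge0 ler0n.
Qed.

(** The same sifted sum is at least K / (2 v) times the product of the 1 - 1 / q and at most 2 v
    times the product of the 1 + 1 / q. The two products differ by a factor at most exp (4 v s0), so
    these bounds contradict each other for large K. *)
Lemma generation (s0 : R) v K g : (1 < v)%N -> 0 <= s0 ->
  4 * v%:R ^+ 2 * expR (4 * (v%:R * s0)) < K%:R -> coprime g v ->
  gen_large s0 (v * 2 ^ K) v g.
Proof.
move=> v1 s00 hK cg; apply: contrapT => ng.
set L := (v * 2 ^ K)%N in ng.
have v0 : (0 < v)%N by lia.
pose F (n : nat) : R := (coprime n v && `[< gen_large s0 L v n >])%:R.
pose f n := F n - F (g * n)%N.
have genmod n : `[< gen_large s0 L v (n %% v)%N >] = `[< gen_large s0 L v n >].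
  by apply/asboolP/asboolP; apply: gen_large_mod; rewrite modn_mod.
have Fmod n : F (n %% v)%N = F n by rewrite /F coprime_modl genmod.
have pF : modperiodic v F by move=> n; rewrite -Fmod addnC -{1}[v]mul1n modnMDl Fmod.
have pf : modperiodic v f by move=> n; rewrite /f pF (periodic_mul g pF).
have f0 : \sum_(r < v) f r = 0.
  by rewrite big_split/= sumrN (sum_residues_mul v0 cg Fmod) subrr.
have F1 n : 0 <= F n <= 1 by rewrite /F; case: (coprime n v && _); rewrite ?ler01 ?lexx.
have fB : \sum_(r < v) `|f r| <= 2 * v%:R.
  apply: (@le_trans _ _ (\sum_(r < v) 2)); last by rewrite sumr_const card_ord -[leLHS]mulr_natr.
  apply: ler_sum => r _; apply: le_trans (ler_normB _ _) _.
  have /andP[? ?] := F1 r; have /andP[? ?] := F1 (g * r)%N.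
  by rewrite !ger0_norm//; lra.
have c0 : coprime 0 v = false by rewrite /coprime gcd0n; lia.
have fz : f 0 = 0 by rewrite /f /F muln0 c0 subrr.
pose Q := small_primes s0 L v.
have uQ : uniq Q by apply: filter_uniq; exact: iota_uniq.
have pQ : all prime Q by apply/allP => p; rewrite mem_filter => /andP[/and3P[]].
have cQ : all (coprime^~ v) Q by apply/allP => p; rewrite mem_filter => /andP[/and3P[]].
have h1 := lsum_zero_sum L v1 uQ pQ cQ pf f0 fB fz.
(* For n free of Q and coprime to v one has F n = 1 and F (g n) = 0, so on the sifted set f is the
   indicator of coprimality to v. *)
have E : lsum Q L f = lsum Q L (fun n => (coprime n v)%:R).
  apply: eq_bigr => n nQ; congr (_ / _).
  have cgn : coprime (g * n) v = coprime n v by rewrite coprimeMl cg.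
  rewrite /f /F cgn; have [cn|_] := boolP (coprime n v); last by rewrite subrr.
  have n0 : (0 < n)%N by case: (posnP n) => // n0; rewrite n0 c0 in cn.
  have gn : gen_large s0 L v n.
    apply: gen_large_prod => // p pp pn.
    have cp : coprime p v := coprime_dvdl pn cn.
    have pL : (p < L.+1)%N by apply: leq_ltn_trans (ltn_ord n); exact: dvdn_leq.
    have lp : large s0 L v (p %% v).
      apply: contraT => nl; have pin : p \in Q by rewrite mem_filter pp cp nl mem_iota.
      by have := allP nQ p pin; rewrite pn.
    apply: gen_large_mod (gen_large_self _ lp); first by rewrite modn_mod.
    by rewrite ltn_mod.
  rewrite asboolT// (_ : `[< _ >] = false) ?subr0//.
  apply/negbTE/asboolPn => ggn; apply: ng.
  (* The power of n with exponent [(totient v).-1] is an inverse of n modulo v, so g = (g n) n^-1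
     would be generated. *)
  apply: gen_large_mod (gen_largeM ggn (gen_largeX (totient v).-1 gn)).
  rewrite -mulnA -expnS prednK ?totient_gt0//.
  by rewrite -modnMmr Euler_exp_totient// modnMmr muln1.
have h2 := @lsum_free_ge R v Q L (fun n => (coprime n v)%:R) uQ pQ cQ (fun n => ler0n _ _).
have h3 := @coprime_lsum_ge R v K v0.
rewrite E ger0_norm in h1; last first.
  by apply: sumr_ge0 => n _; rewrite divr_ge0 ?ler0n.
set P' := \prod_(q <- Q) (1 - q%:R^-1) in h2.
have P'0 : 0 < P'.
  rewrite /P' big_seq; apply: prodr_gt0 => q qQ.
  by rewrite subr_gt0 invf_lt1 ?ltr0n ?prime_gt0 ?(allP pQ)// ltr1n prime_gt1// (allP pQ).
have h4 := prod_1p_le pQ; rewrite -/P' in h4.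
have h5 : K%:R / (2 * v%:R) * P' <= 2 * v%:R * (P' * expR (4 * (v%:R * s0))).
  apply: (@le_trans _ _ (P' * lsum [::] L (fun n => (coprime n v)%:R))).
    by rewrite mulrC ler_wpM2l// ltW.
  apply: le_trans (h2 _) _.
    by move=> q n cq; rewrite coprimeMl cq.
  apply: le_trans h1 _; rewrite ler_wpM2l ?mulr_ge0 ?ler0n//.
  apply: le_trans h4 _; rewrite ler_wpM2l ?(ltW P'0)// ler_expR ler_wpM2l//.
  exact: small_primes_sum.
have v0' : 0 < v%:R :> R by rewrite ltr0n.
move: hK; rewrite ltNge => /negP; apply.
have h6 : K%:R / (2 * v%:R) <= 2 * v%:R * expR (4 * (v%:R * s0)).
  by rewrite -(ler_pM2r P'0); apply: le_trans h5 _; rewrite mulrA mulrAC.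
move: h6; rewrite ler_pdivrMr ?mulr_gt0//.
by move: (expR _) => X h; apply: le_trans h _; rewrite le_eqVlt; apply/orP; left; apply/eqP; ring.
Qed.

End generation.

(** * Turan's inequality and divisors in a prescribed residue class *)

Section turan.
Context (R : realType).

Lemma iter_addr_0 n (x : R) : iter n (+%R x) 0 = n%:R * x.
Proof. by elim: n => [|n IH]; rewrite ?mul0r//= IH -natr1; ring. Qed.

Lemma sum_residue_hit m w : (0 < m)%N -> (\sum_(r < m) ((m %| w + r)%N : nat))%N = 1%N.
Proof.
case: m => // m _.
pose c : 'I_m.+1 := inord ((m.+1 - w %% m.+1) %% m.+1).
rewrite (bigD1 c)//= big1 ?addn0.
  rewrite /c inordK ?ltn_mod//; apply/eqP; rewrite eqb1 /dvdn modnDmr -modnDml.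
  by rewrite subnKC ?modnn// ltnW// ltn_mod.
move=> r rc; apply/eqP; rewrite eqb0; apply: contra rc => mr.
apply/eqP/val_inj; rewrite /c /= inordK ?ltn_mod//.
move: mr; rewrite /dvdn -modnDml; have := ltn_mod w m.+1; have := ltn_ord r.
move: (w %% m.+1)%N (r : nat) => a b; rewrite /= => bm am.
have [ab|ab] := ltnP (a + b) m.+1.
  by rewrite modn_small// addn_eq0 => /andP[/eqP-> /eqP->]; rewrite subn0 modnn.
rewrite -(subnK ab) modnDr modn_small; last by lia.
by move=> /eqP h; rewrite modn_small; lia.
Qed.

(* Exactly one in m consecutive terms of w + iv is divisible by m. *)
Lemma count_multiples v w m I : (0 < m)%N -> coprime v m ->
  `|\sum_(i < I) ((m %| w + i * v)%N%:R : R) - I%:R / m%:R| <= 1.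
Proof.
move=> m0 vm.
pose b (i : nat) : nat := (m %| w + i * v)%N.
have per i : b (m + i)%N = b i by rewrite /b mulnDl addnCA dvdn_addr// dvdn_mulr.
have bmod n : ((m %| w + n %% m)%N : nat) = (m %| w + n)%N by rewrite /dvdn modnDmr.
have one : (\sum_(i < m) b i = 1)%N.
  rewrite -(sum_residue_hit w m0).
  rewrite -(@sum_residues_mul nat m v (fun n => ((m %| w + n)%N : nat)) m0 vm bmod).
  by apply: eq_bigr => i _; rewrite /b mulnC.
have blocks q r : (\sum_(i < q * m + r) b i = q + \sum_(i < r) b i)%N.
  elim: q => [|q IH]; first by rewrite mul0n !add0n.
  rewrite mulSn -addnA big_split_ord/= one -[q.+1]add1n -[RHS]addnA -IH; congr (_ + _)%N.
  by apply: eq_bigr => i _; rewrite per.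
have E : (\sum_(i < I) b i = I %/ m + \sum_(i < I %% m) b i)%N by rewrite -blocks -divn_eq.
have r1 : (\sum_(i < I %% m) b i <= 1)%N.
  have le : (I %% m <= m)%N by rewrite ltnW// ltn_mod.
  by rewrite -one (big_ord_widen m b le) [leqRHS](bigID (fun k : 'I_m => (k < I %% m)%N))/= leq_addr.
rewrite -[\sum_(i < I) _]natr_sum E natrD.
have m0' : 0 < m%:R :> R by rewrite ltr0n.
have : I%:R / m%:R = (I %/ m)%:R + (I %% m)%:R / m%:R :> R.
  by rewrite {1}(divn_eq I m) natrD natrM mulrDl mulfK// gt_eqF.
have : 0 <= (I %% m)%:R / m%:R :> R by rewrite divr_ge0 ?ler0n.
have : (I %% m)%:R / m%:R <= 1 :> R by rewrite ler_pdivrMr// mul1r ler_nat ltnW// ltn_mod.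
have : (\sum_(i < I %% m) b i)%N%:R <= 1 :> R by rewrite -[X in _ <= X]/(1%:R) ler_nat.
have : 0 <= (\sum_(i < I %% m) b i)%N%:R :> R by rewrite ler0n.
move=> h1 h2 h3 h4 ->; rewrite ler_norml; apply/andP; split; lra.
Qed.

Definition hits (P : seq nat) v w i : nat := count (fun p => p %| w + i * v)%N P.

(** Expand the square. A pair p <> q contributes I / (p q) up to an error 1, since p q is coprime to
    v, so the main terms I s^2 cancel; the diagonal I s and the accumulated errors remain. *)
Lemma turan (P : seq nat) v w I (s := \sum_(p <- P) p%:R^-1 : R) : uniq P -> all prime P ->
  all (coprime v) P ->
  \sum_(i < I) ((hits P v w i)%:R - s) ^+ 2 <= I%:R * s + 4 * (size P)%:R ^+ 2.
Proof.
move=> uP pP cP.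
have hE i : (hits P v w i)%:R = \sum_(p <- P) ((p %| w + i * v)%N%:R : R).
  by rewrite /hits -sum1_count natr_sum big_mkcond/=; apply: eq_bigr => p _; case: ifP.
have s0 : 0 <= s by apply: sumr_ge0 => p _; rewrite invr_ge0 ler0n.
have pr p : p \in P -> [/\ prime p, coprime v p & (0 < p)%N].
  by move=> pin; have pp := allP pP p pin; split => //; [exact: (allP cP)|exact: prime_gt0].
have sn : s <= (size P)%:R.
  rewrite /s -sum1_size natr_sum big_seq [leRHS]big_seq; apply: ler_sum => p /pr[_ _ p0].
  by rewrite invf_le1 ?ltr0n// ler1n.
set n : R := (size P)%:R in sn *.
have E1 : I%:R * s - n <= \sum_(i < I) (hits P v w i)%:R.
  under eq_bigr do rewrite hE.
  rewrite exchange_big/= /s mulr_sumr /n -sum1_size natr_sum -sumrB.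
  rewrite big_seq [leRHS]big_seq; apply: ler_sum => p /pr[_ vp p0].
  by have := @count_multiples v w p I p0 vp; rewrite ler_norml => /andP[h _]; lra.
have E2 : \sum_(i < I) (hits P v w i)%:R ^+ 2 <= I%:R * s + I%:R * s ^+ 2 + n + n ^+ 2.
  have -> : \sum_(i < I) (hits P v w i)%:R ^+ 2 = \sum_(p <- P) \sum_(q <- P)
      \sum_(i < I) ((p %| w + i * v)%N%:R * (q %| w + i * v)%N%:R : R).
    under eq_bigr do rewrite hE expr2 mulr_suml.
    rewrite exchange_big/=; apply: eq_bigr => p _; rewrite exchange_big/=.
    by apply: eq_bigr => i _; rewrite mulr_sumr.
  have -> : I%:R * s + I%:R * s ^+ 2 + n + n ^+ 2 =
     \sum_(p <- P) (I%:R / p%:R + 1 + \sum_(q <- P) (I%:R / (p%:R * q%:R) + 1)).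
    rewrite big_split/= big_split/= -mulr_sumr -/s.
    have -> : \sum_(p <- P) \sum_(q <- P) (I%:R / (p%:R * q%:R) + 1) = I%:R * s ^+ 2 + n ^+ 2 :> R.
      transitivity (\sum_(p <- P) (I%:R * s * p%:R^-1 + n)).
        apply: eq_bigr => p _; rewrite big_split/= /n -sum1_size natr_sum; congr (_ + _).
        by rewrite /s mulr_sumr mulr_suml; apply: eq_bigr => q _; rewrite invfM; ring.
      rewrite big_split/= -mulr_sumr -/s big_const_seq count_predT iter_addr_0 -/n; ring.
    rewrite big_const_seq count_predT iter_addr_0 -/n; ring.
  rewrite big_seq [leRHS]big_seq; apply: ler_sum => p pin.
  have [pp vp p0] := pr p pin.
  rewrite (bigD1_seq p)//= [X in _ <= _ + X](bigD1_seq p)//=.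
  have diag : \sum_(i < I) ((p %| w + i * v)%N%:R * (p %| w + i * v)%N%:R : R) <= I%:R / p%:R + 1.
    have := @count_multiples v w p I p0 vp; rewrite ler_norml => /andP[_ h].
    under eq_bigr do rewrite -natrM mulnb andbb.
    by lra.
  apply: lerD => //; apply: ler_wpDl.
    by rewrite addr_ge0// divr_ge0 ?ler0n// mulr_ge0 ?ler0n.
  rewrite big_seq_cond [leRHS]big_seq_cond; apply: ler_sum => q /andP[/pr[pq vq q0] qp].
  have cpq : coprime p q by rewrite prime_coprime// dvdn_prime2// eq_sym.
  have := @count_multiples v w (p * q) I; rewrite muln_gt0 p0 q0 coprimeMr vp vq => /(_ isT isT).
  rewrite ler_norml natrM => /andP[_ h].
  under eq_bigr do rewrite -natrM mulnb -Gauss_dvd//.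
  by lra.
have -> : \sum_(i < I) ((hits P v w i)%:R - s) ^+ 2 =
    \sum_(i < I) (hits P v w i)%:R ^+ 2 - 2 * s * \sum_(i < I) (hits P v w i)%:R + I%:R * s ^+ 2.
  have -> : I%:R * s ^+ 2 = \sum_(i < I) s ^+ 2.
    by rewrite sumr_const card_ord -[RHS]mulr_natr mulrC.
  rewrite mulr_sumr -sumrB -big_split/=; apply: eq_bigr => i _; ring.
set S1 := \sum_(i < I) (hits P v w i)%:R in E1 *; set S2 := \sum_(i < I) _ in E2 *.
have n1 : n <= n ^+ 2 by rewrite /n -natrX ler_nat; case: (size P) => // k; rewrite expnS leq_pmulr// expn1.
have : 2 * s * (I%:R * s - n) <= 2 * s * S1 by rewrite ler_wpM2l// mulr_ge0.
have : s * n <= n * n by rewrite ler_wpM2r// /n ler0n.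
move: E2 n1; rewrite !expr2; move: (I%:R : R) => a; move: S1 S2 {E1 pr hE} => S1 S2; nra.
Qed.

(* Chebyshev's inequality applied to the variance. *)
Lemma few_misses (P : seq nat) v w I (s := \sum_(p <- P) p%:R^-1 : R) s0 : uniq P -> all prime P ->
  all (coprime v) P -> 0 < s0 -> s0 <= s ->
  (#|[set i : 'I_I | (hits P v w i)%:R < s / 2]|)%:R <=
    4 * I%:R / s0 + 16 * (size P)%:R ^+ 2 / s0 ^+ 2.
Proof.
move=> uP pP cP s00 s0s; have s_gt0 : 0 < s by exact: lt_le_trans s0s.
have := @turan P v w I uP pP cP; rewrite -/s => T.
set c : R := _%:R.
have h : c * (s ^+ 2 / 4) <= I%:R * s + 4 * (size P)%:R ^+ 2.
  apply: le_trans T; rewrite /c -sum1_card natr_sum mulr_suml [leRHS](bigID (mem [set i : 'I_I | (hits P v w i)%:R < s / 2]))/=.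
  apply: ler_wpDr; first by apply: sumr_ge0 => i _; exact: sqr_ge0.
  apply: ler_sum => i; rewrite inE mul1r => hi.
  have h0 : 0 <= (hits P v w i)%:R :> R by exact: ler0n.
  by rewrite !expr2; nra.
have -> : 4 * I%:R / s0 + 16 * (size P)%:R ^+ 2 / s0 ^+ 2 =
   4 * (I%:R / s0 + 4 * ((size P)%:R / s0) ^+ 2) :> R by field; rewrite gt_eqF.
have -> : c = 4 * ((c * (s ^+ 2 / 4)) / s ^+ 2) by field; rewrite gt_eqF.
rewrite ler_wpM2l//; apply: (@le_trans _ _ (I%:R / s + 4 * ((size P)%:R / s) ^+ 2)).
  rewrite ler_pdivrMr ?exprn_gt0//; apply: le_trans h _.
  by rewrite le_eqVlt; apply/orP; left; apply/eqP; field; rewrite gt_eqF.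
apply: lerD; first by apply: ler_wpM2l; rewrite ?ler0n// lef_pV2.
have ps0 := ltW s00; have ps := ltW s_gt0.
rewrite ler_wpM2l// lerXn2r ?nnegrE ?divr_ge0 ?ler0n//.
by apply: ler_wpM2l; rewrite ?ler0n// lef_pV2.
Qed.

Lemma coprime_prodr_seq (s : seq nat) (F : nat -> nat) m :
  {in s, forall a, coprime m (F a)} -> coprime m (\prod_(a <- s) F a).
Proof.
move=> H; rewrite big_seq; apply: (big_ind (fun x => coprime m x)) => //; first exact: coprimen1.
by move=> x y; rewrite coprimeMr => -> ->.
Qed.

Lemma prod_primes_dvd (s : seq nat) W : uniq s -> all prime s -> all (fun p => p %| W)%N s ->
  (\prod_(p <- s) p %| W)%N.
Proof.
elim: s => [|p s IH]/=; first by rewrite big_nil dvd1n.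
move=> /andP[ps us] /andP[pp pps] /andP[pW sW]; rewrite big_cons Gauss_dvd ?pW ?IH//.
apply: (coprime_prodr_seq (F := id)) => q qs; have pq : prime q := allP pps q qs.
rewrite prime_coprime// dvdn_prime2//; apply: contra ps => /eqP->//.
Qed.

Lemma prod_coprime_dvd (I : eqType) (s : seq I) (F : I -> nat) W : uniq s ->
  {in s &, forall a b, a != b -> coprime (F a) (F b)} -> {in s, forall a, (F a %| W)%N} ->
  (\prod_(a <- s) F a %| W)%N.
Proof.
elim: s => [|a s IH]/=; first by rewrite big_nil dvd1n.
move=> /andP[as_ us] cF dF; rewrite big_cons Gauss_dvd ?dF ?mem_head ?IH//.
- by move=> b c bs cs; apply: cF; rewrite inE ?bs ?cs orbT.
- by move=> b bs; apply: dF; rewrite inE bs orbT.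
rewrite big_seq; apply: (big_ind (fun x => coprime (F a) x)) => //; first exact: coprimen1.
  by move=> x y; rewrite coprimeMr => -> ->.
move=> b bs; apply: cF; rewrite ?mem_head// ?inE ?bs ?orbT//.
by apply: contra as_ => /eqP->.
Qed.

Lemma class_primesP L v k p : p \in class_primes L v k -> prime p /\ (p %% v)%N = k.
Proof. by rewrite mem_filter => /andP[/andP[-> /eqP]]. Qed.

(** The divisor X collects, for each large class k, the first e k primes of the class that divide W.
    They are distinct, so their product divides W, and modulo v it is the product of the k ^ e k. *)
Lemma divisor_in_class (s0 : R) L v u w i : (1 < v)%N -> gen_large s0 L v u ->
  (forall k, (k < v)%N -> large s0 L v k -> (v <= hits (class_primes L v k) v w i)%N) ->
  exists2 X, (X %| w + i * v)%N & (X = u %[mod v])%N.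
Proof.
move=> v1 /(gen_large_bounded v1)[e [ev eu]] H.
set W := (w + i * v)%N.
pose T k := take (e k) [seq p <- class_primes L v k | p %| W]%N.
have Tk k p : p \in T k -> [/\ prime p, (p %% v)%N = k & (p %| W)%N].
  by move=> /mem_take; rewrite mem_filter => /andP[-> /class_primesP[]].
exists (\prod_(k < v | large s0 L v k) \prod_(p <- T k) p)%N.
  rewrite -big_filter; apply: prod_coprime_dvd.
  - by rewrite filter_uniq// index_enum_uniq.
  - move=> k l _ _ kl; apply: (coprime_prodr_seq (F := id)) => p /Tk[pp pl _].
    rewrite coprime_sym; apply: (coprime_prodr_seq (F := id)) => q /Tk[pq qk _].
    rewrite prime_coprime// dvdn_prime2//; apply: contra kl => /eqP E.
    by apply/eqP/val_inj; rewrite /= -qk -E pl.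
  move=> k _; apply: prod_primes_dvd.
  - by rewrite take_uniq// !filter_uniq// iota_uniq.
  - by apply/allP => p /Tk[].
  - by apply/allP => p /Tk[].
rewrite -eu; apply: eq_prod_mod => k lk.
have sT : size (T k) = e k.
  have := H k (ltn_ord k) lk; rewrite /hits -/W => h.
  rewrite size_take size_filter; case: ltnP => // h'.
  by have := leq_trans (ev k) (leq_trans h h'); rewrite ltnn.
rewrite -sT; have {Tk sT} : forall p, p \in T k -> (p %% v = k)%N by move=> p /Tk[].
elim: (T k) => [_|p t IH h]; first by rewrite big_nil.
rewrite big_cons/= expnS -modnMm IH; last by move=> q qt; apply: h; rewrite inE qt orbT.
by rewrite modnMm -modnMml (h p (mem_head p t)).
Qed.

(** An index is good if each large class supplies at least v prime divisors of [w + i v]. Then some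
    divisor X is u modulo v, and the cofactor is u as well because w = u^2 and u is invertible. *)
Lemma product_count u v K I : (0 < v)%N -> coprime u v ->
  4 * v%:R ^+ 2 * expR (4 * (v%:R * (16 * v%:R))) < K%:R :> R -> ((v * 2 ^ K).+1 ^ 2 <= I)%N ->
  exists s : seq nat, [/\ uniq s, (I <= 2 * size s)%N & forall W, W \in s ->
    (W < v * I)%N /\ exists X Y, [/\ W = (X * Y)%N, X = u %[mod v] & Y = u %[mod v] ]%N].
Proof.
move=> v0 uv hK hI; have [v1|v1] := leqP v 1.
  have vE : v = 1%N by case: (v) v0 v1 => [|[]].
  rewrite vE; exists (iota 0 I); rewrite iota_uniq size_iota; split => //; first by rewrite leq_pmull.
  move=> W; rewrite mem_iota/= => WI; split; first by rewrite mul1n.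
  by exists 1%N, W; rewrite mul1n !modn1.
(* With s0 = 16 v a class with fewer than v hits misses half of its expected number. [few_misses]
   then gives at most I / (4 v) + I / (4 v) bad indices per class, hence at most I / 2 for all v
   classes. *)
set L := (v * 2 ^ K)%N in hI; pose s0 : R := 16 * v%:R.
have v0' : 0 < v%:R :> R by rewrite ltr0n.
have s00 : 0 < s0 by rewrite /s0 mulr_gt0.
have gu : gen_large s0 L v u by apply: generation => //; exact: ltW.
pose w := ((u * u) %% v)%N.
pose good (i : nat) := [forall k : 'I_v, large s0 L v k ==> (v <= hits (class_primes L v k) v w i)%N].
pose bad (k : 'I_v) := [set i : 'I_I | large s0 L v k && ~~ (v <= hits (class_primes L v k) v w i)%N].
have badE : [set i : 'I_I | ~~ good i] = \bigcup_(k : 'I_v) bad k.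
  apply/setP => i; rewrite inE /good negb_forall; apply/existsP/finset.bigcupP.
    by move=> [k]; rewrite negb_imply => h; exists k => //; rewrite inE.
  by move=> [k _]; rewrite inE => h; exists k; rewrite negb_imply.
have badk k : (#|bad k|)%:R <= I%:R / (2 * v%:R) :> R.
  have [lk|nlk] := boolP (large s0 L v k); last first.
    have -> : bad k = finset.set0 by apply/setP => i; rewrite !inE (negbTE nlk).
    by rewrite cards0 divr_ge0 ?mulr_ge0 ?ler0n.
  move: (lk) => /andP[sk ck].
  have uP : uniq (class_primes L v k) by rewrite filter_uniq// iota_uniq.
  have pP : all prime (class_primes L v k) by apply/allP => p /class_primesP[].
  have cP : all (coprime v) (class_primes L v k).
    by apply/allP => p /class_primesP[_ pk]; rewrite coprime_sym -coprime_modl pk.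
  (* The primes involved are at most L and I is at least (L + 1)^2, so the error term of
     [few_misses] stays below its main term. *)
  have nP : ((size (class_primes L v k))%:R : R) ^+ 2 <= I%:R.
    rewrite -natrX ler_nat; apply: leq_trans hI; rewrite leq_exp2r//.
    by rewrite size_filter; apply: leq_trans (count_size _ _) _; rewrite size_iota.
  have := few_misses w I uP pP cP s00 sk.
  set n := size _ in nP *; move=> h.
  apply: (@le_trans _ _ (4 * I%:R / s0 + 16 * n%:R ^+ 2 / s0 ^+ 2)).
    apply: le_trans h; rewrite ler_nat; apply: subset_leq_card; apply/fintype.subsetP => i.
    rewrite !inE lk/= -ltnNge => hi.
    apply: (@lt_le_trans _ _ v%:R); first by rewrite ltr_nat.
    by move: sk; rewrite /class_sum /s0; set x := \sum_(_ <- _) _; move: v0' => /[swap]; lra.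
  have -> : 4 * I%:R / s0 = I%:R / (4 * v%:R) by rewrite /s0; field; rewrite gt_eqF.
  have -> : I%:R / (2 * v%:R) = I%:R / (4 * v%:R) + I%:R / (4 * v%:R) :> R by field; rewrite gt_eqF.
  rewrite lerD2l.
  have -> : 16 * n%:R ^+ 2 / s0 ^+ 2 = n%:R ^+ 2 * (16 * v%:R ^+ 2)^-1 by rewrite /s0; field; rewrite gt_eqF.
  apply: ler_pM => //; rewrite ?exprn_ge0 ?ler0n ?invr_ge0 ?mulr_ge0 ?exprn_ge0 ?ler0n//.
  rewrite lef_pV2 ?posrE ?mulr_gt0 ?exprn_gt0//.
  have : 1 <= v%:R :> R by rewrite ler1n.
  by rewrite expr2; nra.
have nbad : (2 * #|[set i : 'I_I | ~~ good i]| <= I)%N.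
  rewrite -(ler_nat R) natrM badE.
  have : (#|\bigcup_(k : 'I_v) bad k|)%:R <= \sum_(k < v) (#|bad k|)%:R :> R.
    rewrite -natr_sum ler_nat; apply: (big_ind2 (fun (A : {set 'I_I}) n => #|A| <= n)%N) => //.
      by rewrite cards0.
    move=> A a B b Aa Bb; rewrite cardsU; apply: leq_trans (leq_subr _ _) _.
    exact: leq_add.
  have : \sum_(k < v) (#|bad k|)%:R <= \sum_(k < v) I%:R / (2 * v%:R) :> R by apply: ler_sum => k _.
  rewrite sumr_const card_ord -[X in _ <= X -> _]mulr_natr.
  have -> : I%:R / (2 * v%:R) * v%:R = I%:R / 2 :> R by field; rewrite gt_eqF.
  by lra.
exists [seq (w + i * v)%N | i <- iota 0 I & good i]; split.
- rewrite map_inj_uniq ?filter_uniq ?iota_uniq// => i j /addnI /eqP.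
  by rewrite eqn_pmul2r// => /eqP.
- rewrite size_map size_filter.
  have -> : count good (iota 0 I) = #|[set i : 'I_I | good i]|.
    rewrite -sum1_count -sum1_card big_mkcond [RHS]big_mkcond/= -[I in iota 0 I]subn0 -/(index_iota 0 I).
    by rewrite big_mkord; apply: eq_bigr => i _; rewrite inE.
  have := cardsC [set i : 'I_I | good i]; rewrite card_ord.
  have -> : ~: [set i : 'I_I | good i] = [set i : 'I_I | ~~ good i] by apply/setP => i; rewrite !inE.
  by lia.
move=> W /mapP[i]; rewrite mem_filter mem_iota add0n => /andP[gi iI] ->.
split.
  have : (w < v)%N by rewrite ltn_mod.
  by rewrite mulnC; nia.
have [|X XW Xu] := @divisor_in_class s0 L v u w i v1 gu.
  by move=> k kv lk; move/forallP: gi => /(_ (Ordinal kv)); rewrite lk.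
exists X, ((w + i * v) %/ X)%N; rewrite [(X * _)%N]mulnC divnK//; split => //.
have cX : coprime X v by rewrite -coprime_modl Xu coprime_modl.
set Y := (_ %/ X)%N.
have : (X * Y = X * u %[mod v])%N.
  by rewrite [(X * _)%N]mulnC divnK// addnC modnMDl modn_mod -[in RHS]modnMml Xu modnMml.
move=> /eqP E; apply/eqP; have [l|/ltnW l] := leqP u Y.
  by move: E; rewrite !eqn_mod_dvd ?leq_mul2l ?l ?orbT// -mulnBr Gauss_dvdr 1?coprime_sym.
rewrite eq_sym; move: E; rewrite eq_sym.
by rewrite !eqn_mod_dvd ?leq_mul2l ?l ?orbT// -mulnBr Gauss_dvdr 1?coprime_sym.
Qed.

End turan.

Local Open Scope classical_set_scope.
Local Open Scope ring_scope.

(** * The action of SL(2,R) and invariance of the area *)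
Section matrix2.
Context (R : realType).
Local Notation M := 'M[R]_2.

Definition mx2 (a b c d : R) : M :=
  \matrix_(i, j) (if i == 0 then (if j == 0 then a else b) else (if j == 0 then c else d)).

Lemma I2_cases (i : 'I_2) : i = i0 \/ i = i1.
Proof.
case: i => -[|[|n]] // lt_n; [left|right]; exact/val_inj.
Qed.

Lemma mx2E a b c d :
  (mx2 a b c d i0 i0 = a) * (mx2 a b c d i0 i1 = b) *
  (mx2 a b c d i1 i0 = c) * (mx2 a b c d i1 i1 = d).
Proof. by rewrite !mxE. Qed.

Lemma mx2P (A B : M) : A i0 i0 = B i0 i0 -> A i0 i1 = B i0 i1 ->
  A i1 i0 = B i1 i0 -> A i1 i1 = B i1 i1 -> A = B.
Proof.
move=> h1 h2 h3 h4; apply/matrixP => i j.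
by case: (I2_cases i) => ->; case: (I2_cases j) => ->.
Qed.

Lemma mx2_eta (A : M) : A = mx2 (A i0 i0) (A i0 i1) (A i1 i0) (A i1 i1).
Proof. by apply: mx2P; rewrite mx2E. Qed.

Lemma mulmx2E (A B : M) i j : (A * B) i j = A i i0 * B i0 j + A i i1 * B i1 j.
Proof.
rewrite -[A * B]/(A *m B) !mxE big_ord_recl big_ord1.
by congr (_ + A i _ * B _ j); apply/val_inj.
Qed.

Lemma mulmx2 a b c d a' b' c' d' :
  mx2 a b c d * mx2 a' b' c' d' =
  mx2 (a * a' + b * c') (a * b' + b * d') (c * a' + d * c') (c * b' + d * d').
Proof. by apply: mx2P; rewrite mulmx2E !mx2E. Qed.

Lemma det2E (A : M) : \det A = A i0 i0 * A i1 i1 - A i0 i1 * A i1 i0.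
Proof.
rewrite (expand_det_row _ i0) !big_ord_recl big_ord0 addr0 /cofactor !det_mx11 !mxE/=.
rewrite expr0 expr1 mul1r mulN1r mulrN; congr (A _ _ * A _ _ - A _ _ * A _ _); exact/val_inj.
Qed.

Lemma tr2E (A : M) : \tr A = A i0 i0 + A i1 i1.
Proof.
by rewrite /mxtrace big_ord_recl big_ord1; congr (_ + A _ _); apply/val_inj.
Qed.

Lemma one2E : 1 = mx2 1 0 0 1.
Proof. by apply: mx2P; rewrite mx2E !mxE. Qed.

Lemma oppmx2 a b c d : - mx2 a b c d = mx2 (- a) (- b) (- c) (- d).
Proof. by apply: mx2P; rewrite !mxE. Qed.

Lemma mulr1_unit2 (A B : M) : A * B = 1 -> A \is a GRing.unit.
Proof. by move=> /mulmx1_unit[]. Qed.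

Lemma inv2E (A : M) : \det A = 1 -> A^-1 = mx2 (A i1 i1) (- A i0 i1) (- A i1 i0) (A i0 i0).
Proof.
move=> dA; have AB : A * mx2 (A i1 i1) (- A i0 i1) (- A i1 i0) (A i0 i0) = 1.
  rewrite {1}(mx2_eta A) mulmx2 one2E; move: dA; rewrite det2E.
  by move: (A i0 i0) (A i0 i1) (A i1 i0) (A i1 i1) => a b c d dA; congr mx2; rewrite -?dA; ring.
have uA := mulr1_unit2 AB.
by rewrite -[RHS]mul1r -(mulVr uA) -mulrA AB mulr1.
Qed.

Lemma det1_unit (A : M) : \det A = 1 -> A \is a GRing.unit.
Proof. move=> dA; have : A \in unitmx by rewrite unitmxE dA unitr1.
by []. Qed.

Lemma detM2 (A B : M) : \det (A * B) = \det A * \det B.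
Proof. exact: det_mulmx. Qed.

Lemma detV2 (A : M) : \det A = 1 -> \det (A^-1) = 1.
Proof.
by move=> dA; rewrite (inv2E dA) det2E !mx2E; rewrite det2E in dA; rewrite -dA; ring.
Qed.

Definition umx (b : R) : M := mx2 1 b 0 1.
Definition wmx (c : R) : M := mx2 0 (- c^-1) c 0.

Lemma det_umx b : \det (umx b) = 1.
Proof. by rewrite det2E !mx2E; ring. Qed.

Lemma det_wmx c : c != 0 -> \det (wmx c) = 1.
Proof. by move=> c0; rewrite det2E !mx2E; field. Qed.

Lemma umxD b b' : umx b * umx b' = umx (b + b').
Proof. by rewrite /umx mulmx2; congr mx2; ring. Qed.

Lemma umx0 : umx 0 = 1.
Proof. by rewrite one2E. Qed.

Lemma umxV b : (umx b)^-1 = umx (- b).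
Proof. by rewrite (inv2E (det_umx b)) !mx2E oppr0. Qed.

(** The big Bruhat cell. It reduces invariance of the area to the translations and the maps z -> - 1
    / (c^2 z). *)
Lemma bruhat (A : M) : \det A = 1 -> A i1 i0 != 0 ->
  A = umx (A i0 i0 / A i1 i0) * wmx (A i1 i0) * umx (A i1 i1 / A i1 i0).
Proof.
rewrite det2E => dA c0; rewrite /umx /wmx !mulmx2 {1}(mx2_eta A).
move: (A i0 i0) (A i0 i1) (A i1 i0) (A i1 i1) dA c0 => a b c d dA c0.
have -> : b = (a * d - 1) / c by rewrite -dA; field.
by congr mx2; field.
Qed.

Definition mobius_den (A : M) (p : R * R) : R :=
  (A i1 i0 * p.1 + A i1 i1) ^+ 2 + (A i1 i0 * p.2) ^+ 2.

Lemma mobius_den_gt0 (A : M) (p : R * R) : \det A = 1 -> H2 p -> 0 < mobius_den A p.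
Proof.
rewrite det2E /H2 /mobius_den /= => dA p0.
have [c0|c0] := eqVneq (A i1 i0) 0.
  rewrite c0 mul0r add0r mul0r expr0n/= addr0 exprn_even_gt0//=.
  by apply: contraPneq dA => ->; rewrite c0 !mulr0 subr0 => /eqP; rewrite eq_sym oner_eq0.
rewrite ltr_wpDl ?sqr_ge0// exprn_even_gt0//= mulf_neq0// gt_eqF//.
Qed.

Lemma mobius_H2 (A : M) (p : R * R) : \det A = 1 -> H2 p -> H2 (mobius A p).
Proof. by move=> dA p0; rewrite /H2/= divr_gt0//; apply: mobius_den_gt0. Qed.

Lemma mobiusM (A B : M) (p : R * R) : \det A = 1 -> \det B = 1 -> H2 p ->
  mobius (A * B) p = mobius A (mobius B p).
Proof.
move=> dA dB p0.
have D1 := mobius_den_gt0 dB p0.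
have D2 := mobius_den_gt0 dA (mobius_H2 dB p0).
have D3 : 0 < mobius_den (A * B) p by apply: mobius_den_gt0 => //; rewrite detM2 dA dB mulr1.
move: D1 D2 D3 dA dB.
rewrite /mobius_den /mobius !mulmx2E !det2E.
move: (A i0 i0) (A i0 i1) (A i1 i0) (A i1 i1) => a b c d.
move: (B i0 i0) (B i0 i1) (B i1 i0) (B i1 i1) => a' b' c' d'.
case: p p0 => x y; rewrite /H2 /= => y0 D1 D2 D3 dA dB.
(* Write P + i Q and r + i s for the numerator and the denominator of the image of x + i y. By det =
   1 the height y equals Q r - P s; after this substitution the claim is an identity of rational
   functions. *)
have yE : y = a' * y * (c' * x + d') - (a' * x + b') * (c' * y).
  by rewrite -[LHS]mulr1 -dB; ring.
have XE : (a' * x + b') * (c' * x + d') + a' * c' * y ^+ 2 =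
    (a' * x + b') * (c' * x + d') + a' * y * (c' * y) by ring.
have rE : (c * a' + d * c') * x + (c * b' + d * d') = c * (a' * x + b') + d * (c' * x + d') by ring.
have sE : (c * a' + d * c') * y = c * (a' * y) + d * (c' * y) by ring.
have NE : ((a * a' + b * c') * x + (a * b' + b * d')) * (c * (a' * x + b') + d * (c' * x + d'))
   + (a * a' + b * c') * (c * a' + d * c') * y ^+ 2 =
   (a * (a' * x + b') + b * (c' * x + d')) * (c * (a' * x + b') + d * (c' * x + d')) +
   (a * (a' * y) + b * (c' * y)) * (c * (a' * y) + d * (c' * y)) by ring.
move: D1 D2 D3.
rewrite rE sE NE XE.
have -> : y / ((c' * x + d') ^+ 2 + (c' * y) ^+ 2) =
    (a' * y * (c' * x + d') - (a' * x + b') * (c' * y)) / ((c' * x + d') ^+ 2 + (c' * y) ^+ 2).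
  by rewrite -yE.
have -> : y / ((c * (a' * x + b') + d * (c' * x + d')) ^+ 2 + (c * (a' * y) + d * (c' * y)) ^+ 2) =
    (a' * y * (c' * x + d') - (a' * x + b') * (c' * y)) /
    ((c * (a' * x + b') + d * (c' * x + d')) ^+ 2 + (c * (a' * y) + d * (c' * y)) ^+ 2).
  by rewrite -yE.
move: (a' * x + b') (c' * x + d') (a' * y) (c' * y) => P r Q s.
move=> /gt_eqF/negbT D1 /gt_eqF/negbT D2 /gt_eqF/negbT D3.
have E : (c * ((P * r + Q * s) / (r ^+ 2 + s ^+ 2)) + d) ^+ 2 +
    (c * ((Q * r - P * s) / (r ^+ 2 + s ^+ 2))) ^+ 2 =
    ((c * P + d * r) ^+ 2 + (c * Q + d * s) ^+ 2) / (r ^+ 2 + s ^+ 2) by field.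
rewrite E; congr pair; field; by rewrite D1 D3.
Qed.

Lemma mobius1 (p : R * R) : mobius 1 p = p.
Proof.
by case: p => x y; rewrite /mobius one2E !mx2E/= !(mul0r, mul1r, add0r, addr0, expr1n, expr0n)/= !divr1 mulr1.
Qed.

Lemma mobiusN (A : M) (p : R * R) : mobius (- A) p = mobius A p.
Proof.
rewrite /mobius !mxE; congr pair; congr (_ / _); ring.
Qed.

Lemma mobiusK (A : M) (p : R * R) : \det A = 1 -> H2 p -> mobius A^-1 (mobius A p) = p.
Proof.
by move=> dA p0; rewrite -mobiusM// ?detV2// mulVr ?mobius1// det1_unit.
Qed.

Lemma mobiusKV (A : M) (p : R * R) : \det A = 1 -> H2 p -> mobius A (mobius A^-1 p) = p.
Proof.
by move=> dA p0; rewrite -mobiusM// ?detV2// mulrV ?mobius1// det1_unit.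
Qed.

(* 4 sinh^2 (d / 2), a rational substitute for the hyperbolic distance d. *)
Definition hgap (p q : R * R) : R :=
  ((p.1 - q.1) ^+ 2 + (p.2 - q.2) ^+ 2) / (p.2 * q.2).

Lemma hgapC p q : hgap p q = hgap q p.
Proof. by rewrite /hgap mulrC [in RHS]mulrC; congr (_ * _); [rewrite mulrC|ring]. Qed.

Lemma hgap_mobius (A : M) (p q : R * R) : \det A = 1 -> H2 p -> H2 q ->
  hgap (mobius A p) (mobius A q) = hgap p q.
Proof.
move=> dA p0 q0.
have D1 := mobius_den_gt0 dA p0.
have D2 := mobius_den_gt0 dA q0.
move: D1 D2 dA; rewrite /mobius_den /hgap /mobius det2E.
move: (A i0 i0) (A i0 i1) (A i1 i0) (A i1 i1) => a b c d.
case: p q p0 q0 => [x y] [x' y']; rewrite /H2 /= => y0 y0' D1 D2 dA.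
have XE u v : (a * u + b) * (c * u + d) + a * c * v ^+ 2 =
    (a * u + b) * (c * u + d) + a * v * (c * v) by ring.
have yE u v : v = a * v * (c * u + d) - (a * u + b) * (c * v).
  by rewrite -[LHS]mulr1 -dA; ring.
have dx : x - x' = (a * x + b) * (c * x' + d) - a * y * (c * y')
    - (a * x' + b) * (c * x + d) + a * y' * (c * y).
  by rewrite -[LHS]mulr1 -dA; ring.
have dy : y - y' = (a * x + b) * (c * y') + a * y * (c * x' + d)
    - (a * x' + b) * (c * y) - a * y' * (c * x + d).
  by rewrite -[LHS]mulr1 -dA; ring.
rewrite !XE dx dy.
move: D1 D2 y0 y0'.
rewrite [y in _ -> _ -> 0 < y -> _](yE x y) [y' in _ -> _ -> _ -> 0 < y' -> _](yE x' y').
have -> : y * y' = (a * y * (c * x + d) - (a * x + b) * (c * y)) *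
   (a * y' * (c * x' + d) - (a * x' + b) * (c * y')) by rewrite -!yE.
have -> w : y / w = (a * y * (c * x + d) - (a * x + b) * (c * y)) / w by rewrite -yE.
have -> w : y' / w = (a * y' * (c * x' + d) - (a * x' + b) * (c * y')) / w by rewrite -yE.
move: (a * x + b) (c * x + d) (a * y) (c * y) => P r Q s.
move: (a * x' + b) (c * x' + d) (a * y') (c * y') => P' r' Q' s'.
move=> /gt_eqF/negbT D1 /gt_eqF/negbT D2 /gt_eqF/negbT D3 /gt_eqF/negbT D4.
by field; rewrite D1 D2 D3 D4.
Qed.

End matrix2.

(** * Changes of variables through uniqueness of measures *)

Section density_image.
Context d d' (T : measurableType d) (T' : measurableType d') (R : realType).
Context (m : {measure set T -> \bar R}) (D : set T) (f : T -> R) (g : T -> T').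
Context (mD : measurable D) (mf : measurable_fun setT f)
  (f0 : forall x, 0 <= f x) (mg : measurable_fun setT g).

(** The image under g of the measure with density f on D. Bundled as a measure, it is determined by
    its values on intervals or rectangles, which is how every substitution below is proved. *)
Definition density_image (X : set T') : \bar R :=
  (\int[m]_(x in D `&` g @^-1` X) (f x)%:E)%E.

Let mpre X : measurable X -> measurable (D `&` g @^-1` X).
Proof. by move=> mX; apply: measurableI => //; rewrite -[X in measurable X]setTI; apply: mg. Qed.

Let di0 : density_image set0 = 0%E.
Proof. by rewrite /density_image preimage_set0 setI0 integral_set0. Qed.

Let di_ge0 X : (0 <= density_image X)%E.
Proof. by apply: integral_ge0 => x _; rewrite lee_fin. Qed.

Let di_sigma : semi_sigma_additive density_image.
Proof.
move=> F mF tF mUF.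
rewrite [X in _ --> X](_ : _ = \sum_(n <oo) density_image (F n))%E; last first.
  rewrite /density_image preimage_bigcup setI_bigcupr.
  rewrite ge0_integral_bigcup//.
  - by move=> k; exact: mpre.
  - by apply/measurable_EFinP; exact: measurable_funTS.
  - by move=> x _; rewrite lee_fin.
  - apply/trivIsetP => i j _ _ ij; rewrite setIACA setIid -preimage_setI.
    by move/trivIsetP : tF => /(_ i j Logic.I Logic.I ij) ->; rewrite preimage_set0 setI0.
by apply/cvg_closeP; split; [exact: is_cvg_nneseries|rewrite closeE].
Qed.

HB.instance Definition _ := isMeasure.Build _ _ _ density_image di0 di_ge0 di_sigma.

Definition density_image_measure : {measure set T' -> \bar R} := density_image.

End density_image.

Section lebesgue.
Context (R : realType).
Local Notation lam := (@lebesgue_measure R).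

Lemma lebesgue_measure_scale (k : R) (A : set R) : 0 < k -> measurable A ->
  lam ((fun x => x * k) @^-1` A) = (k^-1%:E * lam A)%E.
Proof.
move=> k0 mA.
have mk : measurable_fun setT (fun x : R => x * k) by exact: mulrr_measurable.
pose nu : {measure set (measurableTypeR R) -> \bar R} :=
  @density_image_measure _ _ (measurableTypeR R) (measurableTypeR R) R lam _ _ _ (@measurableT _ _) (@measurable_cst _ _ _ _ setT k) (fun=> ltW k0) mk.
have E : forall B, measurable B -> nu B = (k%:E * lam ((fun x => (x * k)%R) @^-1` B))%E.
  move=> B mB; rewrite /nu /= /density_image_measure /= /density_image setTI (_ : (fun=> _) = cst k%:E)// integral_cst//.
  by rewrite -[X in measurable X]setTI; exact: (mk measurableT).
have : lam A = nu A.
  apply: lebesgue_measure_unique => // _ [[a b]] _ <-.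
  rewrite E; last exact: measurable_itv.
  rewrite (_ : _ @^-1` _ = `](a / k), (b / k)]%classic); last first.
    by apply/seteqP; split=> x /=; rewrite !in_itv/= ltr_pdivrMr// ler_pdivlMr.
  rewrite !lebesgue_measure_itv/= !lte_fin ltr_pM2r ?invr_gt0//.
  case: ifPn => _; last by rewrite mule0.
  by rewrite -!EFinB -EFinM; congr (_%:E); field; rewrite gt_eqF.
move=> ->; rewrite E// muleA -EFinM mulVf ?gt_eqF// mul1e //.
Qed.

Lemma lebesgue_measure_affine (s k : R) (A : set R) : `|s| = 1 -> measurable A ->
  lam ((fun x => s * x + k) @^-1` A) = lam A.
Proof.
move=> s1 mA.
have mk : measurable_fun setT (fun x : R => s * x + k).
  by apply: measurable_funD => //; exact: mulrl_measurable.
pose nu : {measure set (measurableTypeR R) -> \bar R} :=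
  @density_image_measure _ _ (measurableTypeR R) (measurableTypeR R) R lam _ _ _ (@measurableT _ _) (@measurable_cst _ _ _ _ setT (1:R)) (fun=> ler01) mk.
have E : forall B, measurable B -> nu B = lam ((fun x => s * x + k) @^-1` B).
  move=> B mB; rewrite /nu /= /density_image_measure /= /density_image setTI (_ : (fun=> _) = cst 1%:E)// integral_cst ?mul1e//.
  by rewrite -[X in measurable X]setTI; exact: (mk measurableT).
rewrite -E//; apply/esym/lebesgue_measure_unique => // _ [[a b]] _ <-.
rewrite E; last exact: measurable_itv.
have [s0|s0] := leP 0 s.
  rewrite (ger0_norm s0) in s1; rewrite s1.
  rewrite (_ : _ @^-1` _ = `](a - k), (b - k)]%classic); last first.
    by apply/seteqP; split=> x /=; rewrite !in_itv/= mul1r; lra.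
  rewrite !lebesgue_measure_itv/= !lte_fin ltrD2r; case: ifPn => _//.
  by rewrite -!EFinB; congr (_%:E); ring.
rewrite (ltr0_norm s0) in s1; rewrite (_ : s = -1); last by rewrite -s1 opprK.
rewrite (_ : _ @^-1` _ = `[(k - b), (k - a)[%classic); last first.
  by apply/seteqP; split=> x /=; rewrite !in_itv/= mulN1r; lra.
rewrite !lebesgue_measure_itv/= !lte_fin ltrD2l ltrN2; case: ifPn => _//.
by rewrite -!EFinB; congr (_%:E); ring.
Qed.

End lebesgue.

(** * Hyperbolic area in the coordinates (x / y, ln y) *)

Section hyperbolic_measure.
Context (R : realType).
Local Notation lam := (@lebesgue_measure R).

(** The substitution t = ln y, dt = dy / y, checked on intervals with ln as a primitive. *)
Lemma lebesgue_ln_image (B : set R) : measurable B ->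
  (\int[lam]_(y in `]0%R, +oo[ `&` (@ln R) @^-1` B) (expR (- ln y))%:E)%E = lam B.
Proof.
move=> mB.
have mf : measurable_fun setT (fun y : R => expR (- ln y)).
  by apply: measurableT_comp => //; apply: measurable_funN.
pose nu := @density_image_measure _ _ (measurableTypeR R) (measurableTypeR R) R lam
  `]0, +oo[ _ _ (measurable_itv _) mf (fun x => expR_ge0 _) (@measurable_ln R).
apply/esym; apply: (@lebesgue_measure_unique _ nu) => // _ [[a b]] _ <-.
rewrite /nu /= /density_image_measure/= /density_image.
rewrite (_ : _ `&` _ = `](expR a), (expR b)]%classic); last first.
  apply/seteqP; split=> x /=; rewrite !in_itv/= ?andbT.
    by move=> [x0 /andP[ax xb]]; rewrite -[x]lnK ?posrE// ltr_expR ler_expR ax.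
  move=> /andP[ax xb]; have x0 : 0 < x by apply: lt_trans ax; exact: expR_gt0.
  by split=> //; rewrite -ltr_expR -ler_expR lnK ?posrE// ax.
rewrite lebesgue_measure_itv/= lte_fin.
case: ifPn => ab; last first.
  rewrite set_itv_ge ?integral_set0// bnd_simp ltr_expR//.
rewrite integral_itv_obnd_cbnd; last first.
  by apply/measurable_EFinP; exact: measurable_funTS.
rewrite (@continuous_FTC2 _ _ (@ln R)) ?ltr_expR ?expRK//.
- apply/continuous_within_itvP; rewrite ?ltr_expR//; split.
  + move=> x; rewrite in_itv/= => /andP[ax _].
    apply: continuous_comp; last exact: continuous_expR.
    by apply: continuousN; apply: continuous_ln; apply: lt_trans ax; exact: expR_gt0.
  + apply: cvg_at_right_filter; apply: continuous_comp; last exact: continuous_expR.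
    by apply: continuousN; apply: continuous_ln; exact: expR_gt0.
  + apply: cvg_at_left_filter; apply: continuous_comp; last exact: continuous_expR.
    by apply: continuousN; apply: continuous_ln; exact: expR_gt0.
- split.
  + move=> x; rewrite in_itv/= => /andP[ax _].
    have x0 : 0 < x by apply: lt_trans ax; exact: expR_gt0.
    by have [] := is_derive1_ln x0.
  + by apply: cvg_at_right_filter; apply: continuous_ln; exact: expR_gt0.
  + by apply: cvg_at_left_filter; apply: continuous_ln; exact: expR_gt0.
- move=> x; rewrite in_itv/= => /andP[ax _].
  have x0 : 0 < x by apply: lt_trans ax; exact: expR_gt0.
  by rewrite derive1E; have [_ ->] := is_derive1_ln x0; rewrite expRN lnK.
Qed.

Definition log_coord (p : R * R) : R * R := (p.1 * expR (- ln p.2), ln p.2).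

Lemma measurable_log_coord : measurable_fun setT log_coord.
Proof.
have mln : measurable_fun setT (fun p : R * R => ln p.2).
  exact: measurableT_comp.
apply/measurable_fun_pairP; split => //.
apply: measurable_funM => //; apply: measurableT_comp => //; exact: measurable_funN.
Qed.

Let H2E : @H2 R = setT `*` `]0, +oo[%classic.
Proof. by apply/seteqP; split => -[x y] /=; rewrite /H2/= in_itv/= andbT; [split|case]. Qed.

Lemma measurable_H2 : measurable (@H2 R).
Proof. by rewrite H2E; apply: measurableX => //; exact: measurable_itv. Qed.

(** The density 1 / y^2 on the half-plane, in a form that is nonnegative and visibly measurable on
    the whole plane. *)
Let dens (p : R * R) : R := expR (- ln p.2 - ln p.2).

Let mdens : measurable_fun setT dens.
Proof.
have mln : measurable_fun setT (fun p : R * R => ln p.2) by exact: measurableT_comp.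
apply: measurableT_comp => //; apply: measurable_funB => //; exact: measurable_funN.
Qed.

Let RR : measurableType _ := (measurableTypeR R * measurableTypeR R)%type.

Let nu : {measure set RR -> \bar R} :=
  @density_image_measure _ _ RR RR R (lam \x lam)%E _ _ _ measurable_H2 mdens
  (fun=> expR_ge0 _) measurable_log_coord.

(** For fixed y the condition x / y in A describes a set of length y times that of A. This absorbs
    one of the two factors 1 / y, and the remaining dy / y is Lebesgue measure in ln y. *)
Lemma log_coord_rect (A B : set R) : measurable A -> measurable B ->
  nu (A `*` B) = (lam A * lam B)%E.
Proof.
move=> mA mB.
rewrite /nu /= /density_image_measure /= /density_image.
rewrite integral_mkcond.
set f := (f in integral _ _ f).
have mf : measurable_fun setT f.
  have mS : measurable (H2 (R:=R) `&` log_coord @^-1` (A `*` B)).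
    apply: measurableI; first exact: measurable_H2.
    by rewrite -[X in measurable X]setTI; apply: measurable_log_coord => //; exact: measurableX.
  apply: (measurable_restrictT (fun x : R * R => (dens x)%:E) mS).1.
  by apply/measurable_EFinP; exact: measurable_funTS.
have f0 x : (0 <= f x)%E.
  by apply: erestrict_ge0 => ? _; rewrite lee_fin expR_ge0.
rewrite fubini_tonelli1// fubini_tonelli//.
have mI : measurable (`]0%R, +oo[ `&` @ln R @^-1` B).
  by apply: measurableI => //; rewrite -[X in measurable X]setTI; exact: measurable_ln.
rewrite -(lebesgue_ln_image mB) muleC.
transitivity (\int[lam]_(y in `]0%R, +oo[ `&` @ln R @^-1` B) ((expR (- ln y))%:E * lam A))%E; last first.
  have me : measurable_fun (`]0%R, +oo[ `&` @ln R @^-1` B) (fun y => (expR (- ln y))%:E).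
    by apply/measurable_EFinP; apply: measurable_funTS; apply: measurableT_comp => //; exact: measurable_funN.
  have mA0 : (0 <= lam A)%E by exact: measure_ge0.
  have e0 (y : R) : (`]0%R, +oo[ `&` @ln R @^-1` B) y -> (0 <= (expR (- ln y))%:E)%E.
    by move=> _; rewrite lee_fin expR_ge0.
  exact: (ge0_integralZr lam mI me e0 mA0).
rewrite [RHS]integral_mkcond; apply: eq_integral => y _.
rewrite patchE; case: ifPn; last first.
  move=> yB; apply: integral0_eq => x _; rewrite /f patchE ifF//.
  apply/negbTE; apply: contra yB; rewrite !inE /= /log_coord /H2 /= => -[y0 [_ yB]].
  by rewrite in_itv/= andbT.
rewrite inE/= in_itv/= andbT => -[y0 yB].
transitivity (\int[lam]_(x in (fun x => (x * expR (- ln y))%R) @^-1` A) (dens (x, y))%:E)%E.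
  rewrite [RHS]integral_mkcond; apply: eq_integral => x _; rewrite /f !patchE.
  congr (if _ then _ else _); apply/idP/idP; rewrite !inE /= /log_coord/= /H2/=; first by case=> _ [].
  by [].
rewrite /dens/= (_ : (fun=> _) = cst (expR (- ln y - ln y))%:E)// integral_cst//; last first.
  by rewrite -[X in measurable X]setTI; exact: mulrr_measurable.
have := lebesgue_measure_scale (expR_gt0 (- ln y)) mA => E.
apply: (etrans (congr1 (mule (expR (- ln y - ln y))%:E) E)).
rewrite muleA -EFinM; congr (_%:E * _)%E.
by rewrite -expRN opprK -expRD addrNK.
Qed.

(** [hyp_area] extended to a bundled measure on the plane, so that monotonicity and countable
    additivity become available. *)
Definition hyp_measure : {measure set RR -> \bar R} :=
  @density_image_measure _ _ RR RR R (lam \x lam)%E _ _ _ measurableT mdens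
  (fun=> expR_ge0 _) (@measurable_id _ RR setT).

Lemma hyp_measureE (S : set (R * R)) : S `<=` @H2 R -> hyp_area S = hyp_measure S.
Proof.
move=> S2; rewrite /hyp_measure /= /density_image_measure /= /density_image setTI.
apply: eq_integral => -[x y]; rewrite inE => /S2; rewrite /H2/= => y0.
by rewrite /dens/= expRD !expRN lnK// expr2 invfM.
Qed.

Definition exp_coord (q : R * R) : R * R := (q.1 * expR q.2, expR q.2).

Lemma measurable_exp_coord : measurable_fun setT exp_coord.
Proof.
have mexp : measurable_fun setT (fun p : R * R => expR p.2) by exact: measurableT_comp.
by apply/measurable_fun_pairP; split => //; exact: measurable_funM.
Qed.

Lemma log_coordK p : H2 p -> exp_coord (log_coord p) = p.
Proof.
case: p => x y; rewrite /H2/= /exp_coord/log_coord/= => y0.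
by rewrite expRN lnK// divfK ?gt_eqF.
Qed.

(* In the coordinates (x / y, ln y) the area element dx dy / y^2 is Lebesgue measure and the
   generators of SL(2,R) act by shears and reflections, so that invariance of the area follows
   from Fubini and the invariance of the one-dimensional Lebesgue measure. *)
Lemma hyp_area_exp_coord (S : set (R * R)) : measurable S -> S `<=` @H2 R ->
  hyp_area S = (lam \x lam)%E (exp_coord @^-1` S).
Proof.
move=> mS S2.
have mP : measurable (exp_coord @^-1` S).
  by rewrite -[X in measurable X]setTI; exact: measurable_exp_coord.
rewrite (@product_measure_unique _ _ _ _ _ lam lam nu log_coord_rect _ mP).
rewrite /nu /= /density_image_measure /= /density_image /hyp_area.
rewrite (_ : _ `&` _ = S); last first.
  apply/seteqP; split => p /=; first by move=> [p2]; rewrite log_coordK.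
  by move=> Sp; have p2 := S2 _ Sp; rewrite log_coordK.
apply: eq_integral => -[x y]; rewrite inE => /S2; rewrite /H2/= => y0.
by rewrite /dens/= expRD !expRN lnK// expr2 invfM.
Qed.

End hyperbolic_measure.

(** * Invariance of the area under SL(2,R) *)

Section invariance.
Context (R : realType).
Local Notation lam := (@lebesgue_measure R).
Local Notation L2 := (lam \x lam)%E.
Let RR : measurableType _ := (measurableTypeR R * measurableTypeR R)%type.
Implicit Types X S : set (R * R).

Lemma mfun_pair (f g : R * R -> R) : measurable_fun setT f -> measurable_fun setT g ->
  measurable_fun setT (fun q : R * R => (f q, g q)).
Proof. by move=> mf mg; apply/measurable_fun_pairP. Qed.

Lemma lebesgue2_swap X : measurable X -> L2 X = (lam \x^ lam)%E X.
Proof.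
move=> mX; apply: (@product_measure_unique _ _ (measurableTypeR R) (measurableTypeR R) R lam lam (lam \x^ lam)%E) => // A B mA mB.
by rewrite /= product_measure2E.
Qed.

Lemma lebesgue2_shear_v (s : R) (h : R -> R) X : `|s| = 1 -> measurable X ->
  L2 ((fun q : R * R => (q.1, s * q.2 + h q.1)) @^-1` X) = L2 X.
Proof.
move=> s1 mX; rewrite /product_measure1; apply: eq_integral => u _ /=.
rewrite -(lebesgue_measure_affine (h u) s1 (measurable_xsection u mX)); congr (lam _).
Qed.

Lemma lebesgue2_shear_u (s : R) (h : R -> R) X : `|s| = 1 -> measurable_fun setT h -> measurable X ->
  L2 ((fun q : R * R => (s * q.1 + h q.2, q.2)) @^-1` X) = L2 X.
Proof.
move=> s1 mh mX; rewrite !lebesgue2_swap//; last first.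
  rewrite -[X in measurable X]setTI.
  have mm : measurable_fun setT (fun q : R * R => (s * q.1 + h q.2, q.2)).
    apply: mfun_pair => //; apply: measurable_funD; last exact: measurableT_comp.
    exact: measurable_funM.
  exact: mm.
rewrite /product_measure2; apply: eq_integral => u _ /=.
rewrite -(lebesgue_measure_affine (h u) s1 (measurable_ysection u mX)); congr (lam _).
Qed.

Definition area_preserving (f : R * R -> R * R) := forall S, measurable S -> S `<=` @H2 R ->
  measurable (@H2 R `&` f @^-1` S) /\ hyp_area (@H2 R `&` f @^-1` S) = hyp_area S.

(** Here g is the map f read in the coordinates (x / y, ln y), where invariance concerns plane
    Lebesgue measure. *)
Lemma area_preserving_coord (f g : R * R -> R * R) :
  (forall q, f (exp_coord q) = exp_coord (g q)) -> measurable_fun setT g ->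
  (forall X, measurable X -> L2 (g @^-1` X) = L2 X) -> area_preserving f.
Proof.
move=> fg mg L2g S mS S2.
have mP X : measurable X -> measurable (@exp_coord R @^-1` X).
  by move=> mX; rewrite -[X in measurable X]setTI; exact: measurable_exp_coord.
have mQ X : measurable X -> measurable (g @^-1` X).
  by move=> mX; rewrite -[X in measurable X]setTI; exact: mg.
have E : @H2 R `&` f @^-1` S =
    @H2 R `&` @log_coord R @^-1` (g @^-1` (@exp_coord R @^-1` S)).
  apply/seteqP; split => p /= [p2]; rewrite -fg log_coordK//.
have mS' : measurable (@H2 R `&` f @^-1` S).
  rewrite E; apply: measurableI; first exact: measurable_H2.
  by rewrite -[X in measurable X]setTI; exact: (@measurable_log_coord R measurableT _ (mQ _ (mP _ mS))).
split => //.
rewrite (hyp_area_exp_coord mS S2) (hyp_area_exp_coord mS'); last exact: subIsetl.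
rewrite -(L2g (@exp_coord R @^-1` S)); last exact: mP.
congr (L2 _); apply/seteqP; split => q /=; rewrite fg; first by case.
by split => //; rewrite /H2/=; exact: expR_gt0.
Qed.

(** In these coordinates z -> z + b shifts u by b exp (- v) and fixes v: a horizontal shear. *)
Lemma area_preserving_umx (b : R) : area_preserving (mobius (umx b)).
Proof.
apply: (@area_preserving_coord _ (fun q => (1 * q.1 + b * expR (- q.2), q.2))).
- case=> u v; rewrite /mobius /exp_coord /umx !mx2E /=.
  have -> : (0 * (u * expR v) + 1) ^+ 2 + (0 * expR v) ^+ 2 = 1 by ring.
  have e0 := lt0r_neq0 (expR_gt0 v).
  by rewrite expRN; congr pair; field; rewrite ?e0.
- have m1 : measurable_fun setT (fun q : R * R => 1 * q.1 + b * expR (- q.2)).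
    apply: measurable_funD; first exact: measurable_funM.
    by apply: measurable_funM => //; apply: measurableT_comp => //; exact: measurable_funN.
  exact: (mfun_pair m1 measurable_snd).
- move=> X mX; apply: (lebesgue2_shear_u (normr1 _) (h := fun v => b * expR (- v))) => //.
  by apply: measurable_funM => //; apply: measurableT_comp => //; exact: measurable_funN.
Qed.

(** Since |z|^2 = y^2 (1 + u^2), the map z -> - 1 / (c^2 z) sends ln y to - ln y - ln (c^2 (1 +
    u^2)) and u to - u: a reflected vertical shear composed with a reflection. *)
Lemma area_preserving_wmx (c : R) : c != 0 -> area_preserving (mobius (wmx c)).
Proof.
move=> c0.
apply: (@area_preserving_coord _ (fun q => (-1 * q.1 + 0, -1 * q.2 - ln (c ^+ 2 * (1 + q.1 ^+ 2))))).
- case=> u v; rewrite /mobius /exp_coord /wmx !mx2E /=.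
  have e0 := expR_gt0 v.
  have k0 : 0 < c ^+ 2 * (1 + u ^+ 2).
    by rewrite mulr_gt0 ?exprn_even_gt0// ltr_wpDr ?sqr_ge0.
  rewrite mulN1r addr0 expRD mulN1r !expRN lnK//.
  have e1 := lt0r_neq0 e0; have k1 : 1 + u ^+ 2 != 0 by rewrite gt_eqF// ltr_wpDr ?sqr_ge0.
  have -> : (c * (u * expR v)) ^+ 2 + (c * expR v) ^+ 2 = c ^+ 2 * (1 + u ^+ 2) * expR v ^+ 2 by ring.
  by congr pair; field; rewrite ?c0 ?e1 ?k1.
- have ml : measurable_fun setT (fun q : R * R => ln (c ^+ 2 * (1 + q.1 ^+ 2))).
    apply: measurableT_comp => //; apply: measurable_funM => //; apply: measurable_funD => //.
    exact: measurable_funX.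
  apply: (mfun_pair (f := fun q => -1 * q.1 + 0) (g := fun q => -1 * q.2 - ln (c ^+ 2 * (1 + q.1 ^+ 2)))); first by apply: measurable_funD => //; exact: measurable_funM.
  by apply: measurable_funB => //; apply: measurable_funM.
- move=> X mX.
  have n1 : `|-1 : R| = 1 by rewrite normrN1.
  have S1 := lebesgue2_shear_v (s := -1) (fun u => - ln (c ^+ 2 * (1 + u ^+ 2))) n1 mX.
  have mY : measurable ((fun q : R * R => (q.1, -1 * q.2 + - ln (c ^+ 2 * (1 + q.1 ^+ 2)))) @^-1` X).
    rewrite -[X in measurable X]setTI.
    have mm : measurable_fun setT (fun q : R * R => (q.1, -1 * q.2 + - ln (c ^+ 2 * (1 + q.1 ^+ 2)))).
      apply: mfun_pair => //; apply: measurable_funD; first exact: measurable_funM.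
      apply: measurable_funN; apply: measurableT_comp => //; apply: measurable_funM => //; apply: measurable_funD => //.
      exact: measurable_funX.
    exact: mm.
  have S2 := lebesgue2_shear_u (s := -1) (h := fun=> 0) n1 (measurable_cst _) mY.
  rewrite -S1 -S2; congr (L2 _); apply/seteqP; split => q /=; by rewrite !mulN1r !addr0 ?sqrrN.
Qed.

Lemma area_preserving_comp (f g h : R * R -> R * R) : area_preserving f -> area_preserving g ->
  (forall p, H2 p -> h p = f (g p)) -> (forall p, H2 p -> H2 (g p)) -> area_preserving h.
Proof.
move=> af ag hE g2 S mS S2.
have [mf Ef] := af S mS S2.
have [mg Eg] := ag _ mf (@subIsetl _ _ _).
rewrite (_ : _ `&` _ = @H2 R `&` g @^-1` (@H2 R `&` f @^-1` S)) ?Eg//.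
by apply/seteqP; split => p /= [p2]; rewrite hE//; [move=> Sp; split=> //; split=> //; exact: g2|case].
Qed.

Lemma area_preserving_mobius (A : 'M[R]_2) : \det A = 1 -> area_preserving (mobius A).
Proof.
have H (B : 'M[R]_2) : \det B = 1 -> B i1 i0 != 0 -> area_preserving (mobius B).
  move=> dB c0.
  have dW := det_wmx c0.
  have dU := @det_umx R.
  apply: (@area_preserving_comp (mobius (umx (B i0 i0 / B i1 i0) * wmx (B i1 i0)))
    (mobius (umx (B i1 i1 / B i1 i0)))).
  - apply: (area_preserving_comp (area_preserving_umx (B i0 i0 / B i1 i0)) (area_preserving_wmx c0)).
      by move=> p p2; rewrite mobiusM.
    by move=> p p2; apply: mobius_H2.
  - exact: area_preserving_umx.
  - by move=> p p2; rewrite {1}(bruhat dB c0) mobiusM// detM2 dW dU mulr1.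
  - by move=> p p2; apply: mobius_H2.
move=> dA; have [c0|c0] := eqVneq (A i1 i0) 0; last exact: H.
(* An upper triangular A is written as (A w) w^-1, where both factors have a non-zero lower left
   entry. *)
have dW1 : \det (wmx 1 : 'M[R]_2) = 1 by rewrite det_wmx ?oner_eq0.
have dB : \det (A * wmx 1) = 1 by rewrite detM2 dA dW1 mulr1.
have ad : A i1 i1 != 0.
  by apply: contraPneq dA => d0; rewrite det2E c0 d0 !mulr0 subr0 => /eqP; rewrite eq_sym oner_eq0.
have dV := detV2 dW1.
apply: (@area_preserving_comp (mobius (A * wmx 1)) (mobius (wmx 1)^-1)).
- by apply: H => //; rewrite mulmx2E !mx2E c0 mul0r add0r mulr1.
- by apply: H => //; rewrite (inv2E dW1) !mx2E oppr_eq0 oner_eq0.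
- by move=> p p2; rewrite -mobiusM// mulrK// det1_unit.
- by move=> p p2; apply: mobius_H2.
Qed.

End invariance.

(** * Discrete groups of finite coarea *)
Section discrete_groups.
Context (R : realType).
Local Notation M := 'M[R]_2.
Implicit Types (G : set M) (A B : M) (p q w : R * R).

Lemma finite_set_inj (T : Type) (F : finType) (S : set T) (f : T -> F) :
  {in S &, injective f} -> finite_set S.
Proof. by move=> /inj_card_eq /eq_finite_set <-; exact: finite_finset. Qed.

Definition entry_bound (C : R) : set M := [set A | forall i j, `|A i j| <= C].

(** Pigeonhole on a grid of mesh h = e / (2 D). For A and B in one cell the entries of A^-1 (A - B)
    are below 2 D h = e, as A^-1 has the entries of A up to order and sign; so A^-1 B is 1. *)
Lemma discrete_finite G (C : R) : SL2_subgroup G -> discrete_mx G ->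
  finite_set (G `&` entry_bound C).
Proof.
move=> [G1 _ Gd GM GV] /(_ 1 G1)[e [e0 He]].
pose D := `|C| + 1.
have D0 : 0 < D by rewrite ltr_pwDr.
pose h := e / (2 * D).
have h0 : 0 < h by rewrite divr_gt0 ?mulr_gt0.
pose N := Num.truncn (2 * D / h).
pose f A : {ffun 'I_2 * 'I_2 -> 'I_N.+1} := [ffun x => inord (Num.truncn ((A x.1 x.2 + D) / h))].
apply: (@finite_set_inj _ _ _ f) => A B; rewrite !inE => -[GA bA] [GB bB] /ffunP fAB.
have bD X : entry_bound C X -> forall i j, - D <= X i j <= D.
  move=> bX i j; rewrite -ler_norml (le_trans (bX i j))// (le_trans (ler_norm C))//.
  by rewrite lerDl.
have tb X : entry_bound C X -> forall i j, 0 <= (X i j + D) / h /\ (Num.truncn ((X i j + D) / h) < N.+1)%N.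
  move=> bX i j; have /andP[X1 X2] := bD X bX i j; split.
    by rewrite divr_ge0 ?(ltW h0)// -lerBlDr add0r.
  rewrite ltnS; apply: le_truncn; rewrite ler_pM2r ?invr_gt0//.
  by move: X2; lra.
have close i j : `|A i j - B i j| < h.
  have [a0 aN] := tb A bA i j; have [b0 bN] := tb B bB i j.
  have := fAB (i, j); rewrite !ffunE/= => /(congr1 val) /=; rewrite !inordK// => E.
  have /andP[a1 a2] := truncn_itv a0; have /andP[b1 b2] := truncn_itv b0.
  move: a1 a2 b1 b2; rewrite E -!natr1.
  rewrite !ler_pdivlMr// !ltr_pdivrMr// !mulrDl ?mul1r.
  by rewrite ltr_norml; lra.
have dA := Gd A GA.
have -> : B = A * (A^-1 * B) by rewrite mulVKr// det1_unit.
rewrite (He (A^-1 * B)) ?mulr1//; first by apply: GM => //; exact: GV.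
move=> i j.
have -> : (1 : M) i j - (A^-1 * B) i j = (A^-1 * (A - B)) i j.
  by rewrite mulrBr mulVr ?det1_unit// !mxE.
rewrite mulmx2E !mxE.
apply: le_lt_trans (ler_normD _ _) _; rewrite !normrM.
have bV k l : `|A^-1 k l| <= D.
  have nD X k' l' : entry_bound C X -> `|X k' l'| <= D.
    by move=> /bD /(_ k' l'); rewrite ler_norml.
  rewrite (inv2E dA); case: (I2_cases k) => ->; case: (I2_cases l) => ->;
  by rewrite mx2E ?normrN; exact: nD.
have -> : e = D * h + D * h.
  by rewrite /h; field; rewrite gt_eqF.
apply: ltrD; apply: le_lt_trans (_ : D * `|_| < _).
- by apply: ler_wpM2r => //.
- by rewrite ltr_pM2l//.
- by apply: ler_wpM2r => //.
- by rewrite ltr_pM2l//.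
Qed.

Lemma discrete_countable G : SL2_subgroup G -> discrete_mx G -> countable G.
Proof.
move=> sG dG.
have -> : G = \bigcup_n (G `&` entry_bound n%:R).
  apply/seteqP; split => [A GA|A [n _ []]//].
  exists (Num.truncn (\sum_i \sum_j `|A i j|)).+1 => //; split => // i j.
  have s0 k : 0 <= \sum_j `|A k j| by apply: sumr_ge0.
  apply: ltW; apply: le_lt_trans (truncnS_gt _).
  rewrite (bigD1 i)//= (bigD1 j)//= -addrA lerDl addr_ge0// sumr_ge0//.
by apply: bigcup_countable => // n _; exact/finite_set_countable/discrete_finite.
Qed.

Lemma hgap_ge0 p q : H2 p -> H2 q -> 0 <= hgap p q.
Proof.
move=> p0 q0; rewrite /hgap divr_ge0//; first by rewrite addr_ge0 ?sqr_ge0.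
by rewrite mulr_ge0// ltW.
Qed.

(** A substitute for the triangle inequality, as [hgap] is not a metric. Points with small [hgap]
    have comparable heights, which allows the denominators to be exchanged. *)
Lemma hgap_triangle p q w : H2 p -> H2 q -> H2 w ->
  hgap p w <= 4 * (hgap p q * hgap q w + hgap p q + hgap q w).
Proof.
move=> p0 q0 w0; have := hgap_ge0 p0 q0; have := hgap_ge0 q0 w0.
case: p q w p0 q0 w0 => [a b] [x y] [c d]; rewrite /H2/= => b0 y0 d0 e20 e10.
have E1 : (a - x) ^+ 2 + (b - y) ^+ 2 = hgap (a, b) (x, y) * (b * y).
  by rewrite /hgap/= divfK// gt_eqF// mulr_gt0.
have E2 : (x - c) ^+ 2 + (y - d) ^+ 2 = hgap (x, y) (c, d) * (y * d).
  by rewrite /hgap/= divfK// gt_eqF// mulr_gt0.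
rewrite {1}/hgap/= ler_pdivrMr ?mulr_gt0//.
move: (hgap (a, b) (x, y)) (hgap (x, y) (c, d)) e10 e20 E1 E2 => e1 e2 e10 e20 E1 E2.
have yb : y <= (e1 + 2) * b.
  rewrite -(ler_pM2r y0); have := sqr_ge0 (a - x); have := sqr_ge0 b; nra.
have yd : y <= (e2 + 2) * d.
  rewrite -(ler_pM2r y0); have := sqr_ge0 (x - c); have := sqr_ge0 d; nra.
have h1 : e1 * (b * y) <= e1 * (b * ((e2 + 2) * d)) by rewrite ler_wpM2l// ler_pM2l.
have h2 : e2 * (y * d) <= e2 * ((e1 + 2) * b * d) by rewrite ler_wpM2l// ler_pM2r.
have := sqr_ge0 (a - x - (x - c)); have := sqr_ge0 (b - y - (y - d)); nra.
Qed.

Definition hball (e : R) (z : R * R) : set (R * R) := [set p | H2 p /\ hgap p z < e].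

Lemma measurable_hball e z : H2 z -> measurable (hball e z).
Proof.
move=> z0.
have -> : hball e z = @H2 R `&`
   (fun p : R * R => e * (p.2 * z.2) - ((p.1 - z.1) ^+ 2 + (p.2 - z.2) ^+ 2)) @^-1` `]0, +oo[.
  apply/seteqP; split => p /= [p0]; rewrite /hball/hgap/= in_itv/= andbT ltr_pdivrMr ?mulr_gt0// subr_gt0//.
apply: measurableI; first exact: measurable_H2.
rewrite -[X in measurable X]setTI.
have mf : measurable_fun setT (fun p : R * R => e * (p.2 * z.2) - ((p.1 - z.1) ^+ 2 + (p.2 - z.2) ^+ 2)).
  apply: measurable_funB.
    apply: measurable_funM => //; exact: measurable_funM.
  by apply: measurable_funD; apply: measurable_funX; apply: measurable_funB.
by apply: mf => //; exact: measurable_itv.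
Qed.

Lemma hyp_area_hball e z : H2 z -> 0 < e <= 1 ->
  (((e ^+ 2) / 16)%:E <= hyp_area (hball e z))%E.
Proof.
move=> z0 /andP[e0 e1]; case: z z0 => x y; rewrite /H2/= => y0.
(* A Euclidean box of width 2 k y and height k y standing on the centre fits into the ball, because
   2 k^2 <= e / 2 when e <= 1. *)
pose k := e / 2.
pose Bx := `](x - k * y), (x + k * y)]%classic `*` `]y, ((1 + k) * y)]%classic.
have k0 : 0 < k by rewrite divr_gt0.
have mBx : measurable Bx by apply: measurableX; exact: measurable_itv.
have ky : 0 < k * y by rewrite mulr_gt0.
have sub : Bx `<=` hball e (x, y).
  move=> [a b] [/=]; rewrite !in_itv/= => /andP[a1 a2] /andP[b1 b2].
  have b0 : 0 < b by lra.
  split => //; rewrite /hgap/= ltr_pdivrMr ?mulr_gt0//.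
  have h1 : (a - x) ^+ 2 <= (k * y) ^+ 2.
    by rewrite -ler_sqrt ?sqr_ge0// !sqrtr_sqr (gtr0_norm ky) ler_norml; lra.
  have h2 : (b - y) ^+ 2 <= (k * y) ^+ 2.
    by rewrite -ler_sqrt ?sqr_ge0// !sqrtr_sqr (gtr0_norm ky) ler_norml; lra.
  apply: (@le_lt_trans _ _ (2 * (k * y) ^+ 2)); first by lra.
  apply: (@le_lt_trans _ _ (e / 2 * y ^+ 2)).
    have -> : 2 * (k * y) ^+ 2 = e * (e / 2 * y ^+ 2) by rewrite /k; field.
    by rewrite ler_piMl// mulr_ge0 ?sqr_ge0// divr_ge0// ltW.
  rewrite expr2 mulrA -mulrA -mulrA.
  have : 0 < e * (y * y) by rewrite !mulr_gt0.
  have : e * (y * y) <= e * (b * y) by rewrite ler_pM2l// ler_pM2r// ltW.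
  by nra.
apply: (@le_trans _ _ (hyp_area Bx)); last first.
  rewrite !hyp_measureE; last 2 first.
  - by move=> p [].
  - by move=> p /sub[].
  by apply: le_measure; rewrite ?inE//; exact: measurable_hball.
pose cc : R := ((1 + k) * y) ^- 2.
apply: (@le_trans _ _ (\int[(@lebesgue_measure R \x @lebesgue_measure R)%E]_(p in Bx) cc%:E)%E).
  rewrite (_ : (fun=> cc%:E) = cst cc%:E)// integral_cst//.
  rewrite [X in (_ <= _ * X)%E]product_measure1E; [|exact: measurable_itv|exact: measurable_itv].
  rewrite /=.
  rewrite !lebesgue_measure_itv/= !lte_fin.
  rewrite !ifT; last 2 first.
  - by lra.
  - by lra.
  rewrite -!EFinD -!EFinM lee_fin /cc.
  have -> : x + k * y - (x - k * y) = 2 * (k * y) by ring.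
  have -> : (1 + k) * y - y = k * y by ring.
  have -> : ((1 + k) * y) ^- 2 * (2 * (k * y) * (k * y)) = 2 * k ^+ 2 / (1 + k) ^+ 2.
    have k1 : 1 + k != 0 by rewrite gt_eqF// addr_gt0.
    by have y1 := lt0r_neq0 y0; field; rewrite k1 y1.
  rewrite ler_pdivlMr; last by rewrite exprn_gt0// addr_gt0.
  have -> : e = 2 * k by rewrite /k; field.
  have : (1 + k) ^+ 2 <= 4.
    have -> : 4 = 2 ^+ 2 :> R by ring.
    by rewrite ler_pXn2r// ?nnegrE; rewrite /k; lra.
  by have := sqr_ge0 k; nra.
apply: ge0_le_integral => //.
- by move=> p _; rewrite lee_fin invr_ge0 sqr_ge0.
- apply/measurable_EFinP. 
  apply: (@eq_measurable_fun _ _ _ _ _ (fun p : R * R => expR (- ln p.2 - ln p.2))).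
    move=> [a b]; rewrite inE /Bx/= !in_itv/= => -[_ /andP[b1 _]].
    have b0 : 0 < b by lra.
    by rewrite expRD !expRN lnK// expr2 invfM.
  apply: measurable_funTS; apply: measurableT_comp => //.
  by apply: measurable_funB; [apply: measurable_funN|]; exact: measurableT_comp.
- move=> [a b] [_]; rewrite /= ?in_itv/= => /andP[b1 b2]; rewrite lee_fin /cc.
  have b0 : 0 < b by lra.
  by rewrite lef_pV2 ?posrE ?exprn_gt0//; [rewrite ler_pXn2r// ?nnegrE ltW//; lra|lra].
Qed.

(* The pieces of disjoint balls cut out by the translates of F can be moved back into F, where
   they stay disjoint. *)
Lemma packing G (e : R) : SL2_subgroup G -> discrete_mx G -> finite_area G -> 0 < e ->
  exists N, forall (m : nat) (z : nat -> R * R),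
    (forall i, (i < m)%N -> H2 (z i)) ->
    (forall i j A, (i < m)%N -> (j < m)%N -> G A -> hgap (z i) (mobius A (z j)) < e ->
       i = j /\ (A = 1 \/ A = -1)) ->
    (m <= N)%N.
Proof.
move=> sG dG [F [mF F2 Ffin covF]] e0.
have [G1 GN1 Gd GM GV] := sG.
have /countable_injP[f finj] := discrete_countable sG dG.
have [g gP] : exists g : nat -> M, forall n, G (g n) /\ (forall A, G A -> f A = n -> g n = A).
  suff H n : exists B, G B /\ (forall A, G A -> f A = n -> B = A).
    by exists (fun n => projT1 (cid (H n))) => n; exact: projT2 (cid (H n)).
  have [[A [GA fA]]|nA] := pselect (exists A, G A /\ f A = n).
    by exists A; split => // B GB fB; apply: finj; rewrite ?inE// fA fB.
  by exists 1; split => // A GA fA; case: nA; exists A.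
have Gg n : G (g n) by have [] := gP n.
have dg n : \det (g n) = 1 by exact: Gd.
have gsurj A : G A -> exists n, g n = A.
  by move=> GA; exists (f A); have [_ /(_ A GA erefl)] := gP (f A).
(* Two points within d <= 1 of a common point have [hgap] at most 4 (d^2 + d + d) <= 12 d < e. *)
pose d := Num.min 1 e / 24.
have d0 : 0 < d by rewrite divr_gt0// lt_min ltr01 e0.
have d1 : d <= 1.
  have : Num.min 1 e <= 1 by rewrite ge_min lexx.
  by rewrite /d; lra.
have d12 : 12 * d < e.
  have : Num.min 1 e <= e by rewrite ge_min lexx orbT.
  by rewrite /d; lra.
pose a : R := d ^+ 2 / 16.
have a0 : 0 < a by rewrite divr_gt0// exprn_gt0.
have Fnum : hyp_area F \is a fin_num.
  by rewrite ge0_fin_numE// hyp_measureE.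
pose r : R := fine (hyp_area F).
exists (Num.truncn (r / a)) => m z z2 sep.
pose R_ i := hball d (z i).
pose T_ n := @H2 R `&` mobius (g n)^-1 @^-1` F.
have dgV n : \det (g n)^-1 = 1 by apply: detV2.
have mT n : measurable (T_ n) by have [] := area_preserving_mobius (dgV n) mF F2.
have mR i : (i < m)%N -> measurable (R_ i) by move=> im; exact: measurable_hball (z2 i im).
have UT : \bigcup_n T_ n = @H2 R.
  apply/seteqP; split => [p [n _ []]//|p p0].
  have [A [q [GA Fq pE]]] := covF p p0.
  have [n nA] := gsurj A GA; exists n => //; split => //=.
  by rewrite pE -nA mobiusK//; exact: F2.
pose P_ i := fun n => R_ i `&` seqDU T_ n.
pose Q_ i := fun n => @H2 R `&` mobius (g n) @^-1` P_ i n.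
have P2 i n : P_ i n `<=` @H2 R by move=> p [[]].
have mP i n : (i < m)%N -> measurable (P_ i n).
  by move=> im; apply: measurableI; [exact: mR|exact: seqDU_measurable].
have PE i : (i < m)%N -> R_ i = \bigcup_n P_ i n.
  move=> im; rewrite -setI_bigcupr -seqDU_bigcup_eq UT; apply/esym/setIidPl.
  by move=> p [].
have tP i : trivIset setT (P_ i).
  by apply: trivIset_setIl; exact: trivIset_seqDU.
have mQ i n : (i < m)%N -> measurable (Q_ i n).
  by move=> im; have [] := area_preserving_mobius (dg n) (mP i n im) (P2 i n).
have aQ i n : (i < m)%N -> hyp_area (Q_ i n) = hyp_area (P_ i n).
  by move=> im; have [] := area_preserving_mobius (dg n) (mP i n im) (P2 i n).
have Q2 i n : Q_ i n `<=` @H2 R by move=> p [].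
have QF i n : Q_ i n `<=` F.
  move=> p [p0 [_ []]] [_ /=]; by rewrite mobiusK.
(* A common point brings z i close to the image of z j under g_n g_k^-1, so i = j and g_n = g_k up
   to sign. As [seqDU] made the pieces of one ball disjoint, n = k follows even if the enumeration
   of G repeats an isometry. *)
have Qdisj i j n k p : (i < m)%N -> (j < m)%N -> Q_ i n p -> Q_ j k p -> i = j /\ n = k.
  move=> im jm [p0 Pin] [_ Pjk].
  have [[gp0 hi] _] := Pin; have [[kp0 hj] _] := Pjk.
  have GA : G (g n * (g k)^-1) by apply: GM => //; exact: GV.
  have zj := z2 j jm; have zi := z2 i im.
  have dA := Gd _ GA.
  have E : mobius (g n) p = mobius (g n * (g k)^-1) (mobius (g k) p).
    by rewrite mobiusM// mobiusK.
  have [ij A1] : i = j /\ (g n * (g k)^-1 = 1 \/ g n * (g k)^-1 = -1).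
    apply: sep => //; apply: le_lt_trans d12.
    have n0 := mobius_H2 (dg n) p0; have k0 := mobius_H2 dA zj.
    apply: le_trans (hgap_triangle zi n0 k0) _.
    have : hgap (mobius (g n) p) (mobius (g n * (g k)^-1) (z j)) < d by rewrite E hgap_mobius.
    have := hgap_ge0 zi n0; have := hgap_ge0 n0 k0; move: hi; rewrite hgapC.
    move: (hgap _ _) (hgap _ _) => e1 e2; nra.
  split => //; subst j.
  have gE : mobius (g n) p = mobius (g k) p.
    by rewrite E; case: A1 => ->; rewrite ?mobiusN mobius1.
  have /trivIsetP tPi := tP i.
  apply: contrapT => /eqP nk.
  have := tPi n k Logic.I Logic.I nk; rewrite -subset0 => /(_ (mobius (g n) p)); apply.
  by split => //; rewrite gE.
pose V_ i := \bigcup_n Q_ i n.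
have mV i : (i < m)%N -> measurable (V_ i) by move=> im; apply: bigcupT_measurable => n; exact: mQ.
have aV i : (i < m)%N -> (a%:E <= hyp_measure R (V_ i))%E.
  move=> im; apply: le_trans (hyp_area_hball (z2 i im) _) _; first by rewrite d0.
  rewrite hyp_measureE; last by move=> p [].
  rewrite -/(R_ i) (PE i im) !measure_bigcup//.
  - rewrite le_eqVlt; apply/orP; left; apply/eqP; apply: eq_eseriesr => n _.
    by rewrite -!hyp_measureE// aQ.
  - by move=> n _; exact: mQ.
  - apply/trivIsetP => n k _ _ /eqP nk; rewrite -subset0 => p [h1 h2].
    by apply: nk; have [] := Qdisj _ _ _ _ _ im im h1 h2.
  - by move=> n _; exact: mP.
pose W i := if (i < m)%N then V_ i else set0.
have mW i : measurable (W i) by rewrite /W; case: ifP => // im; exact: mV.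
have tW : trivIset setT W.
  apply/trivIsetP => i j _ _ /eqP ij; rewrite -subset0 => p []; rewrite /W.
  case: ifPn => // im; case: ifPn => // jm [n _ h1] [k _ h2].
  by apply: ij; have [] := Qdisj _ _ _ _ _ im jm h1 h2.
have WF : \big[setU/set0]_(i < m) W i `<=` F.
  rewrite -bigcup_mkord => p [i /= im]; rewrite /W im => -[n _]; exact: QF.
have ineq : ((m%:R * a)%:E <= hyp_measure R F)%E.
  apply: (@le_trans _ _ (hyp_measure R (\big[setU/set0]_(i < m) W i))); last first.
    by apply: le_measure; rewrite ?inE//; apply: bigsetU_measurable => i _; exact: mW.
  rewrite measure_bigsetU//.
  have -> : (m%:R * a)%:E = (\sum_(i < m) a%:E)%E by rewrite sumEFin sumr_const card_ord mulr_natl.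
  by apply: lee_sum => i _; rewrite /W ltn_ord; exact: aV.
rewrite -hyp_measureE// -(fineK Fnum) lee_fin in ineq.
by rewrite -(@natrK R m); apply: le_truncn; rewrite ler_pdivlMr.
Qed.

End discrete_groups.

(** * Displacement at a point and absence of elliptic elements *)

Section fuchsian.
Context (R : realType).
Local Notation M := 'M[R]_2.
Implicit Types (G : set M) (A B : M) (p q w z : R * R).

(* [at_pt z A] is N^-1 A N for N = [[y, x], [0, 1]], which maps i to z = x + i y. *)
Definition at_pt z A : M :=
  mx2 (A i0 i0 - A i1 i0 * z.1)
      ((A i0 i1 + (A i0 i0 - A i1 i1) * z.1 - A i1 i0 * z.1 ^+ 2) / z.2)
      (A i1 i0 * z.2) (A i1 i1 + A i1 i0 * z.1).

Lemma at_ptM z A B : H2 z -> at_pt z (A * B) = at_pt z A * at_pt z B.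
Proof.
move=> z0; rewrite /at_pt mulmx2 !mulmx2E.
by have z1 := lt0r_neq0 z0; congr mx2; field.
Qed.

Lemma at_ptN z A : at_pt z (- A) = - at_pt z A.
Proof. by rewrite /at_pt oppmx2 !mxE; congr mx2; ring. Qed.

Lemma tr_at_pt z A : \tr (at_pt z A) = \tr A.
Proof. by rewrite !tr2E /at_pt !mx2E; ring. Qed.

Lemma det_at_pt z A : H2 z -> \det (at_pt z A) = \det A.
Proof. by move=> z0; have z1 := lt0r_neq0 z0; rewrite !det2E /at_pt !mx2E; field. Qed.

(** For determinant 1 this is the sum of the squares of the entries minus 2, and it equals [hgap]
    between i and A i. *)
Definition gap A : R := (A i0 i0 - A i1 i1) ^+ 2 + (A i0 i1 + A i1 i0) ^+ 2.

Lemma gap_at_pt z A : \det A = 1 -> H2 z -> hgap z (mobius A z) = gap (at_pt z A).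
Proof.
move=> dA z0; have D1 := mobius_den_gt0 dA z0.
move: D1 dA z0; rewrite /mobius_den /hgap /gap /at_pt /mobius det2E !mx2E.
move: (A i0 i0) (A i0 i1) (A i1 i0) (A i1 i1) z => a b c d [x y]; rewrite /H2/=.
move=> D1 dA y0.
have D0 := lt0r_neq0 D1; have y1 := lt0r_neq0 y0.
have -> : x - ((a * x + b) * (c * x + d) + a * c * y ^+ 2) / ((c * x + d) ^+ 2 + (c * y) ^+ 2) =
  (x * ((c * x + d) ^+ 2 + (c * y) ^+ 2) - ((a * x + b) * (c * x + d) + a * c * y ^+ 2))
    / ((c * x + d) ^+ 2 + (c * y) ^+ 2) by field.
have -> : y - y / ((c * x + d) ^+ 2 + (c * y) ^+ 2) =
  (y * ((c * x + d) ^+ 2 + (c * y) ^+ 2) - y) / ((c * x + d) ^+ 2 + (c * y) ^+ 2) by field.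
apply: (@mulIf _ (y ^+ 2 * ((c * x + d) ^+ 2 + (c * y) ^+ 2))); first by rewrite mulf_neq0// expf_neq0.
transitivity ((x * ((c * x + d) ^+ 2 + (c * y) ^+ 2) - ((a * x + b) * (c * x + d) + a * c * y ^+ 2)) ^+ 2
  + (y * ((c * x + d) ^+ 2 + (c * y) ^+ 2) - y) ^+ 2); first by field; rewrite y1 D0.
transitivity (((c * x + d) ^+ 2 + (c * y) ^+ 2) * (((a - c * x - (d + c * x)) * y) ^+ 2 +
  (b + (a - d) * x - c * x ^+ 2 + c * y * y) ^+ 2)); last by field.
have K (r s P Q : R) : (x * (r ^+ 2 + s ^+ 2) - (P * r + Q * s)) ^+ 2 + (y * (r ^+ 2 + s ^+ 2) - (Q * r - P * s)) ^+ 2 =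
  (r ^+ 2 + s ^+ 2) * ((x * r - y * s - P) ^+ 2 + (x * s + y * r - Q) ^+ 2) by ring.
have yE : y = a * y * (c * x + d) - (a * x + b) * (c * y) by rewrite -[LHS]mulr1 -dA; ring.
have XE : (a * x + b) * (c * x + d) + a * c * y ^+ 2 =
    (a * x + b) * (c * x + d) + a * y * (c * y) by ring.
rewrite XE; have := K (c * x + d) (c * y) (a * x + b) (a * y); rewrite -yE => ->.
by congr (_ * _); ring.
Qed.

Lemma gap_ge_tr A : \det A = 1 -> (\tr A) ^+ 2 - 4 <= gap A.
Proof. by rewrite det2E tr2E /gap => dA; have := sqr_ge0 (A i0 i1 - A i1 i0); nra. Qed.

Definition near1 (d : R) A := forall i j, `|A i j - (1 : M) i j| <= d.

Lemma near1P (d : R) A : near1 d A <->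
  [/\ `|A i0 i0 - 1| <= d, `|A i0 i1| <= d, `|A i1 i0| <= d & `|A i1 i1 - 1| <= d].
Proof.
split.
  move=> h; split; [have := h i0 i0|have := h i0 i1|have := h i1 i0|have := h i1 i1];
  by rewrite one2E mx2E ?subr0.
case=> h1 h2 h3 h4 i j; rewrite one2E.
by case: (I2_cases i) => ->; case: (I2_cases j) => ->; rewrite mx2E ?subr0.
Qed.

(** The trace hypothesis excludes rotations about i, whose gap is 0. With it, gap = tr^2 - 4 + (b -
    c)^2 controls the trace and the difference of the off-diagonal entries. *)
Lemma gap_near1 (d : R) A : 0 <= d <= 1 -> \det A = 1 -> 4 <= (\tr A) ^+ 2 -> gap A <= d ^+ 2 ->
  near1 d A \/ near1 d (- A).
Proof.
move=> /andP[d0 d1]; rewrite det2E tr2E /gap => dA tA gA.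
have e1 : `|A i0 i0 - A i1 i1| <= d.
  by rewrite -(ger0_norm d0) -ler_sqr ?nnegrE// !real_normK ?num_real//; have := sqr_ge0 (A i0 i1 + A i1 i0); lra.
have e2 : `|A i0 i1 + A i1 i0| <= d.
  by rewrite -(ger0_norm d0) -ler_sqr ?nnegrE// !real_normK ?num_real//; have := sqr_ge0 (A i0 i0 - A i1 i1); lra.
have e3 : `|A i0 i1 - A i1 i0| <= d.
  by rewrite -(ger0_norm d0) -ler_sqr ?nnegrE// !real_normK ?num_real//; nra.
have e4 : (A i0 i0 + A i1 i1) ^+ 2 <= 4 + d ^+ 2.
  by have := sqr_ge0 (A i0 i1 - A i1 i0); nra.
move: e1 e2 e3; rewrite !ler_norml => /andP[? ?] /andP[? ?] /andP[? ?].
have dd : d ^+ 2 <= d by rewrite expr2 ler_piMl.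
have [t0|t0] := leP 0 (A i0 i0 + A i1 i1); [left|right]; apply/near1P; rewrite ?mxE !ler_norml.
  have t2 : 2 <= A i0 i0 + A i1 i1 by nra.
  have t3 : A i0 i0 + A i1 i1 <= 2 + d / 4 by nra.
  by split; apply/andP; split; lra.
have t2 : A i0 i0 + A i1 i1 <= -2 by nra.
have t3 : - 2 - d / 4 <= A i0 i0 + A i1 i1 by nra.
by split; apply/andP; split; lra.
Qed.

Lemma near1_gap (d : R) A : near1 d A -> gap A <= 8 * d ^+ 2.
Proof.
move=> /near1P[]; rewrite !ler_norml /gap => /andP[? ?] /andP[? ?] /andP[? ?] /andP[? ?].
have h1 : (A i0 i0 - A i1 i1) ^+ 2 <= (2 * d) ^+ 2.
  by rewrite -subr_ge0 subr_sqr mulr_ge0//; lra.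
have h2 : (A i0 i1 + A i1 i0) ^+ 2 <= (2 * d) ^+ 2.
  by rewrite -subr_ge0 subr_sqr mulr_ge0//; lra.
by lra.
Qed.

Lemma gapN A : gap (- A) = gap A.
Proof. by rewrite /gap !mxE; ring. Qed.

Lemma bounded_infinite_repeat (T : Type) (S : set T) (f : nat -> T) : finite_set S ->
  (forall n, S (f n)) -> exists m n, (m < n)%N /\ f m = f n.
Proof.
move=> finS Sf; apply: contrapT => H.
have finj : {in [set: nat] &, injective f}.
  move=> m n _ _ fmn; apply/eqP; apply: contrapT => /negP.
  by rewrite neq_ltn => /orP[mn|mn]; apply: H; [exists m, n|exists n, m].
apply: infinite_nat; rewrite -(eq_finite_set (inj_card_eq finj)).
by apply: sub_finite_set finS => _ [n _ <-].
Qed.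

Lemma group_exp G A n : SL2_subgroup G -> G A -> G (A ^+ n).
Proof.
move=> [G1 _ _ GM _] GA; elim: n => [|n IH]; first by rewrite expr0.
by rewrite exprS; exact: GM.
Qed.

Lemma group_opp G A : SL2_subgroup G -> G A -> G (- A).
Proof. by move=> [_ GN _ GM _] GA; rewrite -mulN1r; exact: GM. Qed.

Lemma mx2_sqr A : \det A = 1 -> A * A = (\tr A) *: A - 1.
Proof.
rewrite det2E tr2E => dA; apply: mx2P; rewrite mulmx2E !mxE/= -?dA; ring.
Qed.

(** An element with trace below 2 in absolute value has bounded powers. By discreteness two of them
    coincide, which produces forbidden torsion. *)
Lemma group_tr_ge G A : surface_group G -> G A -> 4 <= (\tr A) ^+ 2.
Proof.
move=> [sG dG tG] GA; rewrite leNgt; apply/negP => tA.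
have [G1 GN1 Gd GM GV] := sG.
have dA := Gd A GA.
set t := \tr A in tA *.
(* The coefficients of A^n in the basis A, 1 lie on the conic u^2 - t u v + v^2 = 1, a bounded
   ellipse for |t| < 2. *)
have pow n : exists u v : R, A ^+ n = u *: A - v *: 1 /\ u ^+ 2 - t * u * v + v ^+ 2 = 1.
  elim: n => [|n [u [v [E Q]]]].
    by exists 0, (-1); split; [rewrite expr0 scale0r scaleN1r sub0r opprK|ring].
  exists (u * t - v), u; split; last by rewrite -Q; ring.
  rewrite exprSr E mulrBl -!scalerAl mx2_sqr// mul1r scalerBr scalerA scalerBl.
  by rewrite -!addrA; congr (_ + _); rewrite addrC.
have t2 : `|t| < 2.
  by rewrite -ltr_sqr ?nnegrE// real_normK ?num_real//; lra.
pose k := 1 - `|t| / 2.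
have k0 : 0 < k by rewrite /k; lra.
pose C := (1 + k^-1) * (1 + \sum_i \sum_j `|A i j|).
have Aij i j : `|A i j| <= \sum_i \sum_j `|A i j|.
  rewrite (bigD1 i)//= (bigD1 j)//= -addrA lerDl addr_ge0 ?sumr_ge0// => ? _.
  by apply: sumr_ge0.
have Ab n : (G `&` entry_bound C) (A ^+ n).
  split; first exact: group_exp.
  have [u [v [-> Q]]] := pow n => i j.
  have uv : u ^+ 2 + v ^+ 2 <= k^-1.
    rewrite -(ler_pM2l k0) mulfV ?gt_eqF// -Q /k.
    have : t * u * v <= `|t| * (u ^+ 2 + v ^+ 2) / 2.
      apply: le_trans (ler_norm _) _; rewrite !normrM -!mulrA ler_wpM2l//.
      have := sqr_ge0 (`|u| - `|v|); have := real_normK (num_real u); have := real_normK (num_real v); nra.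
    lra.
  have k1 : 0 < k^-1 by rewrite invr_gt0.
  have ub : `|u| <= 1 + k^-1.
    by have := sqr_ge0 (`|u| - 1); have := sqr_ge0 v; have := real_normK (num_real u); nra.
  have vb : `|v| <= 1 + k^-1.
    by have := sqr_ge0 (`|v| - 1); have := sqr_ge0 u; have := real_normK (num_real v); nra.
  rewrite !mxE; apply: le_trans (ler_normB _ _) _; rewrite !normrM /C mulrDr mulr1 addrC.
  apply: lerD; last by apply: ler_pM.
  by rewrite normr_nat; case: (i == j); rewrite ?mulr1 ?mulr0// addr_ge0// ltW.
have [m [n [mn E]]] := bounded_infinite_repeat (discrete_finite C sG dG) Ab.
have uA := det1_unit dA.
have E1 : A ^+ (n - m) = 1.
  apply: (@mulrI _ (A ^+ m)); first exact: unitrX.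
  by rewrite -exprD subnKC ?(ltnW mn)// mulr1 E.
have := tG A (n - m)%N GA; rewrite subn_gt0 mn E1 => /(_ isT (or_introl erefl)).
have tr1 : \tr (1 : M) = 2 by rewrite tr2E one2E !mx2E.
rewrite /t in tA *; case=> AE; move: tA; rewrite AE ?raddfN/= ?tr1 ?sqrrN; lra.
Qed.

End fuchsian.

(** * Commuting elements and common fixed points *)

Section commuting.
Context (R : realType).
Local Notation M := 'M[R]_2.
Implicit Types (G : set M) (A B : M) (p q w z : R * R).

Definition scalar2 A := [/\ A i0 i1 = 0, A i1 i0 = 0 & A i0 i0 = A i1 i1].

(** The trace-free part of B is l times that of A, written entrywise (see [traceless_propE]). For l
    <> 0 this says that A and B have the same fixed points. *)
Definition traceless_prop (l : R) A B :=
  [/\ B i0 i1 = l * A i0 i1, B i1 i0 = l * A i1 i0 & B i0 i0 - B i1 i1 = l * (A i0 i0 - A i1 i1)].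

Lemma scalar2_det1 A : \det A = 1 -> scalar2 A -> A = 1 \/ A = -1.
Proof.
rewrite det2E => + [b c ad]; rewrite b c ad mulr0 subr0 => /eqP.
rewrite -expr2 sqrf_eq1 => /orP[] /eqP d; [left|right];
by apply: mx2P; rewrite ?ad ?b ?c ?d ?oppmx2 one2E ?oppmx2 mx2E ?oppr0.
Qed.

Lemma commute_traceless A B : ~ scalar2 A -> A * B = B * A -> exists l, traceless_prop l A B.
Proof.
move=> nA AB.
have e1 := congr1 (fun X : M => X i0 i0) AB; have e2 := congr1 (fun X : M => X i0 i1) AB.
have e3 := congr1 (fun X : M => X i1 i0) AB.
rewrite /= !mulmx2E in e1 e2 e3.
move: nA e1 e2 e3; rewrite /scalar2 /traceless_prop.
move: (A i0 i0) (A i0 i1) (A i1 i0) (A i1 i1) => a b c d.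
move: (B i0 i0) (B i0 i1) (B i1 i0) (B i1 i1) => a' b' c' d' nA e1 e2 e3.
have [b0|b0] := eqVneq b 0; last first.
  exists (b' / b); split; first by field.
    by apply: (mulfI b0); rewrite mulrA mulrCA mulfV// mulr1; lra.
  by apply: (mulfI b0); rewrite mulrA mulrCA mulfV// mulr1; lra.
have [c0|c0] := eqVneq c 0; last first.
  exists (c' / c); split; last 1 first.
  - by apply: (mulfI c0); rewrite mulrA mulrCA mulfV// mulr1; lra.
  - by apply: (mulfI c0); rewrite mulrA mulrCA mulfV// mulr1; lra.
  - by field.
have [ad|ad] := eqVneq (a - d) 0; first by case: nA; split => //; lra.
exists ((a' - d') / (a - d)); split; last by rewrite divfK.
  by apply: (mulfI ad); rewrite mulrA mulrCA mulfV// mulr1; move: e2; rewrite b0; lra.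
by apply: (mulfI ad); rewrite mulrA mulrCA mulfV// mulr1; move: e3; rewrite c0; lra.
Qed.

Lemma traceless_at_pt l A B z : traceless_prop l A B -> traceless_prop l (at_pt z A) (at_pt z B).
Proof.
move=> [b c ad]; have {}ad : B i0 i0 = B i1 i1 + l * (A i0 i0 - A i1 i1) by lra.
rewrite /traceless_prop /at_pt !mx2E b c ad; split; ring.
Qed.

Lemma traceless_gap l A B : traceless_prop l A B -> gap B = l ^+ 2 * gap A.
Proof. by move=> [b c ad]; rewrite /gap b c ad; ring. Qed.

Lemma traceless_disc l A B : \det A = 1 -> \det B = 1 -> traceless_prop l A B ->
  (\tr B) ^+ 2 - 4 = l ^+ 2 * ((\tr A) ^+ 2 - 4).
Proof.
rewrite !det2E !tr2E => dA dB [b c ad].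
have disc (a e f d : R) : a * d - e * f = 1 -> (a + d) ^+ 2 - 4 = (a - d) ^+ 2 + 4 * (e * f).
  by move=> h; transitivity ((a + d) ^+ 2 - 4 * (a * d - e * f)); [rewrite h mulr1|ring].
by rewrite (disc _ _ _ _ dA) (disc _ _ _ _ dB) ad b c; ring.
Qed.

Lemma traceless_hgap l A B z : \det A = 1 -> \det B = 1 -> H2 z -> traceless_prop l A B ->
  hgap z (mobius B z) = l ^+ 2 * hgap z (mobius A z).
Proof.
by move=> dA dB z0 P; rewrite !gap_at_pt// (traceless_gap (traceless_at_pt z P)).
Qed.

Lemma traceless_trans l l' A B C : traceless_prop l A B -> traceless_prop l' B C ->
  traceless_prop (l' * l) A C.
Proof. by move=> [b c ad] [b' c' ad']; split; rewrite ?b' ?c' ?ad' ?b ?c ?ad mulrA. Qed.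

Lemma traceless_neq0 l A B : \det B = 1 -> ~ (B = 1 \/ B = -1) -> traceless_prop l A B -> l != 0.
Proof.
move=> dB nB [b c ad]; apply/eqP => l0; apply: nB; apply: scalar2_det1 => //.
by rewrite l0 !mul0r in b c ad; split => //; lra.
Qed.

Lemma tr_conj A B : \det B = 1 -> \tr (B * A * B^-1 : M) = \tr A.
Proof. by move=> dB; rewrite -mulrA -[B * _]/(B *m _) mxtrace_mulC -[_ *m B]/(_ * B) mulrVK// det1_unit. Qed.

Lemma group_conj G A B : SL2_subgroup G -> G A -> G B -> G (B * A * B^-1).
Proof. by move=> [_ _ _ GM GV] GA GB; exact: GM _ _ (GM _ _ GB GA) (GV _ GB). Qed.

Lemma conj_expE A B n : B \is a GRing.unit ->
  B ^+ n.+1 * A * (B ^+ n.+1)^-1 = B * (B ^+ n * A * (B ^+ n)^-1) * B^-1.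
Proof.
move=> uB; rewrite exprS invrM ?unitrX// !mulrA//.
Qed.

Definition traceless A : M := A - (\tr A / 2)%:M.

Lemma traceless_propE A B l : traceless_prop l A B <-> traceless B = l *: traceless A.
Proof.
rewrite /traceless; split.
  move=> [b c ad]; apply: mx2P; rewrite !mxE/= ?mulr1n ?mulr0n ?subr0// !tr2E; lra.
move=> E; have := congr1 (fun X : M => X i0 i0) E; have := congr1 (fun X : M => X i0 i1) E.
have := congr1 (fun X : M => X i1 i0) E.
by rewrite !mxE/= !mulr1n !mulr0n !subr0 !tr2E; split => //; lra.
Qed.

Lemma traceless_conj A C : \det C = 1 -> traceless (C * A * C^-1) = C * traceless A * C^-1.
Proof.
move=> dC; rewrite /traceless tr_conj// mulrBr mulrBl; congr (_ - _).
have -> : C * (\tr A / 2)%:M = (\tr A / 2)%:M * C.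
  by rewrite -[LHS]/(_ *m _) -[RHS]/(_ *m _) scalar_mxC.
by rewrite mulrK// det1_unit.
Qed.

Lemma det1X A n : \det A = 1 -> \det (A ^+ n) = 1.
Proof.
by move=> dA; elim: n => [|n IH]; rewrite ?expr0 ?det1// exprS detM2 dA IH mulr1.
Qed.

Lemma conj_traceless_exp A B l : \det B = 1 -> traceless_prop l A (B * A * B^-1) ->
  forall n, traceless_prop (l ^+ n) A (B ^+ n * A * (B ^+ n)^-1).
Proof.
move=> dB /traceless_propE P n; apply/traceless_propE; rewrite traceless_conj// in P.
have uB := det1_unit dB; elim: n => [|n IH].
  by rewrite !expr0 mul1r invr1 mulr1 scale1r.
rewrite conj_expE// traceless_conj// IH -scalerAr -scalerAl P scalerA exprSr//.
Qed.

Lemma conj_traceless_inv A B l : \det B = 1 -> l != 0 -> traceless_prop l A (B * A * B^-1) ->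
  traceless_prop l^-1 A (B^-1 * A * B^-1^-1).
Proof.
move=> dB l0 /traceless_propE; rewrite traceless_conj// => P; apply/traceless_propE.
have uB := det1_unit dB.
rewrite traceless_conj ?detV2// invrK.
have {1}-> : traceless A = l^-1 *: (B * traceless A * B^-1) by rewrite P scalerA mulVf// scale1r.
by rewrite -scalerAr -scalerAl !mulrA mulVr// mul1r mulrVK.
Qed.

Lemma traceless_id_eq A B : \tr A = \tr B -> traceless_prop 1 A B -> A = B.
Proof. by rewrite !tr2E => t [b c ad]; apply: mx2P; rewrite ?b ?c ?mul1r//; lra. Qed.

(** B conjugates the trace-free part of A into a multiple l of itself, and l = 1 means commuting. If
    A is hyperbolic, l^2 = 1 since the traces agree, and l = -1 forces tr B = 0, which [group_tr_ge]
    forbids. If A is parabolic, discreteness gives |l| = 1. *)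
Lemma commute_conj_commute G A B : surface_group G -> G A -> G B -> ~ (A = 1 \/ A = -1) ->
  A * (B * A * B^-1) = (B * A * B^-1) * A -> A * B = B * A.
Proof.
move=> sG GA GB nA comA.
have [sG' dG tG] := sG; have [G1 GN1 Gd GM GV] := sG'.
have dA := Gd A GA; have dB := Gd B GB; have uB := det1_unit dB.
have GA' := group_conj sG' GA GB; have dA' := Gd _ GA'.
have nsA : ~ scalar2 A by move=> /(scalar2_det1 dA).
have [l P] := commute_traceless nsA comA.
have tA' := tr_conj A dB.
have finish : l = 1 -> A * B = B * A.
  move=> l1; rewrite l1 in P.
  have E := traceless_id_eq (esym tA') P.
  by rewrite {1}E mulrVK.
have minus : l <> -1.
  move=> l1; rewrite l1 in P.
  have tB := group_tr_ge sG GB.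
  suff t0 : \tr B = 0 by move: tB; rewrite t0 expr0n/=; lra.
  have E : B * A * B^-1 * B = B * A by rewrite mulrVK.
  have tt := tA'; rewrite !tr2E in tt.
  rewrite tr2E.
  move: P E tt; generalize (B * A * B^-1) => A' [b c ad] E tt.
  have a1 : A' i0 i0 = A i1 i1 by lra.
  have a2 : A' i1 i1 = A i0 i0 by lra.
  have e1 := congr1 (fun X : M => X i0 i0) E; have e2 := congr1 (fun X : M => X i0 i1) E.
  have e3 := congr1 (fun X : M => X i1 i0) E; have e4 := congr1 (fun X : M => X i1 i1) E.
  rewrite /= !mulmx2E a1 a2 b c !mulN1r in e1 e2 e3 e4.
  apply/eqP; apply: contrapT => /negP t0; apply: nsA; split.
  - by apply: (mulfI t0); rewrite mulr0; lra.
  - by apply: (mulfI t0); rewrite mulr0; lra.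
  - by apply: (mulfI t0); lra.
have disc := traceless_disc dA dA' P; rewrite tA' in disc.
have [D0|D0] := eqVneq ((\tr A) ^+ 2 - 4) 0; last first.
  have : l ^+ 2 = 1 by apply: (mulIf D0); rewrite -disc mul1r.
  by move=> /eqP; rewrite sqrf_eq1 => /orP[] /eqP; [exact: finish|move/minus].
have l0 : l != 0 by apply: traceless_neq0 P => // -[] E; apply: nA;
  [left|right]; apply: (mulrI uB); apply: (@mulIr _ B^-1); rewrite ?unitrV// E
    ?mulrN1 ?mulNr ?mulr1 mulrV.
(* A parabolic A with |l| <> 1 would have infinitely many bounded conjugates. *)
have bounded C k : G C -> `|k| <= 1 -> traceless_prop k A (C * A * C^-1) -> k != 0 -> `|k| = 1.
  move=> GC k1 Pk k0; have dC := Gd C GC.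
  have Pn := conj_traceless_exp dC Pk.
  pose K := \sum_i \sum_j `|A i j|.
  have Aij i j : `|A i j| <= K.
    rewrite /K (bigD1 i)//= (bigD1 j)//= -addrA lerDl addr_ge0 ?sumr_ge0// => ? _.
    by apply: sumr_ge0.
  have K0 : 0 <= K by apply: le_trans (Aij i0 i0).
  have Cb n : (G `&` entry_bound (2 * K)) (C ^+ n * A * (C ^+ n)^-1).
    have GCn := group_exp n sG' GC.
    split; first exact: group_conj.
    have [b c ad] := Pn n.
    have tn := tr_conj A (Gd _ GCn); rewrite !tr2E in tn.
    have kn : `|k ^+ n| <= 1 by rewrite normrX exprn_ile1.
    have kA i j : `|k ^+ n * A i j| <= K.
      by rewrite normrM -[leRHS]mul1r; apply: ler_pM.
    have bd u v : `|u| <= K -> `|v| <= K -> `|k ^+ n * (u - v)| <= 2 * K.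
      move=> hu hv; rewrite normrM -[leRHS]mul1r; apply: ler_pM => //.
      by apply: le_trans (ler_normB _ _) _; lra.
    have h1 := bd _ _ (Aij i0 i0) (Aij i1 i1); rewrite -ad in h1.
    have h2 := Aij i0 i0; have h3 := Aij i1 i1.
    move=> i j; case: (I2_cases i) => ->; case: (I2_cases j) => ->;
      rewrite ?b ?c; try (by apply: le_trans (kA _ _) _; lra).
    + by move: h1 h2 h3; rewrite !ler_norml => /andP[? ?] /andP[? ?] /andP[? ?]; apply/andP; split; lra.
    + by move: h1 h2 h3; rewrite !ler_norml => /andP[? ?] /andP[? ?] /andP[? ?]; apply/andP; split; lra.
  have [m [n [mn E]]] := bounded_infinite_repeat (discrete_finite (2 * K) sG' dG) Cb.
  have kmn : k ^+ m = k ^+ n.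
    have [b c ad] := Pn m; have [b' c' ad'] := Pn n; rewrite E in b c ad.
    apply/eqP; apply: contrapT => /negP; rewrite -subr_eq0 => kmn; apply: nsA; split.
    - by apply: (mulfI kmn); rewrite mulr0 mulrBl -b -b' subrr.
    - by apply: (mulfI kmn); rewrite mulr0 mulrBl -c -c' subrr.
    - by apply/eqP; rewrite -subr_eq0; apply/eqP; apply: (mulfI kmn); rewrite mulr0 mulrBl -ad -ad' subrr.
  have k1' : k ^+ (n - m) = 1.
    by apply: (@mulfI _ (k ^+ m)); rewrite ?expf_neq0// -exprD subnKC ?(ltnW mn)// mulr1.
  apply/eqP; have := congr1 Num.norm k1'; rewrite normrX normr1 => /eqP.
  by rewrite pexpr_eq1 ?subn_eq0 -?ltnNge ?subn_gt0// ?normr_ge0.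
have : `|l| = 1.
  have [l1|l1] := leP `|l| 1; first exact: (bounded B).
  have PV := conj_traceless_inv dB l0 P.
  have : `|l^-1| = 1.
    apply: (bounded B^-1) PV _; rewrite ?invr_eq0//; first exact: GV.
    by rewrite normfV invf_le1 ?(ltW l1)// (lt_trans ltr01).
  by rewrite normfV => /eqP; rewrite invr_eq1 => /eqP.
have [l0'|l0'] := leP 0 l; first by rewrite ger0_norm//; exact: finish.
by rewrite ltr0_norm// => l1; exfalso; apply: minus; rewrite -l1 opprK.
Qed.

End commuting.

(** * Zassenhaus' lemma *)

Section thick_thin.
Context (R : realType).
Local Notation M := 'M[R]_2.
Implicit Types (G : set M) (A B : M) (p q w z : R * R).

Definition commut A B : M := A * B * A^-1 * B^-1.

(** The commutator minus 1 is ((A - 1)(B - 1) - (B - 1)(A - 1)) A^-1 B^-1, quadratically small. The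
    radius 1 / 40 makes the resulting factor 16 / 40 * (41 / 40)^2 less than 1 / 2. *)
Lemma commut_contract (d e : R) A B : \det A = 1 -> \det B = 1 -> 0 <= e -> d <= 1 / 40 -> e <= 1 / 40 ->
  near1 d A -> near1 e B -> near1 (e / 2) (commut A B).
Proof.
move=> dA dB e0 d40 e40 nA nB.
have -> : commut A B = 1 + ((A - 1) * (B - 1) - (B - 1) * (A - 1)) * (A^-1 * B^-1).
  have -> : (A - 1) * (B - 1) - (B - 1) * (A - 1) = A * B - B * A.
    by rewrite !mulrBr !mulrBl !mulr1 !mul1r; apply: mx2P; rewrite !mxE; ring.
  rewrite mulrBl /commut !mulrA -(mulrA B A) mulrV ?det1_unit// mulr1 mulrV ?det1_unit//.
  by rewrite addrC subrK.
have bV (X : M) (k : R) : near1 k X -> \det X = 1 -> k <= 1 / 40 -> forall i j, `|X^-1 i j| <= 41 / 40.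
  move=> /near1P[]; rewrite !ler_norml => /andP[? ?] /andP[? ?] /andP[? ?] /andP[? ?] dX k40 i j.
  rewrite (inv2E dX); case: (I2_cases i) => ->; case: (I2_cases j) => ->; rewrite mx2E ?normrN ler_norml; lra.
have h1 i j : `|((A - 1) * (B - 1)) i j| <= 2 * (1 / 40 * e).
  rewrite mulmx2E; apply: le_trans (ler_normD _ _) _; rewrite !normrM.
  have E X k l : (X - 1 : M) k l = X k l - (1 : M) k l by rewrite !mxE.
  rewrite !E mulrDl mul1r.
  by apply: lerD; apply: ler_pM => //; apply: le_trans (nA _ _) _.
have h2 i j : `|((B - 1) * (A - 1)) i j| <= 2 * (1 / 40 * e).
  rewrite mulmx2E; apply: le_trans (ler_normD _ _) _; rewrite !normrM.
  have E X k l : (X - 1 : M) k l = X k l - (1 : M) k l by rewrite !mxE.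
  rewrite !E mulrDl mul1r.
  by apply: lerD; rewrite mulrC; apply: ler_pM => //; apply: le_trans (nA _ _) _.
have h3 i j : `|(A^-1 * B^-1) i j| <= 2 * (41 / 40 * (41 / 40)).
  rewrite mulmx2E; apply: le_trans (ler_normD _ _) _; rewrite !normrM mulrDl mul1r.
  have bA := bV _ _ nA dA d40; have bB := bV _ _ nB dB e40.
  by apply: lerD; apply: ler_pM.
have h4 i j : `|((A - 1) * (B - 1) - (B - 1) * (A - 1)) i j| <= 4 * (1 / 40 * e).
  have -> : ((A - 1) * (B - 1) - (B - 1) * (A - 1)) i j = ((A - 1) * (B - 1)) i j - ((B - 1) * (A - 1)) i j.
    by rewrite !mxE.
  apply: le_trans (ler_normB _ _) _; have := h1 i j; have := h2 i j; lra.
move=> i j.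
have -> (X : M) : (1 + X) i j - (1 : M) i j = X i j by rewrite !mxE addrAC subrr add0r.
rewrite mulmx2E; apply: le_trans (ler_normD _ _) _; rewrite !normrM.
have : forall k, `|((A - 1) * (B - 1) - (B - 1) * (A - 1)) i k| * `|(A^-1 * B^-1) k j|
   <= (4 * (1 / 40 * e)) * (2 * (41 / 40 * (41 / 40))).
  by move=> k; apply: ler_pM.
move=> h; have := h i0; have := h i1; lra.
Qed.

Lemma discrete_at_pt G z : SL2_subgroup G -> discrete_mx G -> H2 z ->
  exists2 e : R, 0 < e & forall A, G A -> near1 e (at_pt z A) -> A = 1.
Proof.
move=> [G1 _ _ _ _] /(_ 1 G1)[e [e0 He]] z0.
case: z z0 => x y; rewrite /H2/= => y0.
have y1 := lt0r_neq0 y0.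
have u0 : 0 <= `|x| / y by rewrite divr_ge0// ltW.
have v0 : 0 < y^-1 by rewrite invr_gt0.
have w0 : 0 <= x ^+ 2 / y by rewrite divr_ge0 ?sqr_ge0// ltW.
pose K := 1 + `|x| / y + y^-1 + y + 2 * `|x| + x ^+ 2 / y.
have K0 : 0 < K by rewrite /K; have := normr_ge0 x; lra.
exists (e / (2 * K)); first by rewrite divr_gt0// mulr_gt0.
move=> A GA; rewrite near1P /at_pt !mx2E /=.
set f := e / (2 * K) => -[h1 h2 h3 h4].
have f0 : 0 <= f by apply: le_trans h1.
have fK : f * K < e.
  have -> : f * K = e / 2 by rewrite /f; field; rewrite lt0r_neq0.
  lra.
have cE : A i1 i0 = (A i1 i0 * y) / y by field.
have cb : `|A i1 i0| <= f * y^-1.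
  by rewrite cE normrM [ `|y^-1|]gtr0_norm// ler_pM2r.
have cx : `|A i1 i0 * x| <= f * (`|x| / y).
  have -> : f * (`|x| / y) = f * y^-1 * `|x| by ring.
  by rewrite normrM ler_wpM2r.
have cxx : `|A i1 i0 * x ^+ 2| <= f * (x ^+ 2 / y).
  have -> : f * (x ^+ 2 / y) = f * y^-1 * x ^+ 2 by ring.
  by rewrite normrM [ `|x ^+ 2|]ger0_norm ?sqr_ge0// ler_wpM2r ?sqr_ge0.
have hb : `|A i0 i1 + (A i0 i0 - A i1 i1) * x - A i1 i0 * x ^+ 2| <= f * y.
  by move: h2; rewrite normrM [ `|y^-1|]gtr0_norm// ler_pdivrMr.
have hax : `|(A i0 i0 - A i1 i0 * x - (A i1 i1 + A i1 i0 * x)) * x| <= f * (2 * `|x|).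
  rewrite normrM mulrA ler_wpM2r//.
  have -> : A i0 i0 - A i1 i0 * x - (A i1 i1 + A i1 i0 * x) =
     (A i0 i0 - A i1 i0 * x - 1) - (A i1 i1 + A i1 i0 * x - 1) by ring.
  by apply: le_trans (ler_normB _ _) _; lra.
apply: He => // i j.
have KE : f * K = f + f * (`|x| / y) + f * y^-1 + f * y + f * (2 * `|x|) + f * (x ^+ 2 / y).
  by rewrite /K !mulrDr mulr1.
have p1 : 0 <= f * (`|x| / y) by apply: mulr_ge0.
have p2 : 0 <= f * y^-1 by apply: mulr_ge0 => //; exact: ltW.
have p3 : 0 <= f * y by apply: mulr_ge0 => //; exact: ltW.
have p4 : 0 <= f * (2 * `|x|) by apply: mulr_ge0 => //; exact: mulr_ge0.
have p5 : 0 <= f * (x ^+ 2 / y) by apply: mulr_ge0.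
apply: le_lt_trans fK; rewrite distrC KE.
move: h1 h4 cb cx cxx hb hax; rewrite one2E !ler_norml => /andP[? ?] /andP[? ?] /andP[? ?] /andP[? ?] /andP[? ?] /andP[? ?] /andP[? ?].
by case: (I2_cases i) => ->; case: (I2_cases j) => ->; rewrite mx2E; apply/andP; split; lra.
Qed.

Lemma at_ptV z A : \det A = 1 -> H2 z -> at_pt z A^-1 = (at_pt z A)^-1.
Proof.
move=> dA z0; have dh : \det (at_pt z A) = 1 by rewrite det_at_pt.
rewrite (inv2E dh) (inv2E dA) /at_pt !mx2E; congr mx2; have z1 := lt0r_neq0 z0; by field.
Qed.

Lemma at_pt_commut z A B : \det A = 1 -> \det B = 1 -> H2 z ->
  at_pt z (commut A B) = commut (at_pt z A) (at_pt z B).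
Proof. by move=> dA dB z0; rewrite /commut !at_ptM// !at_ptV. Qed.

Lemma commut1 A B : \det A = 1 -> \det B = 1 -> commut A B = 1 -> A * B = B * A.
Proof.
move=> dA dB; rewrite /commut => /(congr1 (fun X => X * B)); rewrite mulrVK ?det1_unit// mul1r.
by move/(congr1 (fun X => X * A)); rewrite mulrVK ?det1_unit.
Qed.

(** Iterated commutators with A shrink geometrically and reach 1 by discreteness. Going back, if A
    commutes with X_(n+1) = [A, X_n], then A commutes with X_n A X_n^-1, hence with X_n by
    [commute_conj_commute]; so X_(n+1) is already 1. *)
Lemma zassenhaus_near G z A B : surface_group G -> H2 z -> G A -> G B ->
  near1 (1 / 40) (at_pt z A) -> near1 (1 / 40) (at_pt z B) -> A * B = B * A.
Proof.
move=> sG z0 GA GB nA nB.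
have [sG' dG tG] := sG; have [G1 GN1 Gd GM GV] := sG'.
have dA := Gd A GA.
have [A1|nA1] := pselect (A = 1 \/ A = -1).
  by case: A1 => ->; rewrite ?mul1r ?mulr1 ?mulN1r ?mulrN1.
pose X n := iter n (commut A) B.
have GX n : G (X n).
  elim: n => // n IH; rewrite /X iterS -/(X n) /commut.
  exact: GM _ _ (GM _ _ (GM _ _ GA IH) (GV _ GA)) (GV _ IH).
have dX n : \det (X n) = 1 by exact: Gd.
have nX n : near1 (1 / 40 / 2 ^+ n) (at_pt z (X n)).
  elim: n => [|n IH]; first by rewrite expr0 divr1.
  rewrite /X iterS -/(X n) at_pt_commut//.
  have -> : 1 / 40 / 2 ^+ n.+1 = (1 / 40 / 2 ^+ n) / 2 :> R.
    by rewrite exprS; field; rewrite expf_neq0.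
  apply: (commut_contract (d := 1 / 40)); rewrite ?det_at_pt//.
  rewrite ler_pdivrMr ?exprn_gt0// ler_peMr// exprn_ege1//; lra.
have [e e0 He] := discrete_at_pt sG' dG z0.
have [n Xn] : exists n, X n = 1.
  pose n := (Num.truncn (1 / 40 / e)).+1.
  exists n; apply: He => // i j; apply: le_trans (nX n i j) _.
  rewrite ler_pdivrMr ?exprn_gt0// [e * _]mulrC -ler_pdivrMr//.
  have : n%:R <= (2 ^ n)%:R :> R by rewrite ler_nat ltnW// ltn_expl.
  by rewrite natrX => h; apply: le_trans h; rewrite ltW// truncnS_gt.
elim: n Xn => [|n IH] Xn; first by have -> : B = 1 by []; rewrite mulr1 mul1r.
have com := commut1 dA (dX n) Xn.
case: n => [|n] in IH Xn com *; first exact: com.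
apply: IH.
have comA : A * (X n * A * (X n)^-1) = (X n * A * (X n)^-1) * A.
  have uA := det1_unit dA; have uX := det1_unit (dX n).
  have E : X n.+1 = A * (X n * A * (X n)^-1)^-1.
    rewrite /X iterS -/(X n) /commut invrM ?unitrV ?unitrMr// invrK invrM// !mulrA//.
  rewrite E in com.
  have uC : X n * A * (X n)^-1 \is a GRing.unit by rewrite unitrMr ?unitrV// unitrMr.
  move: com uC; generalize (X n * A * (X n)^-1) => C com uC.
  have com' : A * C^-1 = C^-1 * A by apply: (mulrI uA); rewrite com mulrA.
  apply: (mulIr (x := C^-1)); first by rewrite unitrV.
  by rewrite -!mulrA mulrV// mulr1 com' mulrA mulrV// mul1r.
have := commute_conj_commute sG GA (GX n) nA1 comA.
move=> AX; rewrite /X iterS -/(X n) /commut AX.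
rewrite mulrK ?det1_unit// mulrV// ?det1_unit//.
Qed.

(** The displacement below which [gap_near1] puts an element, up to sign, within 1 / 40 of 1, where
    commutators contract. *)
Definition zmargin : R := (1 / 40) ^+ 2.

Lemma zassenhaus G z A B : surface_group G -> H2 z -> G A -> G B ->
  hgap z (mobius A z) <= zmargin -> hgap z (mobius B z) <= zmargin -> A * B = B * A.
Proof.
move=> sG z0 GA GB hA hB.
have [sG' dG tG] := sG; have [G1 GN1 Gd GM GV] := sG'.
have N X : G X -> hgap z (mobius X z) <= zmargin -> exists2 Y, G Y & near1 (1 / 40) (at_pt z Y) /\ (Y = X \/ Y = - X).
  move=> GX hX; have dX := Gd X GX.
  have : near1 (1 / 40) (at_pt z X) \/ near1 (1 / 40) (- at_pt z X).
    apply: gap_near1; rewrite ?det_at_pt ?tr_at_pt -?gap_at_pt//; first by lra.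
    exact: group_tr_ge GX.
  case=> h; [exists X => //|exists (- X); first exact: group_opp]; split; rewrite ?at_ptN//; by [left|right].
have [A' GA' [nA' EA]] := N A GA hA; have [B' GB' [nB' EB]] := N B GB hB.
have := zassenhaus_near sG z0 GA' GB' nA' nB'.
case: EA => ->; case: EB => ->; rewrite ?mulrN ?mulNr ?opprK// => /oppr_inj//.
Qed.

End thick_thin.

(** * Points of given displacement and a finite cover of the thick part *)

Section thick_part.
Context (R : realType).
Local Notation M := 'M[R]_2.
Implicit Types (G : set M) (A B : M) (p q w z : R * R).

(** The displacement of a hyperbolic element takes its minimum tr^2 - 4 on the axis and every larger
    value away from it; a point with the prescribed value is computed explicitly. *)
Lemma axis_point (s : R) A : \det A = 1 -> 4 < (\tr A) ^+ 2 -> (\tr A) ^+ 2 - 4 <= s ->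
  exists2 w, H2 w & hgap w (mobius A w) = s.
Proof.
move=> dA; rewrite tr2E; set D := _ ^+ 2 - 4 => t4 Ds.
have D0 : 0 < D by rewrite /D; lra.
have s0 : 0 < s by lra.
have DE : D = (A i0 i0 - A i1 i1) ^+ 2 + 4 * (A i0 i1 * A i1 i0).
  by rewrite /D; move: dA; rewrite det2E => h; nra.
have [c0|c0] := eqVneq (A i1 i0) 0.
  have ad : A i0 i0 - A i1 i1 != 0.
    by apply: contraTneq D0 => ad; rewrite DE c0 ad mulr0 mulr0 expr0n/= addr0 ltxx.
  have s1 : 0 <= s / D - 1 by rewrite subr_ge0 ler_pdivlMr// mul1r.
  exists (- (A i0 i1 / (A i0 i0 - A i1 i1)) + Num.sqrt (s / D - 1), 1); first exact: ltr01.
  rewrite gap_at_pt//; last exact: ltr01.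
  rewrite /gap /at_pt !mx2E/= c0.
  transitivity ((A i0 i0 - A i1 i1) ^+ 2 * (1 + Num.sqrt (s / D - 1) ^+ 2)); first by field.
  rewrite sqr_sqrtr//.
  have -> : (A i0 i0 - A i1 i1) ^+ 2 = D by rewrite DE c0 mulr0 mulr0 addr0.
  by field; rewrite gt_eqF.
have c1 : 0 < `|A i1 i0| by rewrite normr_gt0.
(* On the vertical line over the midpoint of the fixed points the root of the displacement is D / (4
   Y) + Y with Y = |c| y. Equating it with the root of s gives a quadratic equation, of which Y is
   the larger solution. *)
pose Y := (Num.sqrt s + Num.sqrt (s - D)) / 2.
have Y0 : 0 < Y by rewrite divr_gt0// ltr_pwDl ?sqrtr_gt0 ?sqrtr_ge0.
have YE : Y ^+ 2 - Num.sqrt s * Y + D / 4 = 0.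
  have h1 := sqr_sqrtr (ltW s0); have h2 : Num.sqrt (s - D) ^+ 2 = s - D by rewrite sqr_sqrtr// subr_ge0.
  by rewrite /Y; nra.
pose y := Y / `|A i1 i0|.
have y0 : 0 < y by rewrite divr_gt0.
exists ((A i0 i0 - A i1 i1) / (2 * A i1 i0), y) => //.
rewrite gap_at_pt// /gap /at_pt !mx2E/=.
have y1 := lt0r_neq0 y0.
have -> : A i0 i0 - A i1 i0 * ((A i0 i0 - A i1 i1) / (2 * A i1 i0)) -
   (A i1 i1 + A i1 i0 * ((A i0 i0 - A i1 i1) / (2 * A i1 i0))) = 0 by field.
rewrite expr0n/= add0r.
have -> : A i0 i1 + (A i0 i0 - A i1 i1) * ((A i0 i0 - A i1 i1) / (2 * A i1 i0)) -
    A i1 i0 * ((A i0 i0 - A i1 i1) / (2 * A i1 i0)) ^+ 2 = D / (4 * A i1 i0) by rewrite DE; field.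
have cy : `|A i1 i0| * y = Y by rewrite /y mulrC divfK// gt_eqF.
have E : D / (4 * `|A i1 i0|) / y + `|A i1 i0| * y = Num.sqrt s.
  have c2 := lt0r_neq0 c1.
  have -> : D / (4 * `|A i1 i0|) / y = D / (4 * Y) by rewrite -cy; field; rewrite y1 c2.
  rewrite cy; have Y1 := lt0r_neq0 Y0; apply: (mulIf Y1).
  by rewrite mulrDl -expr2; have -> : D / (4 * Y) * Y = D / 4 by [field]; lra.
rewrite -[s in RHS](sqr_sqrtr (ltW s0)) -E.
have [cp|cn] := leP 0 (A i1 i0); first by rewrite ger0_norm.
rewrite ltr0_norm//; have := c0 => c3; field; by rewrite y1 c0.
Qed.

(** Bounded displacement bounds the entries of [at_pt z A]; the constant K collects the coefficients
    that carry this back to A. *)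
Lemma finite_hgap G z (C : R) : SL2_subgroup G -> discrete_mx G -> H2 z ->
  finite_set [set A | G A /\ hgap z (mobius A z) <= C].
Proof.
move=> sG dG; have [_ _ Gd _ _] := sG.
case: z => x y; rewrite /H2/= => y0.
have u0 : 0 <= `|x| / y by rewrite divr_ge0// ltW.
have v0 : 0 < y^-1 by rewrite invr_gt0.
have w0 : 0 <= x ^+ 2 / y by rewrite divr_ge0 ?sqr_ge0// ltW.
pose f := `|C| + 3.
pose K := 1 + `|x| / y + y^-1 + y + 2 * `|x| + x ^+ 2 / y.
apply: sub_finite_set (discrete_finite (f * K) sG dG) => A [GA hA]; split => //.
have dA := Gd A GA; have y1 := lt0r_neq0 y0.
have f0 : 0 <= f by rewrite /f; have := normr_ge0 C; lra.
have dh : \det (at_pt (x, y) A) = 1 by rewrite det_at_pt.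
have bd u : u ^+ 2 <= C + 2 -> `|u| <= f.
  move=> hu; rewrite -ler_sqr ?nnegrE// real_normK ?num_real// /f.
  by have := ler_norm C; have := normr_ge0 C; nra.
rewrite gap_at_pt// in hA.
move: dh hA; rewrite det2E /gap /at_pt !mx2E/= => dh hA.
have gb a b c d : a * d - b * c = 1 -> (a - d) ^+ 2 + (b + c) ^+ 2 <= C ->
    [/\ `|a| <= f, `|b| <= f, `|c| <= f & `|d| <= f].
  move=> h1 h2; have := sqr_ge0 a; have := sqr_ge0 b; have := sqr_ge0 c; have := sqr_ge0 d.
  by move=> *; split; apply: bd; lra.
have [h1 h2 h3 h4] := gb _ _ _ _ dh hA.
have cE : A i1 i0 = (A i1 i0 * y) / y by field.
have cb : `|A i1 i0| <= f * y^-1.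
  by rewrite cE normrM [ `|y^-1|]gtr0_norm// ler_pM2r.
have cx : `|A i1 i0 * x| <= f * (`|x| / y).
  have -> : f * (`|x| / y) = f * y^-1 * `|x| by ring.
  by rewrite normrM ler_wpM2r.
have cxx : `|A i1 i0 * x ^+ 2| <= f * (x ^+ 2 / y).
  have -> : f * (x ^+ 2 / y) = f * y^-1 * x ^+ 2 by ring.
  by rewrite normrM [ `|x ^+ 2|]ger0_norm ?sqr_ge0// ler_wpM2r ?sqr_ge0.
have hb : `|A i0 i1 + (A i0 i0 - A i1 i1) * x - A i1 i0 * x ^+ 2| <= f * y.
  by move: h2; rewrite normrM [ `|y^-1|]gtr0_norm// ler_pdivrMr.
have hax : `|(A i0 i0 - A i1 i0 * x - (A i1 i1 + A i1 i0 * x)) * x| <= f * (2 * `|x|).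
  rewrite normrM mulrA ler_wpM2r//.
  by apply: le_trans (ler_normB _ _) _; lra.
move=> i j.
have KE : f * K = f + f * (`|x| / y) + f * y^-1 + f * y + f * (2 * `|x|) + f * (x ^+ 2 / y).
  by rewrite /K !mulrDr mulr1.
have p1 : 0 <= f * (`|x| / y) by apply: mulr_ge0.
have p2 : 0 <= f * y^-1 by apply: mulr_ge0 => //; exact: ltW.
have p3 : 0 <= f * y by apply: mulr_ge0 => //; exact: ltW.
have p4 : 0 <= f * (2 * `|x|) by apply: mulr_ge0 => //; exact: mulr_ge0.
have p5 : 0 <= f * (x ^+ 2 / y) by apply: mulr_ge0.
rewrite KE.
move: h1 h4 cb cx cxx hb hax; rewrite !ler_norml => /andP[? ?] /andP[? ?] /andP[? ?] /andP[? ?] /andP[? ?] /andP[? ?] /andP[? ?].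
by case: (I2_cases i) => ->; case: (I2_cases j) => ->; apply/andP; split; lra.
Qed.

Definition thick G (e : R) z := forall A, G A -> hgap z (mobius A z) < e -> A = 1 \/ A = -1.

(** A greedily chosen e-separated family of thick points modulo G. Thickness rules out self-overlap,
    so [packing] bounds the size of the family, and a maximal one covers. *)
Lemma thick_cover G (e : R) : SL2_subgroup G -> discrete_mx G -> finite_area G -> 0 < e ->
  exists s : seq (R * R), (forall z, z \in s -> H2 z) /\
    forall w, H2 w -> thick G e w -> exists A z, [/\ G A, z \in s & hgap w (mobius A z) < e].
Proof.
move=> sG dG aG e0; have [G1 GN1 Gd GM GV] := sG.
apply: contrapT => H.
have [N HN] := packing sG dG aG e0.
suff [s [ss s2 st ssep]] : exists s : seq (R * R), [/\ size s = N.+1, (forall z, z \in s -> H2 z),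
    (forall z, z \in s -> thick G e z) &
    forall i j A, (i < j < size s)%N -> G A -> e <= hgap (nth (0, 0) s j) (mobius A (nth (0, 0) s i))].
  have s2' i : (i < N.+1)%N -> H2 (nth (0, 0) s i) by move=> iN; apply/s2/mem_nth; rewrite ss.
  have := HN N.+1 (nth (0, 0) s) s2'; rewrite ltnn => /(_ _)/negP; apply => //.
  move=> i j A iN jN GA hA.
  have [ij|ji|ij] := ltngtP i j.
  - have := ssep i j A^-1; rewrite ij ss jN => /(_ isT (GV _ GA)).
    have dA := Gd A GA; have zi := s2' i iN; have zj := s2' j jN.
    have -> : hgap (nth (0, 0) s j) (mobius A^-1 (nth (0, 0) s i)) = hgap (nth (0, 0) s i) (mobius A (nth (0, 0) s j)).
      rewrite -(hgap_mobius dA zj); last by apply: mobius_H2 => //; exact: detV2.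
      by rewrite mobiusKV// hgapC.
    by rewrite leNgt hA.
  - by have := ssep j i A; rewrite ji ss iN => /(_ isT GA); rewrite leNgt hA.
  - split => //; apply: (st (nth (0, 0) s i)) => //; first by apply: mem_nth; rewrite ss.
    by rewrite {2}ij.
elim: N.+1 => [|n [s [ss s2 st ssep]]].
  by exists [::]; split=> // i j A; rewrite ltn0 andbF.
have [w [w2 [tw hw]]] : exists w, H2 w /\ (thick G e w /\ forall A z, G A -> z \in s -> e <= hgap w (mobius A z)).
  apply: contrapT => K; apply: H; exists s; split => // w w2 tw; apply: contrapT => K2.
  apply: K; exists w; split => //; split => // A z GA zs; rewrite leNgt; apply/negP => lt.
  by apply: K2; exists A, z.
exists (rcons s w); split.
- by rewrite size_rcons ss.
- by move=> z; rewrite mem_rcons inE => /orP[/eqP->//|]; exact: s2.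
- by move=> z; rewrite mem_rcons inE => /orP[/eqP->//|]; exact: st.
- move=> i j A; rewrite size_rcons ltnS => /andP[ij js] GA; rewrite !nth_rcons (leq_trans ij js).
  have [jlt|jge] := ltnP j (size s); first by apply: ssep => //; rewrite ij.
  have -> : j == size s by rewrite eqn_leq js jge.
  by apply: hw => //; apply: mem_nth; rewrite (leq_trans ij js).
Qed.

Lemma finite_set_argmin (T : choiceType) (S : set T) (f : T -> R) : finite_set S -> S !=set0 ->
  exists2 x, S x & forall y, S y -> f x <= f y.
Proof.
move=> finS [x0 Sx0].
have [s sE] := (finite_seqP S).1 finS.
have xs : x0 \in s by have : [set` s] x0 by rewrite -sE.
suff [x xin xmin] : exists2 x, x \in s & forall y, y \in s -> f x <= f y.
  exists x; first by rewrite sE.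
  by move=> y Sy; apply: xmin; have : [set` s] y by rewrite -sE.
elim: s x0 xs {sE Sx0} => // a s IH _ _.
have [s0|[b bs]] : s = [::] \/ exists b, b \in s.
  by case: (s) => [|b s']; [left|right; exists b; rewrite inE eqxx].
  by exists a; rewrite ?inE ?eqxx// s0 => y; rewrite inE => /eqP->.
have [x xin xmin] := IH b bs.
have [ax|xa] := leP (f a) (f x).
  exists a; first by rewrite inE eqxx.
  move=> y; rewrite inE => /orP[/eqP->//|ys]; exact: le_trans ax (xmin y ys).
exists x; first by rewrite inE xin orbT.
by move=> y; rewrite inE => /orP[/eqP->|]; [exact: ltW|exact: xmin].
Qed.

End thick_part.

(** * Finiteness of the set of bounded traces *)

Section length_spectrum.
Context (R : realType).
Local Notation M := 'M[R]_2.
Implicit Types (G : set M) (A B : M) (p q w z : R * R).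

(** Conjugation by an element of displacement at most T^2 - 2 enlarges the distance to 1 by a factor
    at most 4 T^2. The remaining factor 3 in 12 T^2 pays for the 8 of [near1_gap], as 8 / 9 <= 1. *)
Definition tube_margin (T : R) : R := (1 / 40 / (12 * T ^+ 2)) ^+ 2.

Lemma tube_margin_gt0 T : 2 <= T -> 0 < tube_margin T.
Proof.
move=> T2; apply: exprn_gt0; apply: divr_gt0; first by apply: divr_gt0.
by apply: mulr_gt0 => //; apply: exprn_gt0; apply: lt_le_trans T2.
Qed.

Lemma tube_margin_le T : 2 <= T -> tube_margin T <= zmargin R.
Proof.
move=> T2; rewrite /tube_margin /zmargin.
have T4 : 4 <= T ^+ 2 by nra.
have u0 : 0 < 1 / 40 :> R by apply: divr_gt0.
move: (1 / 40) u0 => u u0.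
have t0 : 0 < 12 * T ^+ 2 by lra.
rewrite ler_pXn2r// ?nnegrE; [|by rewrite divr_ge0 ?(ltW t0) ?(ltW u0)|exact: ltW].
by rewrite ler_pdivrMr// ler_peMr ?(ltW u0)//; lra.
Qed.

Lemma conj_short G z (T : R) A D : surface_group G -> H2 z -> G A -> G D -> 2 <= T ->
  hgap z (mobius A z) + 2 <= T ^+ 2 -> hgap z (mobius D z) < tube_margin T ->
  hgap z (mobius (A * D * A^-1) z) <= zmargin R.
Proof.
move=> sG z0 GA GD T2 hA hD.
have [sG' dG tG] := sG; have [G1 GN1 Gd GM GV] := sG'.
have dA := Gd A GA; have dD := Gd D GD; have GC := group_conj sG' GD GA; have dC := Gd _ GC.
pose d := 1 / 40 / (12 * T ^+ 2).
have T24 : 4 <= T ^+ 2 by nra.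
have u0 : 0 < 1 / 40 :> R by apply: divr_gt0.
have u1 : 1 / 40 <= 1 :> R by rewrite ler_pdivrMr// mul1r ler1n.
have t0 : 0 < 12 * T ^+ 2 by lra.
have d0 : 0 <= d by rewrite divr_ge0 ?(ltW t0) ?(ltW u0).
have d1 : d <= 1 by rewrite /d ler_pdivrMr// mul1r; lra.
rewrite gap_at_pt// at_ptM// at_ptM// at_ptV//.
rewrite gap_at_pt// in hA; rewrite gap_at_pt// in hD.
have dh : \det (at_pt z A) = 1 by rewrite det_at_pt.
have dh' : \det (at_pt z D) = 1 by rewrite det_at_pt.
have : near1 d (at_pt z D) \/ near1 d (- at_pt z D).
  by apply: gap_near1; rewrite ?tr_at_pt ?d0//; [exact: group_tr_ge GD|exact: ltW].
move: (at_pt z D) (at_pt z A) hA dh dh' => X Y hA dY dX.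
have nC X' : near1 d X' -> near1 (4 * T ^+ 2 * d) (Y * X' * Y^-1).
  move=> nX i j.
  have bT u : u ^+ 2 <= T ^+ 2 -> `|u| <= T.
    move=> hu; have T0' : 0 <= T by apply: le_trans T2.
    by rewrite -ler_sqr ?nnegrE// real_normK ?num_real.
  have Yb k l : `|Y k l| <= T.
    move: dY hA; rewrite det2E /gap => dY hA.
    have := sqr_ge0 (Y i0 i0); have := sqr_ge0 (Y i0 i1); have := sqr_ge0 (Y i1 i0); have := sqr_ge0 (Y i1 i1) => *.
    by case: (I2_cases k) => ->; case: (I2_cases l) => ->; apply: bT; lra.
  have Vb k l : `|Y^-1 k l| <= T.
    by rewrite (inv2E dY); case: (I2_cases k) => ->; case: (I2_cases l) => ->; rewrite mx2E ?normrN.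
  have -> : (Y * X' * Y^-1) i j - (1 : M) i j = (Y * (X' - 1) * Y^-1) i j.
    by rewrite mulrBr mulr1 mulrBl mulrV ?det1_unit// !mxE.
  have T0 : 0 <= T by lra.
  have h1 k : `|(Y * (X' - 1)) i k| <= 2 * (T * d).
    rewrite mulmx2E; apply: le_trans (ler_normD _ _) _; rewrite !normrM mulrDl mul1r.
    have E k' l : (X' - 1 : M) k' l = X' k' l - (1 : M) k' l by rewrite !mxE.
    by rewrite !E; apply: lerD; apply: ler_pM.
  rewrite mulmx2E; apply: le_trans (ler_normD _ _) _; rewrite !normrM.
  have -> : 4 * T ^+ 2 * d = 2 * (T * d) * T + 2 * (T * d) * T by ring.
  by apply: lerD; apply: ler_pM.
have fin : 8 * (4 * T ^+ 2 * d) ^+ 2 <= zmargin R.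
  have -> : 4 * T ^+ 2 * d = 1 / 40 / 3.
    have T00 : T != 0 by rewrite gt_eqF// (lt_le_trans _ T2).
    by rewrite /d; move: (1 / 40) => u; field.
  by rewrite /zmargin; move: (1 / 40) => u; have := sqr_ge0 u; lra.
case=> /nC /near1_gap h; apply: le_trans fin; first exact: h.
by rewrite mulrN mulNr gapN in h.
Qed.

Lemma hyperbolic_nscalar A : 4 < (\tr A) ^+ 2 -> \det A = 1 -> ~ scalar2 A.
Proof.
move=> tA dA [b c ad]; move: tA dA; rewrite tr2E det2E b c ad; nra.
Qed.

(* If the axis of A is not thick, move away from it until the shortest element of G with the same
   axis is displaced by exactly the margin: no other element is shorter there. *)
Lemma thick_witness G (T : R) A : surface_group G -> G A -> 2 <= T ->
  4 < (\tr A) ^+ 2 -> (\tr A) ^+ 2 <= T ^+ 2 ->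
  exists w B, [/\ H2 w, thick G (tube_margin T) w, G B, 4 < (\tr B) ^+ 2 & hgap w (mobius B w) <= T ^+ 2] /\
    hgap w (mobius A w) * ((\tr B) ^+ 2 - 4) = ((\tr A) ^+ 2 - 4) * hgap w (mobius B w).
Proof.
move=> sG GA T2 tA tAT.
have [sG' dG tG] := sG; have [G1 GN1 Gd GM GV] := sG'.
have dA := Gd A GA.
set e := tube_margin T.
have e0 : 0 < e := tube_margin_gt0 T2.
have ez : e <= zmargin R := tube_margin_le T2.
have [z z2 hz] := axis_point dA tA (lexx _).
have [tz|ntz] := pselect (thick G e z).
  exists z, A; split; last by rewrite mulrC.
  by split => //; rewrite hz; lra.
have [D [GD hD D1]] : exists D, [/\ G D, hgap z (mobius D z) < e & ~ (D = 1 \/ D = -1)].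
  by apply: contrapT => H; apply: ntz => D GD hD; apply: contrapT => D1; apply: H; exists D.
(* D and its conjugate by A are both short at z, so they commute by Zassenhaus' lemma, and then D
   commutes with A itself. *)
have comD : D * A = A * D.
  apply: (commute_conj_commute sG GD GA D1).
  apply: (zassenhaus sG z2) => //; first exact: group_conj.
    by rewrite ltW// (lt_le_trans hD).
  by apply: (conj_short sG z2 GA GD T2 _ hD); rewrite hz; lra.
have nsA := hyperbolic_nscalar tA dA.
pose S := [set B | (G B /\ hgap z (mobius B z) <= e) /\ exists2 l, l != 0 & traceless_prop l A B].
have finS : finite_set S by apply: sub_finite_set (finite_hgap e sG' dG z2) => B [H _]; exact: H.
have S0 : S !=set0.
  exists D; split; first by split => //; exact: ltW.
  have [l P] := commute_traceless nsA (esym comD); exists l => //.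
  exact: traceless_neq0 (Gd D GD) D1 P.
have [B [[GB hB] [l l0 P]] Bmin] := finite_set_argmin (fun B => hgap z (mobius B z)) finS S0.
have dB := Gd B GB.
have tB := traceless_disc dA dB P.
have zB := traceless_hgap dA dB z2 P.
rewrite hz -tB in zB.
have l2 : 0 < l ^+ 2 by rewrite exprn_even_gt0.
have tB4 : 4 < (\tr B) ^+ 2.
  by rewrite -subr_gt0 tB mulr_gt0// subr_gt0.
have [w w2 hw] : exists2 w, H2 w & hgap w (mobius B w) = e by apply: axis_point => //; rewrite -zB.
have nsB := hyperbolic_nscalar tB4 dB.
exists w, B; split; last first.
  by rewrite tB (traceless_hgap dA dB w2 P); ring.
have z1 : zmargin R <= 1.
  by apply: exprn_ile1; [apply: divr_ge0|rewrite ler_pdivrMr// mul1r ler1n].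
have T24 : 4 <= T ^+ 2 by nra.
split => //; last by rewrite hw; lra.
(* An element C shorter than B at w commutes with B, so its displacement is a fixed multiple, less
   than 1, of that of B everywhere; at z this contradicts the minimal choice of B. *)
move=> C GC hC; apply: contrapT => C1; have dC := Gd C GC.
have comC : B * C = C * B.
  by apply: (zassenhaus sG w2) => //; [rewrite hw|rewrite ltW// (lt_le_trans hC)].
have [l' P'] := commute_traceless nsB comC.
have l'0 := traceless_neq0 dC C1 P'.
have wC := traceless_hgap dB dC w2 P'; have zC := traceless_hgap dB dC z2 P'.
have l'1 : l' ^+ 2 < 1 by rewrite -(ltr_pM2r e0) mul1r -[X in _ * X < _]hw -wC.
have lt : hgap z (mobius C z) < hgap z (mobius B z).
  by rewrite zC gtr_pMl// zB subr_gt0.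
have : S C.
  split; first by split => //; rewrite ltW// (lt_le_trans lt).
  exists (l' * l); first by rewrite mulf_neq0.
  exact: traceless_trans P P'.
by move=> /Bmin; rewrite leNgt lt.
Qed.

Definition tri (e b : R) := 4 * (e * b + e + b).

Lemma conj_displacement G w z A X (e b : R) : SL2_subgroup G -> G A -> G X -> H2 w -> H2 z ->
  0 <= b -> hgap w (mobius X z) <= e -> hgap w (mobius A w) <= b ->
  hgap z (mobius (X^-1 * A * X) z) <= tri e (tri e b).
Proof.
move=> [G1 GN1 Gd GM GV] GA GX w2 z2 b0 hX hA.
have dA := Gd A GA; have dX := Gd X GX; have dV := detV2 dX.
have Xz2 := mobius_H2 dX z2; have Aw2 := mobius_H2 dA w2; have AXz2 := mobius_H2 dA Xz2.
have -> : hgap z (mobius (X^-1 * A * X) z) = hgap (mobius X z) (mobius A (mobius X z)).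
  rewrite -(hgap_mobius dX z2); last by apply: mobius_H2; rewrite ?detM2 ?dV ?dA ?dX ?mulr1.
  by rewrite -!mobiusM// ?detM2 ?dV ?dA ?dX ?mulr1// !mulrA mulrV ?mul1r// det1_unit.
have g1 := hgap_ge0 w2 Xz2; have g2 := hgap_ge0 w2 Aw2; have g3 := hgap_ge0 Xz2 Aw2.
have t1 : hgap (mobius X z) (mobius A w) <= tri e b.
  apply: le_trans (hgap_triangle Xz2 w2 Aw2) _; rewrite [hgap (mobius X z) w]hgapC /tri.
  rewrite ler_pM2l//; do 2 apply: lerD => //; exact: ler_pM.
apply: le_trans (hgap_triangle Xz2 Aw2 AXz2) _.
rewrite hgap_mobius// /tri -/(tri e b) ler_pM2l//.
rewrite [hgap (mobius X z) _ * _]mulrC [leLHS]addrAC; apply: lerD => //; apply: lerD => //.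
exact: ler_pM.
Qed.

Lemma finite_near_points G (s : seq (R * R)) (C : R) : SL2_subgroup G -> discrete_mx G ->
  (forall z, z \in s -> H2 z) ->
  finite_set [set A | G A /\ exists2 z, z \in s & hgap z (mobius A z) <= C].
Proof.
move=> sG dG s2.
have -> : [set A | G A /\ exists2 z, z \in s & hgap z (mobius A z) <= C] =
    \bigcup_(z in [set` s]) [set A | G A /\ hgap z (mobius A z) <= C].
  by apply/seteqP; split => [A [GA [z zs h]]|A [z zs [GA h]]]; [exists z|split => //; exists z].
apply: bigcup_finite; first exact: finite_seq.
by move=> z zs; apply: finite_hgap => //; exact: s2.
Qed.

(** Each A has a thick witness w, which lies near a translate X z of one of finitely many points.
    Conjugated by X, the element A moves z by a bounded amount, and only finitely many elements do
    so. *)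
Lemma finite_traces G (T : R) : surface_group G -> finite_area G ->
  finite_set [set t | exists A, [/\ G A, t = \tr A, 4 < t ^+ 2 & t ^+ 2 <= T ^+ 2]].
Proof.
move=> sG aG; have [sG' dG tG] := sG; have [G1 GN1 Gd GM GV] := sG'.
wlog T2 : T / 2 <= T.
  move=> W; apply: sub_finite_set (W (`|T| + 2) _); last by rewrite lerDr.
  move=> t [A [GA tE t4 tT]]; exists A; split => //; apply: le_trans tT _.
  by have := real_normK (num_real T); have := normr_ge0 T; nra.
have e0 := tube_margin_gt0 T2; set e := tube_margin T in e0.
have [s [s2 scov]] := thick_cover sG' dG aG e0.
pose S1 := [set A | (G A /\ exists2 z, z \in s & hgap z (mobius A z) <= tri e (tri e (T ^+ 2)))
   /\ 4 < (\tr A) ^+ 2].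
have finS1 : finite_set S1.
  by apply: sub_finite_set (finite_near_points (tri e (tri e (T ^+ 2))) sG' dG s2) => A [H _]; exact: H.
have trE A X : G X -> \tr (X^-1 * A * X) = \tr A.
  by move=> GX; rewrite -{2}[X]invrK tr_conj// detV2// Gd.
have wit A : G A -> 4 < (\tr A) ^+ 2 -> (\tr A) ^+ 2 <= T ^+ 2 -> exists w B X z,
    [/\ [/\ H2 w, G X, z \in s & hgap w (mobius X z) <= e], S1 (X^-1 * B * X), \tr (X^-1 * B * X) = \tr B,
     hgap w (mobius B w) <= T ^+ 2
     & hgap w (mobius A w) * ((\tr B) ^+ 2 - 4) = ((\tr A) ^+ 2 - 4) * hgap w (mobius B w)].
  move=> GA tA tAT; have [w [B [[w2 tw GB tB hB] E]]] := thick_witness sG GA T2 tA tAT.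
  have [X [z [GX zs hX]]] := scov w w2 tw.
  exists w, B, X, z; split => //; [by split => //; exact: ltW| |exact: trE].
  split; last by rewrite trE.
  split; first by apply: (GM) => //; apply: (GM) => //; exact: GV.
  exists z => //; apply: (conj_displacement sG' GB GX w2 (s2 z zs)) => //; [exact: sqr_ge0|exact: ltW].
have [S10|S10] := pselect (S1 !=set0); last first.
  rewrite (_ : [set t | _] = set0)//; apply/seteqP; split => // t [A [GA tE t4 tT]].
  rewrite tE in t4 tT; have [w [B [X [z [_ H _ _ _]]]]] := wit A GA t4 tT.
  by apply: S10; exists (X^-1 * B * X).
have [B0 [_ tB0] B0min] := finite_set_argmin (fun A => (\tr A) ^+ 2) finS1 S10.
pose mu := (\tr B0) ^+ 2 - 4.
have mu0 : 0 < mu by rewrite subr_gt0.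
(* The witness bounds the displacement of A only relative to that of B. The conjugates of the
   possible B form a finite set, so their tr^2 - 4 has a positive minimum mu, and A moves w by at
   most T^2 T^2 / mu. *)
pose b := T ^+ 2 * T ^+ 2 / mu.
have T20 : 0 <= T ^+ 2 by exact: sqr_ge0.
apply: (@sub_finite_set _ _ ((fun A => \tr A) @` [set A | G A /\ exists2 z, z \in s & hgap z (mobius A z) <= tri e (tri e b)])); last first.
  exact/finite_image/finite_near_points.
move=> t [A [GA tE t4 tT]]; rewrite tE in t4 tT.
have [w [B [X [z [[w2 GX zs hX] SB tB hB E]]]]] := wit A GA t4 tT.
exists (X^-1 * A * X); last by rewrite trE.
split; first by apply: (GM) => //; apply: (GM) => //; exact: GV.
exists z => //; apply: (conj_displacement sG' GA GX w2 (s2 z zs)) => //.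
  by apply: divr_ge0; [exact: mulr_ge0|exact: ltW].
have := B0min _ SB; rewrite tB => hmu.
rewrite /b ler_pdivlMr//; apply: (@le_trans _ _ (hgap w (mobius A w) * ((\tr B) ^+ 2 - 4))).
  by rewrite ler_wpM2l// ?lerD2r//; apply: hgap_ge0 => //; apply: mobius_H2 => //; exact: Gd.
have wB : 0 <= hgap w (mobius B w).
  apply: hgap_ge0 => //; apply: mobius_H2 => //; apply: (Gd).
  have [[GXB _] _] := SB.
  have -> : B = X * (X^-1 * B * X) * X^-1.
    by have uX := det1_unit (Gd X GX); rewrite !mulrA mulrV// mul1r mulrK.
  exact: group_conj.
by rewrite E; apply: ler_pM => //; lra.
Qed.

End length_spectrum.

From mathcomp Require Import finmap.

(** * Parabolic elements, and lengths as functions of traces *)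

Section lengths.
Context (R : realType).
Local Notation M := 'M[R]_2.
Implicit Types (G : set M) (A B : M) (p q w z : R * R).

Lemma hball_box (s : seq (R * R)) (e : R) : 0 < e -> (forall z, z \in s -> H2 z) ->
  exists X lo hi, 0 < lo /\ forall z p, z \in s -> H2 p -> hgap p z < e ->
    [/\ - X <= p.1 <= X & lo <= p.2 <= hi].
Proof.
move=> e0; elim: s => [|z s IH] s2; first by exists 0, 1, 1.
have [X [lo [hi [lo0 H]]]] : exists X lo hi, 0 < lo /\ forall z p, z \in s -> H2 p -> hgap p z < e ->
    [/\ - X <= p.1 <= X & lo <= p.2 <= hi].
  by apply: IH => u us; apply: s2; rewrite inE us orbT.
have z0 : H2 z by apply: s2; rewrite inE eqxx.
case: z z0 s2 => x y; rewrite /H2/= => y0 _.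
exists (Num.max X (`|x| + (e + 2) * y)), (Num.min lo (y / (e + 2))), (Num.max hi ((e + 2) * y)).
have e2 : 0 < e + 2 by lra.
split; first by rewrite lt_min lo0 divr_gt0.
move=> z [a b]; rewrite inE => /orP[/eqP->|zs] b0 hp; last first.
  have [h1 h2] := H z _ zs b0 hp; move: h1 h2; rewrite /= => /andP[h1 h2] /andP[h3 h4].
  split; last by rewrite ge_min h3/= le_max h4.
  by rewrite lerNl le_max -lerNl h1/= le_max h2.
move: b0 hp; rewrite /H2/hgap/= => b0; rewrite ltr_pdivrMr ?mulr_gt0// => hp.
have yb : b <= (e + 2) * y.
  by rewrite -(ler_pM2r b0); have := sqr_ge0 (a - x); have := sqr_ge0 y; nra.
have by_ : y <= (e + 2) * b.
  by rewrite -(ler_pM2r y0); have := sqr_ge0 (a - x); have := sqr_ge0 b; nra.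
have ax : `|a - x| <= (e + 2) * y.
  have h0 : 0 <= (e + 2) * y by rewrite mulr_ge0// ltW.
  rewrite -ler_sqr ?nnegrE// real_normK ?num_real//.
  have : e * (b * y) <= e * ((e + 2) * y * y) by rewrite ler_wpM2l ?(ltW e0)// ler_wpM2r// ltW.
  have : 0 <= (e + 2) * y ^+ 2 by rewrite mulr_ge0 ?sqr_ge0// ltW.
  by have := sqr_ge0 (b - y); nra.
split; last by rewrite ge_min ler_pdivrMr// mulrC by_ orbT/= le_max yb orbT.
have : `|a| <= `|x| + (e + 2) * y.
  by rewrite -(subrK x a) (le_trans (ler_normD _ _))// addrC lerD2l.
rewrite ler_norml => /andP[h1 h2].
by rewrite lerNl le_max -[X in _ || X]lerNl h1 orbT/= le_max h2 orbT.
Qed.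

(** Without parabolics, [finite_traces] keeps tr^2 - 4 uniformly away from 0 on all elements other
    than 1 and -1. Then every point is thick, and finitely many balls, enclosed in one compact box,
    cover the quotient. *)
Lemma exists_parabolic G : surface_group G -> finite_area G -> ~ compact_quotient G ->
  exists P, [/\ G P, \tr P = 2 & P <> 1].
Proof.
move=> sG aG ncG; have [sG' dG tG] := sG; have [G1 GN1 Gd GM GV] := sG'.
apply: contrapT => H.
have hyp A : G A -> ~ (A = 1 \/ A = -1) -> 4 < (\tr A) ^+ 2.
  move=> GA A1; have := group_tr_ge sG GA; rewrite le_eqVlt => /orP[|//].
  have -> : 4 = 2 ^+ 2 :> R by ring.
  rewrite eq_sym eqf_sqr => /orP[] /eqP t2.
    by exfalso; apply: H; exists A; split => // A1'; apply: A1; left.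
  exfalso; apply: H; exists (- A); split; first exact: group_opp.
    by rewrite raddfN/= t2 opprK.
  by move=> A1'; apply: A1; right; rewrite -A1' opprK.
have [e e0 He] : exists2 e : R, 0 < e & forall A, G A -> ~ (A = 1 \/ A = -1) -> e <= (\tr A) ^+ 2 - 4.
  set S := [set t : R | exists A, [/\ G A, t = \tr A, 4 < t ^+ 2 & t ^+ 2 <= 3 ^+ 2]].
  have finS : finite_set S := finite_traces 3 sG aG.
  have [S0|S0] := pselect (S !=set0); last first.
    exists 1 => // A GA A1; have tA := hyp A GA A1.
    have [t9|t9] := leP ((\tr A) ^+ 2) (3 ^+ 2); last by lra.
    by exfalso; apply: S0; exists (\tr A), A.
  have [t [B [GB tB t4 t9]] tmin] := finite_set_argmin (fun t => t ^+ 2) finS S0.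
  exists (t ^+ 2 - 4); first by lra.
  move=> A GA A1; have tA := hyp A GA A1; rewrite lerD2r.
  have [t9'|t9'] := leP ((\tr A) ^+ 2) (3 ^+ 2); last by apply: le_trans t9 _; exact: ltW.
  by apply: tmin; exists A.
have [s [s2 scov]] := thick_cover sG' dG aG e0.
have [X [lo [hi [lo0 box]]]] := hball_box e0 s2.
apply: ncG; exists (`[- X, X] `*` `[lo, hi]); split.
- by apply: compact_setX; exact: segment_compact.
- by move=> [a b] [_]; rewrite /H2/= in_itv/= => /andP[h _]; exact: lt_le_trans h.
- move=> p p2; have [A [z [GA zs hz]]] : exists A z, [/\ G A, z \in s & hgap p (mobius A z) < e].
    apply: scov => // A GA hA; apply: contrapT => A1.
    have := He A GA A1; rewrite leNgt => /negP; apply; apply: le_lt_trans hA.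
    by rewrite gap_at_pt ?Gd// -(tr_at_pt p); apply: gap_ge_tr; rewrite det_at_pt ?Gd.
  have dA := Gd A GA.
  have q2 : H2 (mobius A^-1 p) by apply: mobius_H2 => //; exact: detV2.
  exists A, (mobius A^-1 p); split => //; last by rewrite mobiusKV.
  have [//|h1 h2] := box z (mobius A^-1 p) zs q2.
    by rewrite -(hgap_mobius dA q2 (s2 z zs)) mobiusKV.
  by split; rewrite /= in_itv.
Qed.

Lemma hdist_hgap p q : H2 p -> H2 q -> hdist p q = arcosh (1 + hgap p q / 2).
Proof.
move=> p2 q2; rewrite /hdist /hgap; congr (arcosh (1 + _)).
by have := lt0r_neq0 p2; have := lt0r_neq0 q2 => *; field; apply/andP.
Qed.

Lemma arcosh_arg_ge1 (u : R) : 1 <= u -> 1 <= u + Num.sqrt (u ^+ 2 - 1).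
Proof. by move=> u1; have := sqrtr_ge0 (u ^+ 2 - 1); lra. Qed.

Lemma ltr_arcosh (u v : R) : 1 <= u -> u < v -> arcosh u < arcosh v.
Proof.
move=> u1 uv; rewrite /arcosh ltr_ln ?posrE; last 2 first.
- by have := arcosh_arg_ge1 u1; lra.
- by have := @arcosh_arg_ge1 v; lra.
apply: ltr_leD => //; rewrite ler_wsqrtr// lerD2r ler_pXn2r// ?nnegrE; lra.
Qed.

Lemma ler_arcosh (u v : R) : 1 <= u -> u <= v -> arcosh u <= arcosh v.
Proof. by move=> u1; rewrite le_eqVlt => /orP[/eqP->//|uv]; apply/ltW/ltr_arcosh. Qed.

Lemma arcosh_ge0 (u : R) : 1 <= u -> 0 <= arcosh u.
Proof. by move=> u1; apply/ln_ge0/arcosh_arg_ge1. Qed.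

Lemma hgap_transl_ge A p : \det A = 1 -> H2 p -> (\tr A) ^+ 2 - 4 <= hgap p (mobius A p).
Proof.
by move=> dA p2; rewrite gap_at_pt// -(tr_at_pt p); apply: gap_ge_tr; rewrite det_at_pt.
Qed.

(** The infimum is attained on the axis. The value equals 2 arcosh (|tr A| / 2). *)
Lemma transl_length_hyperbolic A : \det A = 1 -> 4 < (\tr A) ^+ 2 ->
  transl_length A = arcosh ((\tr A) ^+ 2 / 2 - 1).
Proof.
move=> dA tA; have [w w2 hw] := axis_point dA tA (lexx _).
have E : (\tr A) ^+ 2 / 2 - 1 = 1 + ((\tr A) ^+ 2 - 4) / 2 by field.
have lb : lbound [set hdist p (mobius A p) | p in @H2 R] (arcosh ((\tr A) ^+ 2 / 2 - 1)).
  move=> _ [p p2 <-]; have Ap2 := mobius_H2 dA p2; rewrite hdist_hgap// E.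
  by apply: ler_arcosh; [lra|have := hgap_transl_ge dA p2; lra].
apply/eqP; rewrite /transl_length eq_le; apply/andP; split.
  apply: ge_inf; first by exists (arcosh ((\tr A) ^+ 2 / 2 - 1)).
  by exists w => //; rewrite hdist_hgap ?hw ?E//; exact: mobius_H2.
by apply: lb_le_inf => //; exists (hdist w (mobius A w)), w.
Qed.

Lemma parabolic_small_gap A (s : R) : \det A = 1 -> (\tr A) ^+ 2 = 4 -> 0 < s ->
  exists2 w, H2 w & hgap w (mobius A w) <= s.
Proof.
move=> dA tA s0.
have DE : (A i0 i0 - A i1 i1) ^+ 2 + 4 * (A i0 i1 * A i1 i0) = 0.
  by move: dA tA; rewrite det2E tr2E => h1 h2; nra.
have [c0|c0] := eqVneq (A i1 i0) 0.
  have ad : A i0 i0 - A i1 i1 = 0.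
    by apply/eqP; rewrite -sqrf_eq0; apply/eqP; move: DE; rewrite c0; lra.
  pose y := (1 + A i0 i1 ^+ 2) / s + 1.
  have y1 : 1 <= y by rewrite lerDr divr_ge0 ?(ltW s0)// addr_ge0// sqr_ge0.
  have y0 : 0 < y by lra.
  exists (0, y) => //; rewrite gap_at_pt//.
  have -> : gap (at_pt (0, y) A) = A i0 i1 ^+ 2 / y ^+ 2.
    by rewrite /gap /at_pt !mx2E/= c0; have y2 := lt0r_neq0 y0; rewrite -[A i0 i0](subrK (A i1 i1)) ad; field.
  rewrite ler_pdivrMr ?exprn_gt0//.
  have h1 : A i0 i1 ^+ 2 <= s * y.
    have -> : s * y = 1 + A i0 i1 ^+ 2 + s by rewrite /y; field; rewrite gt_eqF.
    by lra.
  apply: le_trans h1 _; rewrite ler_pM2l//; nra.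
have c1 : 0 < `|A i1 i0| by rewrite normr_gt0.
pose y := Num.sqrt s / `|A i1 i0|.
have y0 : 0 < y by rewrite divr_gt0// sqrtr_gt0.
exists ((A i0 i0 - A i1 i1) / (2 * A i1 i0), y) => //.
rewrite gap_at_pt//.
have y1 := lt0r_neq0 y0.
have -> : gap (at_pt ((A i0 i0 - A i1 i1) / (2 * A i1 i0), y) A) =
   (((A i0 i0 - A i1 i1) ^+ 2 + 4 * (A i0 i1 * A i1 i0)) / (4 * A i1 i0 * y) + A i1 i0 * y) ^+ 2.
  by rewrite /gap /at_pt !mx2E/=; field; rewrite c0 y1.
rewrite DE mul0r add0r -real_normK ?num_real// normrM (gtr0_norm y0) /y mulrC divfK ?gt_eqF//.
by rewrite sqr_sqrtr// ltW.
Qed.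

(** Points close to the fixed point are moved arbitrarily little. Hence parabolics never enter
    [length_set]. *)
Lemma transl_length_parabolic A : \det A = 1 -> (\tr A) ^+ 2 = 4 -> transl_length A <= 0.
Proof.
move=> dA tA; apply/ler_addgt0Pl => e e0; rewrite addr0.
pose m := Num.min 1 e.
have m0 : 0 < m by rewrite lt_min ltr01.
have m1 : m <= 1 by rewrite ge_min lexx.
have me : m <= e by rewrite ge_min lexx orbT.
pose s := m ^+ 2 / 4.
have s0 : 0 < s by rewrite divr_gt0// exprn_gt0.
have [w w2 hw] := parabolic_small_gap dA tA s0.
have Aw2 := mobius_H2 dA w2; have g0 := hgap_ge0 w2 Aw2.
apply: le_trans (_ : hdist w (mobius A w) <= e).
  apply: ge_inf; last by exists w.
  exists 0 => _ [p p2 <-]; have Ap2 := mobius_H2 dA p2; rewrite hdist_hgap//; apply: arcosh_ge0.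
  by have := hgap_ge0 p2 Ap2; lra.
rewrite hdist_hgap//; set g := hgap _ _ in hw g0 *.
rewrite /arcosh; set v := _ + Num.sqrt _.
have -> : v = 1 + (v - 1) by ring.
have q0 := sqrtr_ge0 ((1 + g / 2) ^+ 2 - 1).
apply: le_trans (le_ln1Dx _) _; first by rewrite /v; lra.
have h2 : Num.sqrt ((1 + g / 2) ^+ 2 - 1) <= 3 / 4 * m.
  have mm : 0 <= 3 / 4 * m by lra.
  rewrite -(ger0_norm mm) -sqrtr_sqr ler_wsqrtr//.
  move: hw; rewrite /s => hw.
  have m2 : m ^+ 2 <= 1 by rewrite exprn_ile1// ltW.
  have : g * g <= 1 / 4 * g by rewrite ler_wpM2r//; lra.
  have : 0 <= m ^+ 2 by exact: sqr_ge0.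
  lra.
have mm : m ^+ 2 <= m by rewrite expr2 ler_piMl// ltW.
by rewrite /v; move: hw; rewrite /s; lra.
Qed.

(** Gives meaning to [count_lengths]: [fset_set] lists the elements of a set only when the set is
    finite. *)
Lemma finite_length_set G (n : nat) : surface_group G -> finite_area G ->
  finite_set (length_set G `&` `[0, n%:R]).
Proof.
move=> sG aG; have [sG' dG tG] := sG; have [G1 GN1 Gd GM GV] := sG'.
have := finite_traces (expR n%:R + 2) sG aG.
move/(finite_image (fun t : R => arcosh (t ^+ 2 / 2 - 1))); apply: sub_finite_set.
move=> l [[l0 [A [GA lE]]]]; rewrite /= in_itv/= => /andP[_ ln].
have dA := Gd A GA.
have := group_tr_ge sG GA; rewrite le_eqVlt => /orP[/eqP t4|t4].
  by have := transl_length_parabolic dA (esym t4); rewrite -lE; lra.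
exists (\tr A); last by rewrite lE transl_length_hyperbolic.
exists A; split => //.
move: ln; rewrite lE transl_length_hyperbolic//; set u := _ / 2 - 1 => ln.
have u1 : 1 <= u by rewrite /u; lra.
have h : u + Num.sqrt (u ^+ 2 - 1) <= expR n%:R.
  by rewrite -[leLHS]lnK ?ler_expR// posrE; have := arcosh_arg_ge1 u1; lra.
have := sqrtr_ge0 (u ^+ 2 - 1); have := expR_gt0 (n%:R : R).
by move: h; rewrite /u; nra.
Qed.

Lemma count_traces G (n : nat) (s : seq R) : surface_group G -> finite_area G -> uniq s ->
  (forall t, t \in s -> [/\ 2 < t, t <= expR (n%:R / 2) & exists2 A, G A & \tr A = t]) ->
  (size s <= count_lengths G n)%N.
Proof.
move=> sG aG us Hs; have [sG' dG tG] := sG; have [G1 GN1 Gd GM GV] := sG'.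
have finL := finite_length_set n sG aG.
pose f (t : R) := arcosh (t ^+ 2 / 2 - 1).
have finj : {in s &, injective f}.
  move=> t t' ts ts' E; have [h _ _] := Hs t ts; have [h' _ _] := Hs t' ts'.
  have lt a b : 2 < a -> a < b -> f a < f b.
    by move=> a2 ab; apply: ltr_arcosh; nra.
  by have [tt|tt|//] := ltgtP t t'; [have := lt _ _ h tt|have := lt _ _ h' tt]; rewrite E ltxx.
rewrite -(size_map f s) /count_lengths.
apply: uniq_leq_size; first by rewrite map_inj_in_uniq.
move=> l /mapP[t ts ->]; have [t2 tn [A GA tA]] := Hs t ts.
have dA := Gd A GA.
have t4 : 4 < (\tr A) ^+ 2 by rewrite tA; nra.
have u1 : 1 < t ^+ 2 / 2 - 1 by nra.
have f0 : 0 < f t.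
  rewrite /f /arcosh; apply: ln_gt0; have := sqrtr_ge0 ((t ^+ 2 / 2 - 1) ^+ 2 - 1); lra.
change (f t \in fset_set (length_set G `&` `[0, n%:R])).
rewrite in_fset_set//; apply/mem_set; split.
  by split => //; exists A; split => //; rewrite transl_length_hyperbolic// tA.
rewrite /= in_itv/= (ltW f0)/= -[leRHS]expRK ler_ln ?posrE ?expR_gt0//; last first.
  by have := sqrtr_ge0 ((t ^+ 2 / 2 - 1) ^+ 2 - 1); lra.
have h1 : Num.sqrt ((t ^+ 2 / 2 - 1) ^+ 2 - 1) <= t ^+ 2 / 2 - 1.
  have u0 : 0 <= t ^+ 2 / 2 - 1 by lra.
  by rewrite -[leRHS](ger0_norm u0) -sqrtr_sqr ler_wsqrtr//; lra.
have h2 : t ^+ 2 <= expR n%:R.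
  have -> : n%:R = n%:R / 2 + n%:R / 2 :> R by field.
  by rewrite expRD -expr2 ler_pXn2r// ?nnegrE ?expR_ge0//; lra.
lra.
Qed.

End lengths.

(** * Cusps and growth of the trace set *)
Section conjugation.
Context (R : realType).
Local Notation M := 'M[R]_2.
Implicit Types (G : set M) (A B h : M).

Definition conjG h G : set M := [set A | G (h * A * h^-1)].

Lemma mulmx2_bound (x y : R) A B : (forall i j, `|A i j| <= x) -> (forall i j, `|B i j| <= y) ->
  forall i j, `|(A * B) i j| <= 2 * (x * y).
Proof.
move=> hA hB i j; rewrite mulmx2E; apply: le_trans (ler_normD _ _) _.
rewrite !normrM mulrDl mul1r.
by apply: lerD; apply: ler_pM.
Qed.

Lemma mx2_bounded A : exists2 x : R, 0 < x & forall i j, `|A i j| <= x.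
Proof.
pose S := `|A i0 i0| + `|A i0 i1| + `|A i1 i0| + `|A i1 i1|.
have := normr_ge0 (A i0 i0); have := normr_ge0 (A i0 i1).
have := normr_ge0 (A i1 i0); have := normr_ge0 (A i1 i1) => h1 h2 h3 h4.
exists (1 + S); first by rewrite /S; lra.
by move=> i j; case: (I2_cases i) => ->; case: (I2_cases j) => ->; rewrite /S; lra.
Qed.

Lemma conj_eq h A B : \det h = 1 -> h * A * h^-1 = h * B * h^-1 -> A = B.
Proof.
by move=> dh E; have uh := det1_unit dh; apply: (mulrI uh); apply: (mulIr (_ : h^-1 \is a GRing.unit)); rewrite ?unitrV.
Qed.

Lemma conjGM h A B : \det h = 1 -> h * (A * B) * h^-1 = (h * A * h^-1) * (h * B * h^-1).
Proof. by move=> dh; rewrite !mulrA mulrVK// det1_unit. Qed.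

Lemma conjGX h A n : \det h = 1 -> h * (A ^+ n) * h^-1 = (h * A * h^-1) ^+ n.
Proof.
move=> dh; elim: n => [|n IH]; first by rewrite !expr0 mulr1 mulrV// det1_unit.
by rewrite !exprS conjGM// IH.
Qed.

Lemma conjG_sub h G : \det h = 1 -> SL2_subgroup G -> SL2_subgroup (conjG h G).
Proof.
move=> dh [G1 GN1 Gd GM GV]; have uh := det1_unit dh; split; rewrite /conjG/=.
- by rewrite mulr1 mulrV.
- by rewrite mulrN1 mulNr mulrV.
- by move=> A /Gd; rewrite !detM2 detV2// dh mul1r mulr1.
- by move=> A B GA GB; rewrite conjGM//; exact: GM.
- move=> A GA; have := GV _ GA; have dA : \det A = 1.
    by have := Gd _ GA; rewrite !detM2 detV2// dh mul1r mulr1.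
  have uA := det1_unit dA.
  by rewrite invrM ?unitrMl ?unitrV// invrK invrM ?mulrA.
Qed.

Lemma conjG_surface h G : \det h = 1 -> surface_group G -> surface_group (conjG h G).
Proof.
move=> dh [sG dG tG]; split; first exact: conjG_sub.
- move=> A GA; have [e [e0 He]] := dG _ GA.
  have [x x0 hx] := mx2_bounded h; have [y y0 hy] := mx2_bounded h^-1.
  exists (e / (8 * (x * y))); split; first by rewrite divr_gt0// !mulr_gt0.
  move=> B GB AB; apply: (conj_eq dh); apply: He => // i j.
  have -> : (h * A * h^-1) i j - (h * B * h^-1) i j = (h * (A - B) * h^-1) i j.
    by rewrite mulrBr mulrBl !mxE.
  have hAB : forall i j, `|(A - B) i j| <= e / (8 * (x * y)) by move=> i' j'; rewrite !mxE ltW.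
  apply: le_lt_trans (mulmx2_bound (mulmx2_bound hx hAB) hy i j) _.
  rewrite [ltLHS](_ : _ = e / 2); first by lra.
  by field; rewrite !gt_eqF.
- move=> A n GA n0 An; have uh := det1_unit dh.
  have : h * A * h^-1 = 1 \/ h * A * h^-1 = -1.
    apply: (tG _ n) => //; rewrite -conjGX//; case: An => ->; [left|right].
      by rewrite mulr1 mulrV.
    by rewrite mulrN1 mulNr mulrV.
  case=> E; [left|right]; apply: (conj_eq dh); rewrite E.
    by rewrite mulr1 mulrV.
  by rewrite mulrN1 mulNr mulrV.
Qed.

Lemma conjG_area h G : \det h = 1 -> (forall A, G A -> \det A = 1) -> finite_area G -> finite_area (conjG h G).
Proof.
move=> dh Gd [F [mF F2 aF cF]]; have uh := det1_unit dh.
have [mF' aF'] := area_preserving_mobius dh mF F2.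
exists (@H2 R `&` mobius h @^-1` F); split; [exact: mF'|by move=> p []|exact: (eq_rect_r (fun a => (a < +oo)%E) aF aF')|].
move=> p p2; have [A [q [GA Fq E]]] := cF _ (mobius_H2 dh p2).
have dA := Gd _ GA; have q2 := F2 _ Fq; have dV := detV2 dh.
exists (h^-1 * A * h), (mobius h^-1 q); split.
- by rewrite /conjG/= !mulrA mulrV// mul1r mulrK.
- by split; [exact: mobius_H2|rewrite /= mobiusKV].
rewrite -mobiusM ?mulrK ?detM2 ?dV ?dA ?dh ?mulr1//.
by rewrite mobiusM// -E mobiusK.
Qed.

Lemma conjG_comp h h' G : \det h = 1 -> \det h' = 1 -> conjG h' (conjG h G) = conjG (h * h') G.
Proof.
move=> dh dh'; apply/seteqP; split => A; rewrite /conjG/= invrM ?det1_unit//; by rewrite !mulrA.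
Qed.

(* An element of trace x has length about 2 ln x. *)
Definition few_traces G := forall eps : R, 0 < eps -> exists x0 : R, forall x (s : seq R), x0 <= x -> uniq s ->
  (forall t, t \in s -> [/\ 2 < t, t <= x & exists2 A, G A & \tr A = t]) ->
  (size s)%:R <= eps * x * ln (ln (3 * ln x)).

Lemma few_traces_conj h G : \det h = 1 -> few_traces G -> few_traces (conjG h G).
Proof.
move=> dh fG eps /fG[x0 H]; exists x0 => x s xx us Hs; apply: H => // t /Hs[t2 tx [A GA tA]].
by split => //; exists (h * A * h^-1) => //; rewrite tr_conj.
Qed.

Lemma expR_half_le2 : expR (1 / 2) <= 2 :> R.
Proof.
have h : 1 / 2 <= expR (- (1 / 2)) :> R by apply: le_trans (expR_ge1Dx _); lra.
have := expRxMexpNx_1 (1 / 2 : R); have := expR_gt0 (1 / 2 : R).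
set a := expR (1/2) in h *; set b := expR _ in h *; move=> a0 ab.
have : a * (1 / 2) <= a * b by rewrite ler_wpM2l// ltW.
lra.
Qed.

Lemma ln4_ge1 : 1 <= ln 4 :> R.
Proof.
rewrite -[leLHS]expRK ler_ln ?posrE ?expR_gt0//.
have -> : 1 = 1 / 2 + 1 / 2 :> R by field.
by rewrite expRD; have := expR_half_le2; have := expR_gt0 (1 / 2 : R); nra.
Qed.

(** Apply the hypothesis at the integer n just above 2 ln x. Then x <= exp (n / 2) <= 2 x, which
    explains the use of eps / 2, and n <= 3 ln x, which explains the 3 in [few_traces]. *)
Lemma few_tracesP G : surface_group G -> finite_area G ->
  (fun n : nat => ((count_lengths G n)%:R : R) / (expR (n%:R / 2) * ln (ln (n%:R : R)))) @ \oo --> (0 : R) ->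
  few_traces G.
Proof.
move=> sG aG /cvgr0Pnorm_lt H eps eps0.
have e2 : 0 < eps / 2 by rewrite divr_gt0.
have [N _ HN] := H _ e2.
exists (expR (1 + N%:R + expR 2)) => x s xx us Hs.
have x0 : 0 < x by apply: lt_le_trans xx; exact: expR_gt0.
have lx : 1 + N%:R + expR 2 <= ln x by rewrite -[leLHS]expRK ler_ln ?posrE ?expR_gt0.
have E2 := expR_gt0 (2 : R); have N0 : 0 <= N%:R :> R by exact: ler0n.
pose n := (Num.trunc (2 * ln x)).+1.
have n1 : 2 * ln x <= n%:R by rewrite ltW// /n truncnS_gt.
have n2 : n%:R <= 2 * ln x + 1.
  by rewrite /n -natr1 lerD2r Num.Theory.truncn_le//; lra.
have Nn : (N <= n)%N by rewrite -(ler_nat R); lra.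
have := HN n Nn; rewrite /=.
have ln2 : 2 <= ln n%:R :> R by rewrite -[leLHS]expRK ler_ln ?posrE ?expR_gt0//; lra.
have lln : 0 < ln (ln n%:R) :> R by apply: ln_gt0; lra.
have D0 : 0 < expR (n%:R / 2) * ln (ln n%:R) :> R by rewrite mulr_gt0 ?expR_gt0.
rewrite ger0_norm ?divr_ge0 ?ler0n ?(ltW D0)// ltr_pdivrMr// => hc.
have xn : x <= expR (n%:R / 2) by rewrite -ler_ln ?posrE ?expR_gt0// expRK; lra.
have nx : expR (n%:R / 2) <= 2 * x.
  have -> : 2 * x = 2 * expR (ln x) by rewrite lnK.
  apply: (@le_trans _ _ (expR (1/2 + ln x))); first by rewrite ler_expR; lra.
  by rewrite expRD ler_wpM2r ?expR_ge0// expR_half_le2.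
have sz : (size s <= count_lengths G n)%N.
  by apply: count_traces => // t /Hs[t2 tx tA]; split => //; exact: le_trans xn.
rewrite -(ler_nat R) in sz; apply: le_trans sz _; apply: le_trans (ltW hc) _.
have -> : eps * x * ln (ln (3 * ln x)) = eps / 2 * (2 * x * ln (ln (3 * ln x))) by field.
rewrite ler_wpM2l ?(ltW e2)// ler_pM ?expR_ge0 ?(ltW lln)//.
rewrite ler_ln ?posrE; [|lra|]; last by apply: ln_gt0; lra.
by rewrite ler_ln ?posrE; lra.
Qed.

End conjugation.

(** * Normalizing a cusp at infinity *)

Section cusp.
Context (R : realType).
Local Notation M := 'M[R]_2.
Implicit Types (G : set M) (A B E h : M).

(** The sign of the translation is a conjugacy invariant in SL(2,R), hence the alternative. The
    first column of h is an eigenvector, scaled so that the translation becomes 1 or -1. *)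
Lemma parabolic_conj A : \det A = 1 -> \tr A = 2 -> A <> 1 ->
  exists h, \det h = 1 /\ (A = h * umx 1 * h^-1 \/ A^-1 = h * umx 1 * h^-1).
Proof.
move=> dA tA A1.
suff [h [e [dh e1 hE]]] : exists h (e : R), [/\ \det h = 1, e = 1 \/ e = -1 & A * h = h * umx e].
  exists h; split => //; have uh := det1_unit dh; have uA := det1_unit dA.
  have AE : A = h * umx e * h^-1 by rewrite -hE mulrK.
  case: e1 AE => -> AE; [left => //|right].
  by rewrite AE !invrM ?unitrMl ?unitrV ?det1_unit ?det_umx// invrK umxV opprK mulrA.
move: dA tA; rewrite det2E tr2E; set a := A i0 i0; set b := A i0 i1; set c := A i1 i0; set d := A i1 i1.
move=> dA tA; have dE : d = 2 - a by lra.
have AE : A = mx2 a b c d by exact: mx2_eta.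
have sg (x : R) : x != 0 -> exists e l : R, [/\ e = 1 \/ e = -1, e * l ^+ 2 * x = 1 & e * e = 1].
  move=> x0; exists (Num.sg x), (Num.sqrt `|x|)^-1; split.
  - by case: sgrP x0 => // _ _; [left|right].
  - rewrite exprVn sqr_sqrtr ?normr_ge0// mulrAC -normrEsg divff// normr_eq0//.
  - by rewrite -expr2 sqr_sg x0.
have [c0|c0] := eqVneq c 0.
  have a1 : a = 1.
    have : (a - 1) ^+ 2 = 0 by rewrite c0 dE in dA; rewrite expr2; lra.
    by move/eqP; rewrite sqrf_eq0 subr_eq0 => /eqP.
  have b0 : b != 0.
    apply/eqP => b0; apply: A1; rewrite AE one2E dE a1 b0 c0; congr mx2; lra.
  have [e [l [e1 el ee]]] := sg b b0.
  exists (mx2 (e * l * b) 0 0 l), e; split => //.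
    by rewrite det2E !mx2E -el; ring.
  rewrite AE /umx !mulmx2 c0 dE a1; congr mx2; try ring.
  by transitivity (e * e * (l * b)); [rewrite ee; ring|ring].
have c0' : - c != 0 by rewrite oppr_eq0.
have [e [l [e1 el ee]]] := sg (- c) c0'.
have bc : b * c = - (a - 1) ^+ 2 by rewrite dE in dA; rewrite expr2; lra.
exists (mx2 (e * l * (a - 1)) l (e * l * c) 0), e; split => //.
  by rewrite det2E !mx2E -el; ring.
rewrite AE /umx !mulmx2 dE; congr mx2.
- by transitivity (e * l * (a * (a - 1) + b * c)); [ring|rewrite bc; ring].
- by transitivity (e * e * (l * (a - 1)) + l); [rewrite ee; ring|ring].
- by ring.
- by transitivity (e * e * (l * c)); [rewrite ee; ring|ring].
Qed.

Lemma umx_exp (b : R) n : umx b ^+ n = umx (n%:R * b).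
Proof.
elim: n => [|n IH]; first by rewrite expr0 mul0r umx0.
by rewrite exprS IH umxD -natr1; congr umx; ring.
Qed.

Lemma group_umx_int G (z : int) : SL2_subgroup G -> G (umx 1) -> G (umx z%:~R).
Proof.
move=> sG GT; have [_ _ _ _ GV] := sG; case: z => n.
  by have := group_exp n sG GT; rewrite umx_exp mulr1.
by have := GV _ (group_exp n.+1 sG GT); rewrite umx_exp umxV mulr1 NegzE rmorphN.
Qed.

(* Conjugating T by powers of a contracting upper triangular element would
   give unipotents accumulating at 1. *)
Lemma triangular_unipotent G A : SL2_subgroup G -> discrete_mx G -> G (umx 1) -> G A ->
  A i1 i0 = 0 -> A i0 i0 = 1 \/ A i0 i0 = -1.
Proof.
move=> sG dG GT GA cA; have [G1 GN1 Gd GM GV] := sG.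
have key B : G B -> B i1 i0 = 0 -> 1 <= `|B i0 i0|.
  move=> GB cB; rewrite leNgt; apply/negP => aB.
  have dB := Gd _ GB; have uB := det1_unit dB.
  set a := B i0 i0 in aB.
  have conj (b : R) : B * umx b * B^-1 = umx (a ^+ 2 * b).
    rewrite (inv2E dB) {1}(mx2_eta B) /umx !mulmx2 cB -/a; move: dB; rewrite det2E cB -/a mulr0 subr0 => dB.
    by congr mx2; [rewrite -[RHS]dB; ring|ring|ring|rewrite -[RHS]dB; ring].
  have pw n : B ^+ n * umx 1 * (B ^+ n)^-1 = umx ((a ^+ 2) ^+ n).
    elim: n => [|n IH]; first by rewrite !expr0 mul1r invr1 mulr1.
    by rewrite conj_expE// IH conj -exprS.
  have [e [e0 He]] := dG 1 G1.
  have a2 : `|a ^+ 2| < 1 by rewrite normrX expr_lt1.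
  have /cvgrPdist_lt /(_ e e0)[n _ Hn] := cvg_geometric 1 a2.
  have a0 : a != 0.
    by apply: contraPneq dB; rewrite det2E cB -/a => ->; rewrite mul0r mulr0 subr0 => /eqP; rewrite eq_sym oner_eq0.
  have : umx ((a ^+ 2) ^+ n) = 1.
    apply: He.
      by rewrite -pw; apply: (GM); [apply: (GM) => //|apply: GV]; exact: group_exp.
    have := Hn n (leqnn n); rewrite /= /geometric/= mul1r sub0r normrN => hn i j.
    rewrite one2E; case: (I2_cases i) => ->; case: (I2_cases j) => ->; rewrite /umx !mx2E ?subrr ?normr0// sub0r normrN//.
  move/(congr1 (fun X : M => X i0 i1)); rewrite one2E /umx !mx2E => /eqP.
  by rewrite -exprM expf_eq0 (negbTE a0) andbF.
have dA := Gd _ GA.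
have h1 := key A GA cA; have h2 := key _ (GV _ GA).
rewrite (inv2E dA) !mx2E cA oppr0 in h2; have {}h2 := h2 erefl.
rewrite det2E cA mulr0 subr0 in dA.
have : `|A i0 i0| * `|A i1 i1| = 1 by rewrite -normrM dA normr1.
move=> h3; have : `|A i0 i0| = 1 by nra.
by move=> /eqP; rewrite eqr_norml ler01 andbT => /orP[] /eqP; [left|right].
Qed.

(** Otherwise G contains, up to sign, only translations, the non-trivial ones by at least e, and the
    quotient has infinite area towards the real axis, against [packing]. *)
Lemma exists_lower G : SL2_subgroup G -> discrete_mx G -> finite_area G -> G (umx 1) ->
  exists2 A, G A & A i1 i0 != 0.
Proof.
move=> sG dG aG GT; apply: contrapT => H; have [G1 GN1 Gd GM GV] := sG.
have tri A : G A -> A i1 i0 = 0.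
  by move=> GA; apply: contrapT => /eqP cA; apply: H; exists A.
have [e [e0 He]] := dG 1 G1.
have up A : G A -> (A i0 i1) ^+ 2 < e ^+ 2 -> A = 1 \/ A = -1.
  have key B : G B -> B i0 i0 = 1 -> (B i0 i1) ^+ 2 < e ^+ 2 -> B = 1.
    move=> GB aB bB; have cB := tri B GB; apply: He => // i j.
    have := Gd B GB; rewrite det2E aB cB mul1r mulr0 subr0 => dB.
    have {}bB : `|B i0 i1| < e by rewrite -(gtr0_norm e0) -ltr_sqr ?nnegrE// !real_normK ?num_real.
    rewrite one2E; case: (I2_cases i) => ->; case: (I2_cases j) => ->.
    - by rewrite !mx2E aB subrr normr0.
    - by rewrite !mx2E sub0r normrN.
    - by rewrite !mx2E cB subrr normr0.
    - by rewrite !mx2E dB subrr normr0.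
  move=> GA bA; have [aA|aA] := triangular_unipotent sG dG GT GA (tri A GA).
    by left; exact: key.
  by right; apply: (canRL (@opprK M)); apply: key; rewrite ?mxE ?aA ?opprK ?sqrrN//; exact: group_opp.
have e40 : 0 < 1 / 4 :> R by lra.
have [N HN] := packing sG dG aG e40.
(* At height at most e a translation by e or more moves a point far, and distinct heights differ by
   a factor at least 2, which makes [hgap] at least 1 / 2. *)
pose y (i : nat) : R := e * (1 / 2) ^+ i.
have y0 i : 0 < y i by rewrite /y mulr_gt0// exprn_gt0//; lra.
suff : (N.+1 <= N)%N by rewrite ltnn.
apply: (HN _ (fun i => (0, y i))) => [i _|i j A _ _ GA]; first exact: y0.
have cA := tri A GA; have aA := triangular_unipotent sG dG GT GA cA.
have dA := Gd A GA; rewrite det2E cA mulr0 subr0 in dA.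
have d2 : (A i1 i1) ^+ 2 = 1.
  by case: aA dA => ->; rewrite ?mul1r ?mulN1r => dA; [rewrite dA|rewrite -sqrrN dA]; rewrite expr1n.
have bd2 : (A i0 i1 * A i1 i1) ^+ 2 = (A i0 i1) ^+ 2 by rewrite exprMn d2 mulr1.
have -> : mobius A (0, y j) = (A i0 i1 * A i1 i1, y j).
  by rewrite /mobius cA /= !(mulr0, mul0r, add0r, addr0) expr0n/= addr0 d2 !divr1.
rewrite /hgap/= sub0r sqrrN bd2 ltr_pdivrMr ?mulr_gt0//.
have [<-|ij] := eqVneq i j => h.
  split => //; apply: (up A GA).
  have : (A i0 i1) ^+ 2 < (y i) ^+ 2.
    by move: h; rewrite subrr expr0n/= addr0 -expr2; have := exprn_gt0 2 (y0 i); lra.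
  move/lt_le_trans; apply; rewrite lerXn2r ?nnegrE ?(ltW (y0 i)) ?(ltW e0)//.
  by rewrite /y ler_piMr ?(ltW e0)// exprn_ile1//; lra.
exfalso; have {h} : (y i - y j) ^+ 2 < 1 / 4 * (y i * y j) by have := sqr_ge0 (A i0 i1); lra.
have far a b : (a < b)%N -> y b <= y a / 2.
  move=> ab; rewrite /y -mulrA ler_wpM2l ?(ltW e0)//.
  rewrite -(subnK ab) exprD.
  have -> : (1 / 2 : R) ^+ a.+1 = (1 / 2) ^+ a / 2 by rewrite exprS; field.
  by rewrite ler_piMl ?divr_ge0 ?exprn_ge0 ?exprn_ile1//; lra.
have yi := y0 i; have yj := y0 j; move: ij; rewrite neq_ltn => /orP[] /far; rewrite expr2; nra.
Qed.

End cusp.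

(** * Counting traces in unions of progressions *)

Section rational.
Context (R : realType).
Local Notation M := 'M[R]_2.
Implicit Types (G : set M) (A B E h : M).

Definition israt (x : R) := exists q : rat, x = ratr q.

Lemma isratD x y : israt x -> israt y -> israt (x + y).
Proof. by move=> [p ->] [q ->]; exists (p + q); rewrite rmorphD. Qed.

Lemma isratN x : israt x -> israt (- x).
Proof. by move=> [p ->]; exists (- p); rewrite rmorphN. Qed.

Lemma isratB x y : israt x -> israt y -> israt (x - y).
Proof. by move=> hx hy; apply: isratD => //; exact: isratN. Qed.

Lemma isratM x y : israt x -> israt y -> israt (x * y).
Proof. by move=> [p ->] [q ->]; exists (p * q); rewrite rmorphM. Qed.

Lemma isratV x : israt x -> israt x^-1.
Proof. by move=> [p ->]; exists p^-1; rewrite fmorphV. Qed.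

Lemma israt_int (z : int) : israt z%:~R.
Proof. by exists z%:~R; rewrite ratr_int. Qed.

Lemma israt_nat (n : nat) : israt n%:R.
Proof. exact: (israt_int n). Qed.

Lemma tr_umx E (y : R) : \tr (E * umx y : M) = \tr E + E i1 i0 * y.
Proof. by rewrite {1}(mx2_eta E) /umx mulmx2 !tr2E !mx2E; ring. Qed.

Lemma progression (s tau x : R) : 0 < s -> 2 <= x -> exists l : seq R,
  [/\ uniq l, (x - 2) / s - 1 <= (size l)%:R &
     forall t, t \in l -> 2 < t <= x /\ exists z : int, t = tau + z%:~R * s].
Proof.
move=> s0 x2; pose m0 := (Num.floor ((2 - tau) / s) + 1)%R.
have /andP[f1 f2] := floor_itv ((2 - tau) / s).
have m1 : 2 - tau < m0%:~R * s by rewrite -ltr_pdivrMr.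
have m2 : m0%:~R * s <= 2 - tau + s.
  by rewrite /m0 rmorphD/= mulrDl mul1r lerD2r -ler_pdivlMr.
have q0 : 0 <= (x - 2) / s by rewrite divr_ge0 ?(ltW s0)//; lra.
pose N := Num.trunc ((x - 2) / s).
have /andP[t1 t2] := truncn_itv q0; rewrite -/N in t1 t2.
exists [seq tau + (m0 + i%:Z)%:~R * s | i <- iota 0 N]; split.
- rewrite map_inj_uniq ?iota_uniq// => i j /addrI /(mulIf (lt0r_neq0 s0)) /eqP.
  by rewrite eqr_int => /eqP /addrI [].
- by rewrite size_map size_iota; rewrite -natr1 in t2; lra.
move=> t /mapP[i]; rewrite mem_iota/= add0n => iN ->; split; last by eexists.
have i0 : 0 <= i%:R * s by rewrite mulr_ge0 ?ler0n ?ltW.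
have iN' : (i%:R + 1) * s <= x - 2.
  apply: (@le_trans _ _ (N%:R * s)); first by rewrite ler_pM2r// natr1 ler_nat.
  by rewrite -ler_pdivlMr.
rewrite rmorphD/= mulrDl -[i%:~R]/(i%:R : R); apply/andP; split; lra.
Qed.

(** A new list shares at most one element with each earlier one, so it loses at most L elements. *)
Lemma union_size (P : nat -> seq R) L : (forall n, uniq (P n)) ->
  (forall n n' t t', (n < n')%N -> t \in P n -> t \in P n' -> t' \in P n -> t' \in P n' -> t = t') ->
  exists s, [/\ uniq s, (forall t, t \in s -> exists n, t \in P n) &
    (\sum_(n < L) size (P n) <= size s + L * L)%N].
Proof.
move=> uP cP.
suff [s [us Hs ss]] : exists s, [/\ uniq s, (forall t, t \in s -> exists2 n, (n < L)%N & t \in P n) &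
    (\sum_(n < L) size (P n) <= size s + L * L)%N].
  by exists s; split => // t /Hs[n _ tn]; exists n.
elim: L => [|L [s [us Hs ss]]]; first by exists [::]; rewrite big_ord0.
exists (s ++ [seq t <- P L | t \notin s]); split.
- rewrite cat_uniq us filter_uniq// andbT; apply/hasPn => t; rewrite mem_filter => /andP[] //.
- move=> t; rewrite mem_cat mem_filter => /orP[/Hs[n nL tn]|/andP[_ tL]]; last by exists L.
  by exists n => //; rewrite ltnS ltnW.
rewrite big_ord_recr/= size_cat.
have : (size [seq t <- P L | t \in s] <= L)%N.
  pose f t := find (fun n => t \in P n) (iota 0 L).
  have fP t : t \in s -> (f t < L)%N /\ t \in P (f t).
    move=> /Hs[n nL tn]; have hn : has (fun n => t \in P n) (iota 0 L).
      by apply/hasP; exists n => //; rewrite mem_iota.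
    have fL : (f t < L)%N by move: hn; rewrite has_find size_iota.
    by split => //; have := nth_find 0%N hn; rewrite -/(f t) nth_iota.
  rewrite -(size_map f) -[leqRHS](size_iota 0); apply: uniq_leq_size.
    rewrite map_inj_in_uniq ?filter_uniq// => t t'; rewrite !mem_filter => /andP[ts tL] /andP[ts' tL'] E.
    have [fL tf] := fP t ts; have [_ tf'] := fP t' ts'.
    by apply: (cP (f t) L) => //; rewrite E.
  move=> n /mapP[t]; rewrite mem_filter => /andP[ts _] ->; have [fL _] := fP t ts.
  by rewrite mem_iota.
have : size (P L) = (size [seq t <- P L | t \in s] + size [seq t <- P L | t \notin s])%N.
  by rewrite !size_filter count_predC.
move: ss; move: (\sum_(n < L) _)%N (size (P L)) (size [seq _ <- _ | _ \in _]) (size [seq _ <- _ | _ \notin _]) (size s).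
by move=> a b c d f; rewrite mulSn mulnS; lia.
Qed.

Lemma lnln_le (y : R) : 1 < y -> ln (ln y) <= y.
Proof.
move=> y1; have l0 : 0 < ln y by exact: ln_gt0.
by have := ln_sublinear l0; have := @ln_sublinear R y; lra.
Qed.

(** With eps = C / 12 the crude bound ln (ln y) <= y is enough: it allows at most (C / 2) K 4^K
    traces, about half of those supplied. *)
Lemma few_traces_log (C : R) (G : set M) : 0 < C -> few_traces G ->
  (forall K : nat, exists s : seq R, [/\ uniq s,
     (forall t, t \in s -> [/\ 2 < t, t <= (4 ^ K)%:R & exists2 A, G A & \tr A = t]) &
     (4 ^ K)%:R * (C * K%:R - 2) <= (size s)%:R]) -> False.
Proof.
move=> C0 fG H.
have e0 : 0 < C / 12 by lra.
have [x0 Hx] := fG _ e0.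
pose K := (Num.trunc (`|x0| + 4 / C + 1)).+1.
have KP : `|x0| + 4 / C + 1 < K%:R by rewrite /K truncnS_gt.
have C4 : 0 < 4 / C by rewrite divr_gt0.
have [s [us Hs ss]] := H K.
have x0' : x0 <= `|x0| by rewrite ler_norm.
have KK : K%:R <= (4 ^ K)%:R :> R by rewrite ler_nat ltnW// ltn_expl.
have x00 := normr_ge0 x0.
have := Hx _ s (_ : x0 <= (4 ^ K)%:R) us Hs; move=> /(_ ltac:(lra)).
have X0 : 0 < (4 ^ K)%:R :> R by rewrite ltr0n expn_gt0.
have lX : ln (4 ^ K)%:R = K%:R * ln 4 :> R by rewrite natrX lnXn// mulr_natl.
have l4a := ln4_ge1 R.
have l4b : ln 4 <= 2 :> R.
  rewrite -[leRHS]expRK ler_ln ?posrE ?expR_gt0//.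
  have -> : 2 = 1 + 1 :> R by [].
  by rewrite expRD; have := expR_ge1Dx (1 : R); nra.
have K1 : 1 < K%:R :> R by lra.
rewrite lX => h.
have y1 : 1 < 3 * (K%:R * ln 4 : R) by nra.
have y2 : 3 * (K%:R * ln 4) <= 6 * K%:R :> R by nra.
have := lnln_le y1 => h1.
have h2 : C / 12 * (4 ^ K)%:R * ln (ln (3 * (K%:R * ln 4))) <= C / 12 * (4 ^ K)%:R * (6 * K%:R).
  by rewrite ler_wpM2l ?mulr_ge0 ?(ltW e0) ?(ltW X0)//; lra.
have CK : 4 < C * K%:R.
  by rewrite mulrC -ltr_pdivrMr//; lra.
have : (4 ^ K)%:R * (C * K%:R - 2) <= C / 12 * (4 ^ K)%:R * (6 * K%:R) by lra.
have -> : C / 12 * (4 ^ K)%:R * (6 * K%:R) = (4 ^ K)%:R * (C * K%:R / 2) by field.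
rewrite ler_pM2l//; lra.
Qed.

End rational.

(** * Rationality of the offsets *)

Section offsets.
Context (R : realType).
Local Notation M := 'M[R]_2.
Implicit Types (G : set M) (A B E h : M).

Lemma rational_offset G A B : SL2_subgroup G -> G (umx 1) -> few_traces G -> G A -> G B ->
  A i1 i0 != 0 -> B i1 i0 != 0 -> israt (B i0 i0 / B i1 i0 + A i1 i1 / A i1 i0).
Proof.
move=> sG GT fG GA GB cA cB; have [_ _ Gd GM GV] := sG.
set beta := _ + _; apply: contrapT => nrat.
set k := A i1 i0 * B i1 i0; have k0 : k != 0 by rewrite mulf_neq0.
have k0' : 0 < `|k| by rewrite normr_gt0.
(* This shift makes every n + B0 + beta larger than 1, so the differences s n are positive and grow
   linearly in n. *)
pose B0 := (Num.trunc `|beta|).+2.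
have B0P : `|beta| + 1 < B0%:R by rewrite /B0 -natr1 ltrD2r truncnS_gt.
have b1 : - `|beta| <= beta by rewrite lerNl -normrN ler_norm.
have b2 : beta <= `|beta| by rewrite ler_norm.
pose s (n : nat) : R := `|k| * ((n + B0)%:R + beta).
have s0 n : 0 < s n by rewrite /s mulr_gt0// natrD; have := ler0n R n; lra.
have sn n : s n <= 2 * B0%:R * `|k| * n.+1%:R.
  rewrite /s -mulrA [_ * (`|k| * _)]mulrCA ler_pM2l// natrD -natr1.
  have := ler0n R n; have : 1 <= B0%:R :> R by rewrite ler1n.
  by nra.
pose E n := A * umx ((n + B0)%:Z%:~R) * B.
have GE n : G (E n) by apply: (GM) => //; apply: (GM) => //; exact: group_umx_int.
have cE n : E n i1 i0 = k * ((n + B0)%:R + beta).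
  rewrite /E {1}(mx2_eta A) {1}(mx2_eta B) /umx !mulmx2 mx2E /k /beta.
  rewrite -[(n + B0)%:Z%:~R]/((n + B0)%:R : R).
  by field; rewrite cA cB.
have GET n (z : int) : exists2 X, G X & \tr X = \tr (E n) + z%:~R * s n.
  have [k1|k1] := ltP 0 k.
    exists (E n * umx z%:~R); first by apply: (GM) => //; exact: group_umx_int.
    by rewrite tr_umx cE /s gtr0_norm//; ring.
  exists (E n * umx (- z)%:~R); first by apply: (GM) => //; exact: group_umx_int.
  by rewrite tr_umx cE /s ler0_norm// rmorphN; ring.
pose C := (16 * B0%:R * `|k|)^-1.
have B00 : 0 < B0%:R :> R by rewrite ltr0n.
have C0 : 0 < C by rewrite /C invr_gt0 !mulr_gt0.
apply: (few_traces_log C0 fG) => K.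
have [->|K0] := posnP K.
  exists [::]; split => //; rewrite /= expn0 mul1r mulr0; lra.
set x : R := (4 ^ K)%:R.
have x4 : 4 <= x by rewrite /x ler_nat -[leqLHS]expn1 leq_pexp2l.
have x2 : 2 <= x by lra.
have /choice[P PP] : forall n : nat, exists l : seq R, [/\ uniq l, (x - 2) / s n - 1 <= (size l)%:R &
     forall t, t \in l -> 2 < t <= x /\ exists z : int, t = \tr (E n) + z%:~R * s n].
  by move=> n; exact: progression.
(* With 2^K progressions and x = (2^K)^2 the overlaps cost at most x, while the harmonic sum of the
   1 / s n yields a multiple of K x. *)
have [||l [ul Hl sl]] := @union_size R P (2 ^ K).
- by move=> n; have [] := PP n.
- move=> n n' t t' nn'; have [_ _ Hn] := PP n; have [_ _ Hn'] := PP n'.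
  move=> /Hn[_ [z1 e1]] /Hn'[_ [w1 f1]] /Hn[_ [z2 e2]] /Hn'[_ [w2 f2]].
  apply: contrapT => tt'.
  have d1 : t - t' = (z1 - z2)%:~R * s n by rewrite e1 e2 rmorphB/=; ring.
  have d2 : t - t' = (w1 - w2)%:~R * s n' by rewrite f1 f2 rmorphB/=; ring.
  have td : t - t' != 0 by rewrite subr_eq0; apply/eqP.
  have /eqP := etrans (esym d1) d2; rewrite /s !(mulrCA _ `|k|) => /eqP.
  move=> /(mulfI (lt0r_neq0 k0')) h.
  have z0 : (z1 - z2)%:~R != 0 :> R by move: td; rewrite d1 mulf_eq0 negb_or => /andP[].
  have [zw|zw] := eqVneq (z1 - z2) (w1 - w2).
    move: h; rewrite -zw => /(mulfI z0) /addIr /eqP.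
    by rewrite eqr_nat eqn_add2r => /eqP E'; move: nn'; rewrite E' ltnn.
  have zw0 : (z1 - z2)%:~R - (w1 - w2)%:~R != 0 :> R by rewrite subr_eq0 eqr_int.
  (* Two common terms give (z1 - z2)(n + B0 + beta) = (w1 - w2)(n' + B0 + beta), an equation with
     integer coefficients that determines beta. *)
  apply: nrat; have -> : beta = ((w1 - w2)%:~R * (n' + B0)%:R - (z1 - z2)%:~R * (n + B0)%:R) /
      ((z1 - z2)%:~R - (w1 - w2)%:~R).
    apply: (mulIf zw0); rewrite mulfVK//.
    by move: h; set a := (z1 - z2)%:~R; set b := (w1 - w2)%:~R; lra.
  apply: isratM; [|apply: isratV]; apply: isratB; try apply: isratM; by [exact: israt_int|exact: israt_nat].
exists l; split => //.
  move=> t /Hl[n]; have [_ _ Hn] := PP n; move=> /Hn[/andP[t2 tx] [z tz]].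
  by split => //; have [X GX tX] := GET n z; exists X => //; rewrite tX.
have xE : x = (2 ^ K * 2 ^ K)%:R by rewrite /x -expnMn.
have : (\sum_(n < 2 ^ K) size (P n))%:R <= (size l + 2 ^ K * 2 ^ K)%:R :> R by rewrite ler_nat.
rewrite natrD -xE.
have : x * (2 * C * K%:R) - (2 ^ K)%:R <= (\sum_(n < 2 ^ K) size (P n))%:R.
  rewrite natr_sum; apply: (@le_trans _ _ (\sum_(n < 2 ^ K) ((x - 2) / s n - 1))); last first.
    by apply: ler_sum => n _; have [] := PP n.
  rewrite sumrB sumr_const card_ord lerD2r.
  apply: (@le_trans _ _ (\sum_(n < 2 ^ K) (x * 4 * C) * n.+1%:R^-1)).
    rewrite -mulr_sumr; have -> : x * (2 * C * K%:R) = x * 4 * C * (K%:R / 2) by field.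
    by rewrite ler_wpM2l ?harmonic_ge// !mulr_ge0 ?(ltW C0)//; lra.
  apply: ler_sum => n _.
  apply: (@le_trans _ _ ((x - 2) / (2 * B0%:R * `|k| * n.+1%:R))).
    have n0 : 0 < n.+1%:R :> R by rewrite ltr0n.
    have -> : x * 4 * C * n.+1%:R^-1 = (x / 2) / (2 * B0%:R * `|k| * n.+1%:R).
      by rewrite /C; field; rewrite !gt_eqF.
    by rewrite ler_wpM2r ?invr_ge0 ?mulr_ge0 ?ler0n ?normr_ge0//; lra.
  rewrite ler_wpM2l ?subr_ge0// lef_pV2 ?posrE ?sn//.
  by rewrite !mulr_gt0.
have : (2 ^ K)%:R <= x by rewrite xE ler_nat leq_pmulr// expn_gt0.
move=> h1 h2 h3.
have h4 : 0 <= x * (C * K%:R) by rewrite !mulr_ge0 ?ler0n ?(ltW C0)//; lra.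
by lra.
Qed.

Definition rational_cusp G := forall A, G A -> A i1 i0 != 0 ->
  [/\ israt (A i0 i0 / A i1 i0), israt (A i1 i1 / A i1 i0) & israt ((A i1 i0) ^+ 2)].

(** Comparison with A0, whose upper left entry vanishes, separates the two summands of the
    offset. *)
Lemma rational_cuspP G A0 : SL2_subgroup G -> G (umx 1) -> few_traces G -> G A0 ->
  A0 i1 i0 != 0 -> A0 i0 i0 = 0 -> rational_cusp G.
Proof.
move=> sG GT fG GA0 c0 a0 A GA cA; have [_ _ Gd GM GV] := sG.
have rd B : G B -> B i1 i0 != 0 -> israt (B i1 i1 / B i1 i0).
  by move=> GB cB; have := rational_offset sG GT fG GB GA0 cB c0; rewrite a0 mul0r add0r.
have ra B : G B -> B i1 i0 != 0 -> israt (B i0 i0 / B i1 i0).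
  move=> GB cB; have := isratB (rational_offset sG GT fG GA0 GB c0 cB) (rd _ GA0 c0).
  by rewrite addrK.
split; [exact: ra|exact: rd|].
(* For n = 0 or n = 1 the element A T^n A has a non-zero lower left entry. *)
have [n hn] : exists n : nat, A i0 i0 / A i1 i0 + A i1 i1 / A i1 i0 + n%:R != 0 :> R.
  have [h|h] := eqVneq (A i0 i0 / A i1 i0 + A i1 i1 / A i1 i0) 0; last by exists 0%N; rewrite addr0.
  by exists 1%N; rewrite h add0r oner_eq0.
pose B := A * umx n%:Z%:~R * A.
have GB : G B by apply: (GM) => //; apply: (GM) => //; exact: group_umx_int.
set th := _ + n%:R in hn.
have cB : B i1 i0 = (A i1 i0) ^+ 2 * th.
  rewrite /B {1 2}(mx2_eta A) /umx !mulmx2 mx2E /th -[n%:Z%:~R]/(n%:R : R); by field.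
have aB : B i0 i0 = A i0 i0 / A i1 i0 * B i1 i0 - 1.
  have := Gd A GA; rewrite cB /B {2 3}(mx2_eta A) /umx !mulmx2 mx2E /th -[n%:Z%:~R]/(n%:R : R) det2E => dA.
  have bE : A i0 i1 = (A i0 i0 * A i1 i1 - 1) / A i1 i0 by rewrite -dA; field.
  by rewrite bE; field.
have cB0 : B i1 i0 != 0 by rewrite cB mulf_neq0// expf_neq0.
(* The rational ratios a / c of A and of A T^n A differ by 1 / (c^2 th), so c^2 is rational too. *)
have -> : (A i1 i0) ^+ 2 = (th * (A i0 i0 / A i1 i0 - B i0 i0 / B i1 i0))^-1.
  rewrite aB mulrBl mulfK// opprB addrCA subrr addr0 cB.
  by field; rewrite hn.
apply: isratV; apply: isratM; first by apply: isratD; [apply: isratD; [exact: ra|exact: rd]|exact: israt_nat].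
by apply: isratB; exact: ra.
Qed.

End offsets.

(** * Denominators bounded by the number of traces *)

Section denominators.
Context (R : realType).
Local Notation M := 'M[R]_2.
Implicit Types (G : set M) (A B E h : M).

Lemma four_times_remaining (i t t' r w : nat) : (i <= 2 * t -> 8 * w <= i -> 0 < w -> t = t' + r -> r <= w.+1 -> i <= 4 * t')%N.
Proof. lia. Qed.

Lemma ln2_le1 : ln 2 <= 1 :> R.
Proof.
rewrite -[leRHS]expRK ler_ln ?posrE ?expR_gt0//.
by apply: le_trans (expR_ge1Dx _); lra.
Qed.

Lemma poly_bound (v y k z : R) : 1 <= v -> v <= y -> 4 * y ^+ 2 <= k -> k <= z ->
  (v * z + 1) ^+ 2 + 8 * y ^+ 4 <= z ^+ 6.
Proof.
move=> v1 vy yk kz.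
have y1 : 1 <= y by lra.
have k4 : 4 <= k by apply: le_trans yk; rewrite expr2; nra.
have yz : y <= z by apply: (le_trans _ kz); apply: (le_trans _ yk); rewrite expr2; nra.
have w1 : 16 <= z ^+ 2 by rewrite expr2; nra.
have e1 : 8 * y ^+ 4 <= z ^+ 2.
  have e : 16 * y ^+ 4 <= z ^+ 2.
    have -> : 16 * y ^+ 4 = (4 * y ^+ 2) ^+ 2 by ring.
    by rewrite lerXn2r ?nnegrE ?mulr_ge0 ?sqr_ge0//; lra.
  have : 0 <= y ^+ 4 by rewrite exprn_ge0//; lra.
  by lra.
have e3 : (v * z + 1) ^+ 2 <= (z * z + 1) ^+ 2.
  have vz : v * z <= z * z by rewrite ler_wpM2r//; lra.
  have vz0 : 0 <= v * z by rewrite mulr_ge0//; lra.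
  by rewrite lerXn2r ?nnegrE//; lra.
have -> : z ^+ 6 = z ^+ 2 * z ^+ 2 * z ^+ 2 by ring.
have e4 : (z * z + 1) ^+ 2 = z ^+ 2 * z ^+ 2 + 2 * z ^+ 2 + 1 by ring.
move: e3 e1 w1; rewrite e4; move: (z ^+ 2) (_ ^+ 2) (8 * _) => w a b h1 h2 h3.
have : 16 * w <= w * w by rewrite ler_wpM2r//; lra.
have : 16 * (w * w) <= w * (w * w) by rewrite ler_wpM2r// mulr_ge0//; lra.
lra.
Qed.

Lemma exp_bound (q k l : R) : 64 <= q -> k <= q / 16 * expR q + 1 -> l <= 7 * k ->
  3 * l <= expR (3 * q).
Proof.
move=> q64 kq lk; have E1 := expR_ge1Dx q; have -> : expR (3 * q) = expR q * (expR q * expR q).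
  by rewrite -!expRD; congr expR; ring.
have F1 : 2 * q + 21 <= expR q * expR q.
  apply: (@le_trans _ _ ((1 + q) * (1 + q))); first by nra.
  by apply: ler_pM => //; lra.
have F2 : 3 * l <= (2 * q + 21) * expR q.
  have E0 : 1 <= expR q by lra.
  apply: (@le_trans _ _ (21 * (q / 16 * expR q + 1))); first by lra.
  by move: (expR q) E0 => w w1; nra.
by apply: le_trans F2 _; rewrite mulrC ler_wpM2l ?expR_ge0.
Qed.

(* The products XY with X = Y = u mod v have positive density for every v,
   whereas the corresponding traces are few. *)
Lemma denominator_bound G (x0 kappa sigma : R) (u : int) (v Y : nat) :
  (forall x (s : seq R), x0 <= x -> uniq s ->
    (forall t, t \in s -> [/\ 2 < t, t <= x & exists2 A, G A & \tr A = t]) ->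
    (size s)%:R <= x * ln (ln (3 * ln x))) ->
  (0 < v)%N -> coprime `|u|%N v ->
  (forall n m : int, exists2 A, G A &
     \tr A = kappa * ((u + n * v%:Z)%:~R * (u + m * v%:Z)%:~R) / v%:R ^+ 2 - sigma) ->
  0 < kappa -> 0 <= sigma -> (v <= Y)%N -> kappa <= Y%:R -> kappa^-1 <= Y%:R -> sigma + 2 <= Y%:R ->
  x0 <= Y%:R ->
  v%:R <= 4 * kappa * ln (3 * (4 * (Y%:R * (16 * Y%:R)))).
Proof.
move=> few v0 uv tG k0 sg0 vY kY kY' sgY x0Y.
have Y0 : (0 < Y)%N by exact: leq_trans vY.
set y : R := Y%:R in kY kY' sgY x0Y *.
have y1 : 1 <= y by rewrite ler1n.
have y00 : 0 <= y by lra.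
have v0' : 0 < v%:R :> R by rewrite ltr0n.
have vy : v%:R <= y by rewrite ler_nat.
(* The exponent 4 v (16 v) required by [product_count], with v replaced by its bound Y, so that K
   depends on Y alone. *)
pose q : R := 4 * (y * (16 * y)); rewrite -/q.
have q64 : 64 * y <= q by rewrite /q; nra.
pose K := (Num.trunc (4 * y ^+ 2 * expR q)).+1.
have Kgt : 4 * y ^+ 2 * expR q < K%:R by rewrite /K truncnS_gt.
have Kle : K%:R <= 4 * y ^+ 2 * expR q + 1.
  by rewrite /K -natr1 lerD2r truncn_le// !mulr_ge0 ?expR_ge0// exprn_ge0//; lra.
have K4 : 4 * y ^+ 2 <= K%:R.
  apply: le_trans (ltW Kgt); rewrite ler_peMr//; first by rewrite mulr_ge0// sqr_ge0.
  by apply: le_trans (expR_ge1Dx _); lra.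
pose u' : nat := `|(u %% v%:Z)%Z|%N.
have u'E : (u'%:Z = u %% v%:Z)%Z by rewrite /u' gez0_abs// modz_ge0// eqz_nat -lt0n.
have cu : coprime u' v.
  have : coprimez (u %% v%:Z)%Z v by rewrite /coprimez gcdz_modl; exact: uv.
  by rewrite -u'E.
(* The W up to Y^4 are discarded so that the remaining traces exceed 2; adding J to the range keeps
   at least I / 4 values. *)
pose J := (8 * Y ^ 4)%N.
pose I := ((v * 2 ^ K).+1 ^ 2 + J)%N.
have hK : 4 * v%:R ^+ 2 * expR (4 * (v%:R * (16 * v%:R))) < K%:R :> R.
  apply: le_lt_trans Kgt; apply: ler_pM; rewrite ?expR_ge0 ?mulr_ge0 ?sqr_ge0//.
    by rewrite ler_wpM2l// lerXn2r ?nnegrE//; lra.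
  by rewrite ler_expR /q ler_wpM2l// ler_pM ?mulr_ge0//; lra.
have [s [us sI Hs]] := product_count v0 cu hK (leq_addr J _ : (_ <= I)%N).
pose f (W : nat) : R := kappa * W%:R / v%:R ^+ 2 - sigma.
have fi : injective f.
  move=> W W' /addIr; rewrite -!mulrA => /(mulfI (lt0r_neq0 k0)) /(mulIf _) h; apply/eqP.
  rewrite -(eqr_nat R); apply/eqP/h; rewrite invr_eq0 expf_neq0// lt0r_neq0//.
pose s' := [seq W <- s | (Y ^ 4 < W)%N].
have ss' : (I <= 4 * size s')%N.
  have : (size [seq W <- s | ~~ (Y ^ 4 < W)%N] <= (Y ^ 4).+1)%N.
    rewrite -[leqRHS](size_iota 0); apply: uniq_leq_size; first by rewrite filter_uniq.
    by move=> W; rewrite mem_filter mem_iota add0n -leqNgt ltnS => /andP[].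
  have : (size s = size s' + size [seq W <- s | ~~ (Y ^ 4 < W)%N])%N.
    by rewrite /s' !size_filter count_predC.
  have : (0 < Y ^ 4)%N by rewrite expn_gt0 Y0.
  have : (8 * Y ^ 4 <= I)%N by rewrite /I leq_addl.
  move=> h1 h2 h3 h4; apply: (four_times_remaining sI h1 h2 h3 h4).
(* Every W is below v I, so the traces kappa W / v^2 - sigma are at most x. *)
pose x := kappa * I%:R / v%:R.
have I0 : 0 < I%:R :> R.
  by rewrite ltr0n /I addn_gt0 expn_gt0.
have x8 : 8 * y <= x.
  have JI : 8 * y ^+ 4 <= I%:R by rewrite /y -natrX -natrM ler_nat /I leq_addl.
  rewrite /x ler_pdivlMr//.
  have h1 : 8 * y * v%:R <= 8 * y * y by rewrite ler_wpM2l//; lra.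
  have h2 : 8 * y * y * kappa^-1 <= 8 * y ^+ 4.
    have : 8 * y * y * kappa^-1 <= 8 * y * y * y by rewrite ler_wpM2l// !mulr_ge0//; lra.
    move/le_trans; apply; have -> : y ^+ 4 = y * y * (y * y) by ring.
    have -> : 8 * y * y * y = 8 * (y * y * y) by ring.
    rewrite ler_wpM2l// ler_wpM2l ?mulr_ge0//; by rewrite ler_peMr.
  rewrite -ler_pdivrMl// mulrC; apply: le_trans (le_trans h2 JI).
  by rewrite ler_wpM2r ?invr_ge0 ?(ltW k0).
have := few x (map f s') _ _ _; rewrite size_map.
move=> /(_ ltac:(lra)) /(_ ltac:(by rewrite map_inj_uniq ?filter_uniq)).
move=> /(_ _)/wrap[].
  move=> t /mapP[W]; rewrite mem_filter => /andP[WY /Hs[WI [X [Z [WE Xu Zu]]]]] ->.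
  split.
  - rewrite /f ltrBrDr ltr_pdivlMr ?exprn_gt0// -ltr_pdivrMl// mulrC.
    apply: (@le_lt_trans _ _ (y ^+ 4)); last by rewrite /y -natrX ltr_nat.
    have -> : y ^+ 4 = y * (y * y) * y by ring.
    rewrite ler_pM// ?invr_ge0 ?(ltW k0)//; first by rewrite mulr_ge0 ?sqr_ge0//; lra.
    rewrite ler_pM// ?sqr_ge0//; [lra|lra|].
    by rewrite expr2 ler_pM//; lra.
  - rewrite /f /x; have : kappa * W%:R / v%:R ^+ 2 <= kappa * I%:R / v%:R; last by lra.
    have -> : kappa * I%:R / v%:R = kappa * (v * I)%N%:R / v%:R ^+ 2 by rewrite natrM; field; rewrite gt_eqF.
    by rewrite ler_wpM2r ?invr_ge0 ?sqr_ge0// ler_wpM2l ?(ltW k0)// ler_nat ltnW.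
  have lift (Z' : nat) : (Z' = u' %[mod v])%N -> exists n : int, Z'%:Z = (u + n * v%:Z)%R.
    move=> E'; exists ((Z' %/ v)%N%:Z - (u %/ v%:Z)%Z)%R.
    have h : (Z' %% v)%N%:Z = u'%:Z.
      by congr Posz; rewrite E' modn_small// -ltz_nat u'E ltz_pmod// ltz_nat.
    rewrite {1}(divn_eq Z' v) PoszD PoszM h u'E {2}(divz_eq u v); ring.
  have [n Xn] := lift X Xu; have [m Zm] := lift Z Zu.
  have [A GA tA] := tG n m; exists A => //.
  by rewrite tA /f -Xn -Zm WE natrM.
move=> h.
have x0' : 0 < x by lra.
have l4 := ln4_ge1 R.
have lx1 : 1 <= ln x by apply: le_trans l4 _; rewrite ler_ln ?posrE//; lra.
(* With z = 2^K one has x <= z^7, so ln x <= 7 K, and K is about (q / 16) exp q. Two further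
   logarithms leave ln (3 q), which is logarithmic in Y. *)
have lx : 3 * ln x <= expR (3 * q).
  pose z : R := (2 ^ K)%:R.
  have z2 : 2 <= z.
    by rewrite /z ler_nat -[leqLHS]expn1 leq_exp2l.
  have Iz : I%:R <= z ^+ 6.
    rewrite /I natrD natrX /J natrM natrX -/y -natr1 natrM -/z.
    apply: (@poly_bound _ _ K%:R) => //; [by rewrite ler1n|by rewrite ler_nat ltnW// ltn_expl].
  have z0 : 0 < z by apply: lt_le_trans z2.
  have yz : y <= z.
    have : K%:R <= z by rewrite ler_nat ltnW// ltn_expl.
    apply: le_trans; apply: le_trans K4; rewrite expr2 mulrA; apply: ler_peMl => //; exact: (le_trans y1 (ler_peMl y00 (ler1n _ 4))).
  have xz : x <= z ^+ 7.
    rewrite /x ler_pdivrMr// exprS.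
    apply: (@le_trans _ _ (z * z ^+ 6)).
      by apply: ler_pM => //; [exact: ltW|exact: le_trans yz].
    by apply: ler_peMr; [rewrite mulr_ge0 ?exprn_ge0// ltW|rewrite ler1n].
  apply: (@exp_bound _ K%:R).
  - by apply: le_trans q64; apply: ler_peMr.
  - by have -> : q / 16 = 4 * y ^+ 2 by rewrite /q; field.
  apply: (@le_trans _ _ (ln (z ^+ 7))).
    by rewrite ler_ln ?posrE// exprn_gt0.
  have lz : ln z = K%:R * ln 2 by rewrite /z natrX lnXn// mulr_natl.
  rewrite lnXn// lz -[leLHS]mulr_natl ler_wpM2l//.
  by apply: ler_piMr; [exact: ler0n|exact: ln2_le1].
have llx : ln (3 * ln x) <= 3 * q by rewrite -[leRHS]expRK ler_ln ?posrE ?expR_gt0//; lra.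
have llx0 : 0 < ln (3 * ln x) by apply: ln_gt0; lra.
have lllx : ln (ln (3 * ln x)) <= ln (3 * q) by rewrite ler_ln ?posrE//; lra.
have h1 : I%:R <= 4 * (x * ln (3 * q)).
  apply: (@le_trans _ _ (4 * (size s')%:R)); first by rewrite -natrM ler_nat.
  rewrite ler_wpM2l//; apply: le_trans h _; rewrite ler_wpM2l// ltW//.
rewrite -(ler_pM2l I0); apply: (@le_trans _ _ (4 * (x * ln (3 * q)) * v%:R)); first by rewrite ler_wpM2r// ltW.
by rewrite le_eqVlt; apply/orP; left; apply/eqP; rewrite /x; field; rewrite gt_eqF.
Qed.

End denominators.

(** * Lucas sequences and powers of a matrix *)

Section lucas.

(** The Lucas sequence of X^2 - P X + Q. With P = tr E and Q = 1 it gives the coefficients of the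
    powers of E; for a trace P / Q the parameters P, Q^2 give its integral version. *)
Fixpoint lucas (T : pzRingType) (P Q : T) (n : nat) : T :=
  match n with
  | 0%N => 0
  | 1%N => 1
  | (m.+1 as n').+1 => P * lucas P Q n' - Q * lucas P Q m
  end.

Lemma lucasS (T : pzRingType) (P Q : T) n :
  lucas P Q n.+2 = P * lucas P Q n.+1 - Q * lucas P Q n.
Proof. by []. Qed.

Lemma lucas01 (T : pzRingType) (P Q : T) : (lucas P Q 0 = 0) * (lucas P Q 1 = 1).
Proof. by []. Qed.

Arguments lucas : simpl never.

(** Modulo Q the terms are powers of P, and a common divisor of two consecutive terms divides Q^2
    times the term before. Hence p_(n+2) / (Q p_(n+1)) is in lowest terms. *)
Lemma lucas_coprime (P Q : int) n : coprimez P Q ->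
  coprimez (lucas P (Q ^+ 2) n.+1) Q /\ coprimez (lucas P (Q ^+ 2) n.+1) (lucas P (Q ^+ 2) n).
Proof.
move=> PQ; elim: n => [|n [IH1 IH2]]; first by rewrite !lucas01 /coprimez !gcd1z.
rewrite lucasS; set a := lucas _ _ n.+1 in IH1 IH2 *; set b := lucas _ _ n in IH2 *; split.
  have -> : P * a - Q ^+ 2 * b = P * a + (- Q * b) * Q by ring.
  by rewrite coprimezE -coprimezE /coprimez addrC gcdzC gcdzMDl gcdzC -/(coprimez _ _) coprimezMl PQ.
have -> : P * a - Q ^+ 2 * b = - (Q * Q * b) + P * a by ring.
rewrite /coprimez addrC gcdzC gcdzMDl gcdzN -/(coprimez _ _) !coprimezMr IH1 IH2//.
Qed.

Context (R : realType).

Lemma lucas_scale (P Q : int) (tau : R) n : tau = P%:~R / Q%:~R -> Q != 0 ->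
  lucas tau 1 n.+1 * Q%:~R ^+ n = (lucas P (Q ^+ 2) n.+1)%:~R.
Proof.
move=> tE Q0; have q0 : Q%:~R != 0 :> R by rewrite intr_eq0.
suff [] : lucas tau 1 n.+1 * Q%:~R ^+ n = (lucas P (Q ^+ 2) n.+1)%:~R /\
  lucas tau 1 n * Q%:~R ^+ n = (lucas P (Q ^+ 2) n)%:~R * Q%:~R by [].
elim: n => [|n [IH1 IH2]]; first by split; rewrite !lucas01 ?mul0r ?expr0 ?mul1r.
split; last by rewrite exprSr mulrA IH1.
rewrite !lucasS rmorphB/= [(_ * lucas _ _ n.+1)%:~R]rmorphM [(_ * lucas _ _ n)%:~R]rmorphM rmorphXn/= -IH1.
have -> : Q%:~R ^+ 2 * (lucas P (Q ^+ 2) n)%:~R = lucas tau 1 n * Q%:~R ^+ n * Q%:~R :> R.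
  by rewrite IH2; ring.
rewrite exprSr; move: (lucas tau 1 n.+1) (lucas tau 1 n) (Q%:~R ^+ n) => a b z; rewrite tE; field; exact: q0.
Qed.

Lemma lucas_ge1 (tau : R) n : 2 <= tau -> 1 <= lucas tau 1 n.+1 - lucas tau 1 n /\ 0 <= lucas tau 1 n.
Proof.
move=> t2; elim: n => [|n [IH1 IH2]]; first by rewrite !lucas01 subr0.
rewrite lucasS; move: IH1 IH2; move: (lucas _ _ n.+1) (lucas _ _ n) => a b h1 h2; split; last by lra.
have : 2 * a <= tau * a by rewrite ler_wpM2r//; lra.
lra.
Qed.

Lemma lucas_le (tau : R) n : 2 <= tau -> lucas tau 1 n.+1 <= tau ^+ n.
Proof.
move=> t2; elim: n => [|n IH]; first by rewrite expr0 lucas01.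
rewrite lucasS exprS; have [_ h] := lucas_ge1 n t2.
have : tau * lucas tau 1 n.+1 <= tau * tau ^+ n by rewrite ler_wpM2l//; lra.
lra.
Qed.

Lemma exp2_dominates (C : R) : exists n : nat, C * n.+1%:R < 2 ^+ n.+1.
Proof.
pose m := (Num.trunc (2 * `|C| + 2)).+1.
have mP : 2 * `|C| + 2 < m%:R by rewrite /m truncnS_gt.
have m0 : (0 < m)%N by [].
exists (2 * m).-1; rewrite prednK ?muln_gt0//.
have C1 : C <= `|C| := ler_norm C; have C0 := normr_ge0 C.
have : m%:R <= 2 ^+ m :> R by rewrite -natrX ler_nat ltnW// ltn_expl.
rewrite mul2n -addnn exprD natrD; move: (2 ^+ m) (m%:R : R) mP => z y h1 h2.
have : C * (y + y) <= `|C| * (y + y) by rewrite ler_wpM2r//; lra.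
have : y * y <= z * z by rewrite ler_pM//; lra.
have : (2 * `|C| + 2) * y < y * y by rewrite ltr_pM2r//; lra.
lra.
Qed.

End lucas.

Arguments lucas : simpl never.

Section integrality.
Context (R : realType).
Local Notation M := 'M[R]_2.
Implicit Types (G : set M) (A B E h : M).

Lemma mx2_power E n : \det E = 1 ->
  E ^+ n.+1 = lucas (\tr E) 1 n.+1 *: E - lucas (\tr E) 1 n *: 1.
Proof.
move=> dE; elim: n => [|n IH]; first by rewrite !lucas01 expr1 scale1r scale0r subr0.
rewrite exprS IH lucasS mulrBr -!scalerAr mulr1 mx2_sqr// mul1r scalerBr scalerA scalerBl.
by rewrite [_ * \tr E]mulrC addrAC.
Qed.

Lemma tr_power_product E n (x y : R) : \det E = 1 -> E i1 i0 != 0 -> lucas (\tr E) 1 n.+1 != 0 ->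
  let U := lucas (\tr E) 1 n.+1 in
  let alpha := lucas (\tr E) 1 n.+2 / (U * E i1 i0) in
  \tr (E ^+ n.+1 * umx x * (E * umx y)) =
    (E i1 i0) ^+ 2 * U * ((x + alpha) * (y + alpha)) - (U + U^-1).
Proof.
move=> dE c0 U0; rewrite lucasS mx2_power//= mul1r.
move: U0; set U := lucas _ _ n.+1; set V := lucas _ _ n => U0.
have dP : \det (U *: E - V *: 1) = 1 by rewrite /U /V -mx2_power// det1X.
have FE : U *: E - V *: 1 = mx2 (U * E i0 i0 - V) (U * E i0 i1) (U * E i1 i0) (U * E i1 i1 - V).
  by apply: mx2P; rewrite !mxE/= ?mulr1n ?mulr0n ?mulr0 ?mulr1 ?subr0.
have EE : E * umx y = mx2 (E i0 i0) (E i0 i0 * y + E i0 i1) (E i1 i0) (E i1 i0 * y + E i1 i1).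
  by rewrite {1}(mx2_eta E) /umx mulmx2; congr mx2; ring.
move: dP dE; rewrite EE FE !det2E /umx !mulmx2 !tr2E !mx2E.
move: c0; move: (E i0 i0) (E i0 i1) (E i1 i0) (E i1 i1) => a b c d c0 dP dE.
have bE : b = (a * d - 1) / c by rewrite -dE; field.
(* The determinant of U E - V is 1, read as a relation between U and V; it turns the constant term
   into U + 1 / U. *)
have VE : V ^+ 2 = 1 - U ^+ 2 + (a + d) * U * V.
  by rewrite -dP -{1}[U ^+ 2]mulr1 -dE; ring.
transitivity (U * (c ^+ 2 * (x + a / c - V / (U * c) + d / c) * (y + (a + d) / c - V / (U * c))) - (U + (V ^+ 2 + U ^+ 2 - (a + d) * U * V) / U)); last first.
  by rewrite VE; field; rewrite c0 U0.
by rewrite bE; field; rewrite c0 U0.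
Qed.

End integrality.

(** * Integrality of the squared traces *)

Section integral_trace.
Context (R : realType).
Local Notation M := 'M[R]_2.
Implicit Types (G : set M) (A B E h : M).

Lemma ln_poly_bound (Y : R) : 4 <= Y -> ln (3 * (4 * (Y * (16 * Y)))) <= 6 * ln Y.
Proof.
move=> Y4; have Y0 : 0 < Y by lra.
have -> : 6 * ln Y = ln (Y ^+ 6) by rewrite lnXn// mulr_natl.
rewrite ler_ln ?posrE ?exprn_gt0 ?mulr_gt0//.
have w16 : 16 <= Y * Y by nra.
have -> : Y ^+ 6 = (Y * Y) * (Y * Y) * (Y * Y) by ring.
have -> : 3 * (4 * (Y * (16 * Y))) = 12 * 16 * (Y * Y) by ring.
rewrite ler_wpM2r ?mulr_ge0 ?(ltW Y0)//.
by apply: ler_pM => //; lra.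
Qed.

Lemma sum_bounds (a b c d e z : R) : 0 <= a -> 0 <= b -> 0 <= c -> 0 <= d -> 0 <= e ->
  a + b + c + d + e + 4 < z -> [/\ a <= z, b <= z, c <= z, d <= z & e <= z /\ 4 <= z].
Proof. by move=> *; split; [| | | |split]; lra. Qed.

Lemma sigma_bound (a b z : R) : a <= z -> b <= 1 -> 1 <= z -> a + b + 2 <= 4 * z.
Proof. by move=> *; lra. Qed.

Lemma dvdz_le_pos (a b : int) : 0 < b -> (a %| b)%Z -> a <= b.
Proof.
move=> b0; rewrite dvdzE => /dvdn_leq; rewrite absz_gt0 gt_eqF// => /(_ isT); lia.
Qed.

(* The reduced denominator v of p' h / (Q p l), when p' is coprime to Q p. *)
Lemma denominator_between (p p' Q h l u v : int) : coprimez p' (Q * p) -> coprimez u v ->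
  p' * h * v = Q * p * l * u -> (Q * p %| h * v)%Z /\ (v %| Q * p * l)%Z.
Proof.
move=> cp cu E; split.
  have : (Q * p %| p' * (h * v))%Z by rewrite mulrA E -mulrA dvdz_mulr.
  by rewrite Gauss_dvdzr// coprimez_sym.
have : (v %| Q * p * l * u)%Z by rewrite -E dvdz_mull.
by rewrite Gauss_dvdzl// coprimez_sym.
Qed.

Lemma integral_trace G A : surface_group G -> G (umx 1) -> few_traces G -> rational_cusp G ->
  G A -> A i1 i0 != 0 -> exists z : int, (\tr A) ^+ 2 = z%:~R.
Proof.
move=> sG GT fG rG GA cA; have [sG' dG tG] := sG; have [_ _ Gd GM GV] := sG'.
have dA := Gd A GA; have t4 := group_tr_ge sG GA.
have [ra rd rc] := rG A GA cA.
set t := \tr A in t4 *.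
have t0 : t != 0 by apply: contraTneq t4 => ->; rewrite expr0n/= -ltNge.
(* Only t^2 and the ratios of entries of A are known to be rational, whereas E = t A - 1 has
   rational trace t^2 - 2 and rational lower left entry. *)
pose E := A * A; have GE : G E by exact: GM.
have dE : \det E = 1 by exact: Gd.
have EE : E = t *: A - 1 by rewrite /E mx2_sqr.
have cE : E i1 i0 = (A i1 i0) ^+ 2 * (A i0 i0 / A i1 i0 + A i1 i1 / A i1 i0).
  by rewrite EE !mxE/= subr0 /t tr2E; field.
have cE0 : E i1 i0 != 0 by rewrite EE !mxE/= subr0 mulf_neq0.
have tE : \tr E = t ^+ 2 - 2 by rewrite EE tr2E !mxE/= /t tr2E; ring.
set tau := \tr E in tE; have tau2 : 2 <= tau by lra.
have [rt rtE] : israt tau.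
  rewrite tE; apply: isratB; last exact: israt_nat.
  have -> : t ^+ 2 = (A i1 i0) ^+ 2 * ((A i0 i0 / A i1 i0 + A i1 i1 / A i1 i0) * (A i0 i0 / A i1 i0 + A i1 i1 / A i1 i0)).
    by rewrite /t tr2E; field.
  by apply: isratM => //; apply: isratM; exact: isratD.
have [r0 r0E] : israt (E i1 i0) by rewrite cE; apply: isratM => //; exact: isratD.
pose P := numq rt; pose Q := denq rt; pose l := numq r0; pose h := denq r0.
have ratE (r : rat) : ratr r = (numq r)%:~R / (denq r)%:~R :> R by [].
have Q0 : 0 < Q by exact: denq_gt0.
have h0 : 0 < h by exact: denq_gt0.
have [Q1|Q1] := eqVneq Q 1.
  exists (P + 2); rewrite rmorphD/=; have := ratE rt; rewrite -rtE -/P -/Q Q1 divr1; lra.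
exfalso; have Q2 : (2 <= Q)%R by lia.
have l0 : l != 0 by rewrite numq_eq0; apply: contraNneq cE0 => r00; rewrite r0E r00 rmorph0.
have l1 : 1 <= `|l| by lia.
pose U n : R := lucas tau 1 n; pose p n : int := lucas P (Q ^+ 2) n.
have Up n : U n.+1 * Q%:~R ^+ n = (p n.+1)%:~R.
  by apply: lucas_scale; [rewrite rtE|rewrite gt_eqF].
have U1 n : 1 <= U n.+1 by rewrite /U; have [] := lucas_ge1 n tau2; lra.
have QR0 : 0 < Q%:~R :> R by rewrite ltr0z.
have p0 n : 0 < p n.+1 by rewrite -(ltr0z R) -Up mulr_gt0 ?exprn_gt0//; have := U1 n; lra.
have PQ : coprimez P Q by exact: coprime_num_den.
have cp n : coprimez (p n.+2) (Q * p n.+1).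
  by have [h1 h2] := lucas_coprime n.+1 PQ; rewrite coprimezMr h1 h2.
pose c0 := E i1 i0; have c02 : 0 < c0 ^+ 2 by rewrite exprn_even_gt0.
have [x0 Hx] := fG 1 ltr01.
pose al (n : nat) : R := U n.+2 / (U n.+1 * c0).
have hR0 : 0 < h%:~R :> R by rewrite ltr0z.
have lR0 : l%:~R != 0 :> R by rewrite intr_eq0.
have cE' : c0 = l%:~R / h%:~R by rewrite /c0 r0E ratE.
have alE n : al n = (p n.+2 * h)%:~R / (Q * p n.+1 * l)%:~R.
  have u0 : U n.+1 != 0 by apply: lt0r_neq0; apply: lt_le_trans (U1 n).
  rewrite !rmorphM/= -!Up /al cE' exprSr.
  have q0 : Q%:~R ^+ n != 0 :> R by rewrite expf_neq0// gt_eqF.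
  move: (gt_eqF QR0) (gt_eqF hR0) => /negbT a1 /negbT a2.
  by field; rewrite a1 a2 q0 u0 lR0.
(* The reduced denominator v of the offset equals Q p_(n+1) = Q^(n+1) U_(n+1) up to factors bounded
   by the fixed integers h and l. *)
have key n : exists v : nat, [/\ (0 < v)%N, (Q * p n.+1 %| h * v%:Z)%Z, (v%:Z %| Q * p n.+1 * l)%Z &
    exists2 u : int, coprime `|u|%N v & al n = u%:~R / v%:R].
  pose r : rat := (p n.+2 * h)%:~R / (Q * p n.+1 * l)%:~R.
  have rE : al n = ratr r by rewrite alE /r fmorph_div/= !ratr_int.
  have vE : (`|denq r|%N%:Z = denq r)%Z by rewrite absz_denq.
  have D0 : Q * p n.+1 * l != 0 by rewrite !mulf_neq0// gt_eqF.
  have eq : p n.+2 * h * denq r = Q * p n.+1 * l * numq r.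
    apply/eqP; rewrite -(eqr_int rat) !rmorphM/= (numqE r); apply/eqP.
    have rr : r = (p n.+2)%:~R * h%:~R / (Q%:~R * (p n.+1)%:~R * l%:~R) by rewrite /r !rmorphM.
    move: (denq r)%:~R => d; rewrite rr.
    have Q0' : Q%:~R != 0 :> rat by rewrite intr_eq0 gt_eqF.
    have l0' : l%:~R != 0 :> rat by rewrite intr_eq0.
    have p0' : (p n.+1)%:~R != 0 :> rat by rewrite intr_eq0 gt_eqF.
    by field; rewrite Q0' l0' p0'.
  have [d1 d2] := denominator_between (cp n) (coprime_num_den r : coprimez (numq r) (denq r)) eq.
  exists `|denq r|%N; rewrite vE; split => //; first by rewrite absz_gt0 denq_neq0.
  have vR : (`|denq r|%N)%:R = (denq r)%:~R :> R by rewrite -[in RHS]vE.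
  by exists (numq r); [exact: coprime_num_den|rewrite rE ratE vR].
(* Chosen so that Y = D^(n+1) exceeds v, kappa, 1 / kappa, sigma + 2 and x0 all at once, while ln Y
   stays linear in n. *)
pose S : R := Q%:~R * tau * `|l%:~R| + (c0 ^+ 2 + 1) * tau + (c0 ^+ 2)^-1 + 4 * tau + `|x0| + 4.
pose D := (Num.trunc S).+1.
have SD : S < D%:R by rewrite /D truncnS_gt.
have tau0 : 0 <= tau by exact: le_trans tau2.
have tau1 : 1 <= tau by apply: le_trans tau2; rewrite ler1n.
have lR1 : 1 <= `|l%:~R| :> R by rewrite -intr_norm -[1]/(1%:~R) ler_int.
have QR2 : 2 <= Q%:~R :> R by rewrite -[2]/(2%:~R) ler_int.
have s1 : 0 <= Q%:~R * tau * `|l%:~R| by rewrite !mulr_ge0// ltW.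
have s2 : 0 <= (c0 ^+ 2 + 1) * tau by rewrite mulr_ge0// addr_ge0// ltW.
have s3 : 0 <= (c0 ^+ 2)^-1 by rewrite invr_ge0 ltW.
have s4 := normr_ge0 x0.
have DS : [/\ Q%:~R * tau * `|l%:~R| <= D%:R, (c0 ^+ 2 + 1) * tau <= D%:R, (c0 ^+ 2)^-1 <= D%:R,
   4 * tau <= D%:R & `|x0| <= D%:R /\ 4 <= D%:R :> R].
  by apply: sum_bounds s1 s2 s3 _ s4 SD; rewrite mulr_ge0//; exact: le_trans tau2.
have [D1 D2 D3 D4 [D5 D6]] := DS.
(* U_(n+1) occurs both in the lower bound for v and in kappa and cancels. There remains Q^(n+1) >=
   2^(n+1) against a linear function of n. *)
have [n Hn] := @exp2_dominates R (h%:~R * (24 * c0 ^+ 2 * D%:R)).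
have [v [v0 d1 d2 [u uv alu]]] := key n.
pose Y := (D ^ n.+1)%N.
have pw (z : R) : 0 <= z -> z <= D%:R -> z ^+ n.+1 <= Y%:R.
  by move=> z0 zD; rewrite /Y natrX lerXn2r ?nnegrE ?ler0n.
have DY : D%:R <= Y%:R :> R by rewrite ler_nat /Y expnS leq_pmulr// expn_gt0.
set u1 := U n.+1 in Hn *.
have u1P : 1 <= u1 by exact: U1.
have u1t : u1 <= tau ^+ n.+1.
  apply: le_trans (lucas_le n tau2) _; rewrite exprS ler_peMl ?exprn_ge0//; lra.
have pow1 (z : R) : 1 <= z -> z <= z ^+ n.+1.
  by move=> z1; rewrite exprS ler_peMr ?exprn_ege1//; exact: le_trans z1.
have vY : (v <= Y)%N.
  have : (v%:Z <= Q * p n.+1 * `|l|)%R.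
    have pos : (0 < Q * p n.+1 * `|l|)%R by rewrite !mulr_gt0// normr_gt0.
    have d3 : (v%:Z %| Q * p n.+1 * `|l|)%Z.
      have [_|_] := ger0P l => //; by rewrite mulrN rpredN.
    exact: dvdz_le_pos pos d3.
  rewrite -(ler_int R) !rmorphM/= -Up -(ler_nat R) intr_norm => h1; apply: le_trans h1 _.
  apply: le_trans (pw _ s1 D1).
  have -> : Q%:~R * (U n.+1 * Q%:~R ^+ n) * `|l%:~R| = Q%:~R ^+ n.+1 * u1 * `|l%:~R| by rewrite exprS /u1; ring.
  rewrite !exprMn; apply: ler_pM; rewrite ?pow1 ?normr_ge0//.
    by rewrite mulr_ge0 ?exprn_ge0 ?(ltW QR0)//; exact: le_trans u1P.
  by rewrite ler_wpM2l// exprn_ge0// ltW.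
have few x (s : seq R) : x0 <= x -> uniq s ->
    (forall t, t \in s -> [/\ 2 < t, t <= x & exists2 A, G A & \tr A = t]) ->
    (size s)%:R <= x * ln (ln (3 * ln x)).
  by move=> xx us Hs; have := Hx x s xx us Hs; rewrite mul1r.
have B := @denominator_bound R G x0 (c0 ^+ 2 * u1) (u1 + u1^-1) u v Y few v0 uv.
have u10 : 0 < u1 by exact: lt_le_trans u1P.
have u1i0 : 0 <= u1^-1 by rewrite invr_ge0 ltW.
have u1i1 : u1^-1 <= 1 by rewrite invf_le1.
have {B} : v%:R <= 4 * (c0 ^+ 2 * u1) * ln (3 * (4 * (Y%:R * (16 * Y%:R)))).
  apply: B => //.
  - move=> N m; exists (E ^+ n.+1 * umx N%:~R * (E * umx m%:~R)).
      apply: (GM); apply: (GM) => //; by [exact: group_exp|exact: group_umx_int].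
    rewrite tr_power_product//; last exact: lt0r_neq0.
    rewrite -/tau -/(U n.+1) -/(U n.+2) -/c0 -/(al n) alu -/u1.
    rewrite !rmorphD/= !rmorphM/= -[v%:Z%:~R]/(v%:R : R).
    have v0' : v%:R != 0 :> R by rewrite pnatr_eq0 -lt0n.
    by field; rewrite v0' lt0r_neq0.
  - by rewrite mulr_gt0.
  - by rewrite addr_ge0// ltW.
  - apply: le_trans (pw _ s2 D2); rewrite exprMn; apply: ler_pM => //; [exact: ltW|exact: ltW|].
    apply: (@le_trans _ _ (c0 ^+ 2 + 1)); first by rewrite lerDl.
    by apply: pow1; rewrite lerDr ltW.
  - by apply: le_trans DY; apply: le_trans D3; rewrite invfM ler_piMr.
  - apply: le_trans (pw _ _ D4); last by rewrite mulr_ge0.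
    rewrite exprMn; apply: (@le_trans _ _ (4 * tau ^+ n.+1)).
      by apply: sigma_bound => //; exact: exprn_ege1.
    by rewrite ler_wpM2r ?exprn_ge0// pow1// ler1n.
  - by apply: le_trans DY; apply: le_trans D5; rewrite ler_norm.
have Y4 : 4 <= Y%:R :> R by exact: le_trans DY.
have lY : ln Y%:R <= n.+1%:R * D%:R :> R.
  have D0 : 0 < D%:R :> R by rewrite ltr0n.
  by rewrite /Y natrX lnXn// -[leLHS]mulr_natl ler_wpM2l// ltW// ln_sublinear.
move=> vB.
have {vB} vB : v%:R <= 4 * (c0 ^+ 2 * u1) * (6 * (n.+1%:R * D%:R)).
  apply: le_trans vB _; apply: ler_wpM2l.
    by rewrite mulr_ge0// mulr_ge0// ltW.
  by apply: le_trans (ln_poly_bound Y4) _; rewrite ler_wpM2l.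
have Qv : Q%:~R ^+ n.+1 * u1 <= h%:~R * v%:R.
  have hv : (0 < h * v%:Z)%R by rewrite mulr_gt0.
  have : (Q * p n.+1 <= h * v%:Z)%R by exact: dvdz_le_pos hv d1.
  by rewrite -(ler_int R) !rmorphM/= -Up exprS => h1; rewrite mulrAC -mulrA.
have Q2n : 2 ^+ n.+1 <= Q%:~R ^+ n.+1 :> R by rewrite lerXn2r ?nnegrE// ltW.
have : 2 ^+ n.+1 * u1 <= h%:~R * (24 * c0 ^+ 2 * D%:R) * n.+1%:R * u1.
  apply: (@le_trans _ _ (Q%:~R ^+ n.+1 * u1)); first by rewrite ler_wpM2r// ltW.
  apply: le_trans Qv _; apply: (@le_trans _ _ (h%:~R * (4 * (c0 ^+ 2 * u1) * (6 * (n.+1%:R * D%:R))))).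
    by rewrite ler_wpM2l// ltW.
  by rewrite le_eqVlt; apply/orP; left; apply/eqP; ring.
by rewrite ler_pM2r// leNgt Hn.
Qed.

End integral_trace.

(** * Groups with integral squared traces *)
Section integral_entries.
Context (R : realType).
Local Notation M := 'M[R]_2.
Implicit Types (G : set M) (A B E h : M).

Lemma rat_sqr_int (r : R) : israt r -> r ^+ 2 \is a Num.int -> r \is a Num.int.
Proof.
move=> [q ->] /intrP[z]; rewrite -rmorphXn/= -ratr_int => /(fmorph_inj (ratr : {rmorphism rat -> R})) E.
have d0 : (denq q)%:~R != 0 :> rat by rewrite intr_eq0.
have E2 : numq q ^+ 2 = z * denq q ^+ 2.
  by apply/eqP; rewrite -(eqr_int rat) rmorphXn rmorphM rmorphXn/= numqE exprMn E.
have : (denq q %| numq q ^+ 2)%Z by rewrite E2 expr2 mulrA dvdz_mull.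
have c1 : coprimez (denq q) (numq q) by rewrite coprimez_sym; exact: coprime_num_den.
rewrite expr2 Gauss_dvdzr// -[numq q]mulr1 Gauss_dvdzr// dvdz1 => /eqP h.
have d1 : denq q = 1 by rewrite -absz_denq h.
by apply/intrP; exists (numq q); rewrite /ratr d1 divr1.
Qed.

(** The cross term 2 p q is rational with integral square, hence integral. *)
Lemma int_sqr_sub (p q : R) : 2 * p ^+ 2 \is a Num.int -> 2 * q ^+ 2 \is a Num.int -> israt (p * q) ->
  2 * (p - q) ^+ 2 \is a Num.int.
Proof.
move=> hp hq rpq.
have h : 2 * (p * q) \is a Num.int.
  apply: rat_sqr_int; first by apply: isratM => //; exact: israt_nat.
  have -> : (2 * (p * q)) ^+ 2 = (2 * p ^+ 2) * (2 * q ^+ 2) by ring.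
  exact: rpredM.
have -> : 2 * (p - q) ^+ 2 = 2 * p ^+ 2 + 2 * q ^+ 2 - 2 * (2 * (p * q)) by ring.
by apply: rpredB; [apply: rpredD|apply: rpredM => //; exact: (rpred_nat _ 2)].
Qed.

(** E is la times a rational matrix with la^2 rational: la is the lower left entry if that is
    non-zero, and 1 otherwise. In the second case the upper right entry is read off from E A0. *)
Lemma entries_rational G A0 E : SL2_subgroup G -> discrete_mx G -> G (umx 1) -> rational_cusp G -> G A0 -> A0 i1 i0 != 0 ->
  G E -> forall i j k l, israt (E i j * E k l).
Proof.
move=> sG dG GT rG GA0 c0 GE; have [_ _ Gd GM GV] := sG; have dE := Gd _ GE.
suff [la [rla N]] : exists la : R, israt (la ^+ 2) /\ forall i j, exists2 q, israt q & E i j = la * q.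
  move=> i j k l; have [q rq ->] := N i j; have [q' rq' ->] := N k l.
  have -> : la * q * (la * q') = la ^+ 2 * (q * q') by ring.
  by apply: isratM => //; exact: isratM.
have four (P : R -> Prop) : P (E i0 i0) -> P (E i0 i1) -> P (E i1 i0) -> P (E i1 i1) -> forall i j, P (E i j).
  by move=> ? ? ? ? i j; case: (I2_cases i) => ->; case: (I2_cases j) => ->.
have [cE|cE] := eqVneq (E i1 i0) 0; last first.
  have [ra rd rc] := rG E GE cE.
  exists (E i1 i0); split => //; apply: (four (fun y => exists2 q, israt q & y = _ * q)).
  - by exists (E i0 i0 / E i1 i0) => //; field.
  - exists (E i0 i0 / E i1 i0 * (E i1 i1 / E i1 i0) - (E i1 i0 ^+ 2)^-1).
      by apply: isratB; [exact: isratM|exact: isratV].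
    by rewrite det2E in dE; have -> : E i0 i1 = (E i0 i0 * E i1 i1 - 1) / E i1 i0 by [rewrite -dE; field]; field.
  - by exists 1; [exact: (israt_nat R 1)|rewrite mulr1].
  - by exists (E i1 i1 / E i1 i0) => //; field.
exists 1; split; first by rewrite expr1n; exact: (israt_nat R 1).
have aE := triangular_unipotent sG dG GT GE cE.
have r1 : israt (1 : R) := israt_nat R 1.
have ra : israt (E i0 i0) by case: aE => ->; [|exact: isratN].
have dE' : E i0 i0 * E i1 i1 = 1 by move: dE; rewrite det2E cE mulr0 subr0.
have a0 : E i0 i0 != 0 by apply: contraTneq (oner_neq0 R) => a0; rewrite -dE' a0 mul0r eqxx.
have rd : israt (E i1 i1).
  have -> : E i1 i1 = (E i0 i0)^-1 by rewrite -[LHS](mulKf a0) dE' mulr1.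
  exact: isratV.
have d0 : E i1 i1 != 0 by apply: contraTneq (oner_neq0 R) => d0; rewrite -dE' d0 mulr0 eqxx.
apply: (four (fun y => exists2 q, israt q & y = _ * q)).
- by exists (E i0 i0) => //; rewrite mul1r.
- exists (E i0 i1); last by rewrite mul1r.
  have GB : G (E * A0) by exact: GM.
  have cB : (E * A0) i1 i0 = E i1 i1 * A0 i1 i0 by rewrite mulmx2E cE mul0r add0r.
  have cB0 : (E * A0) i1 i0 != 0 by rewrite cB mulf_neq0.
  have [rB _ _] := rG _ GB cB0; have [rA _ _] := rG _ GA0 c0.
  have -> : E i0 i1 = E i1 i1 * ((E * A0) i0 i0 / (E * A0) i1 i0) - E i0 i0 * (A0 i0 i0 / A0 i1 i0).
    by rewrite cB mulmx2E; field; rewrite c0.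
  by apply: isratB; exact: isratM.
- by exists 0; [exact: (israt_nat R 0)|rewrite cE mulr0].
- by exists (E i1 i1) => //; rewrite mul1r.
Qed.

(** The traces of E T and E T^-1 are t + c and t - c, and (t + c)^2 + (t - c)^2 - 2 t^2 = 2 c^2. *)
Lemma lower_entry_integral G E : SL2_subgroup G -> G (umx 1) ->
  (forall E, G E -> (\tr E) ^+ 2 \is a Num.int) -> G E -> 2 * (E i1 i0) ^+ 2 \is a Num.int.
Proof.
move=> sG GT iG GE; have [_ _ Gd GM GV] := sG.
have h0 := iG _ GE; have h1 := iG _ (GM _ _ GE GT); have h2 := iG _ (GM _ _ GE (GV _ GT)).
rewrite umxV tr_umx in h2; rewrite tr_umx in h1.
have -> : 2 * E i1 i0 ^+ 2 = (\tr E + E i1 i0 * 1) ^+ 2 + (\tr E + E i1 i0 * -1) ^+ 2 - 2 * \tr E ^+ 2 by ring.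
by apply: rpredB; [exact: rpredD|apply: rpredM => //; exact: (rpred_nat _ 2)].
Qed.

(** Multiplication by A0 moves each entry into the lower left corner, where [lower_entry_integral]
    applies; [int_sqr_sub] removes the correction terms. With F = 2 f^2 all squares of entries
    become integral after multiplication by 2 F^2, and mixed products follow by rationality. *)
Lemma entries_integral G A0 : SL2_subgroup G -> discrete_mx G -> G (umx 1) -> rational_cusp G ->
  G A0 -> A0 i1 i0 != 0 -> A0 i0 i0 = 0 -> (forall E, G E -> (\tr E) ^+ 2 \is a Num.int) ->
  exists2 S : nat, (0 < S)%N & forall E, G E -> forall i j k l, S%:R * (E i j * E k l) \is a Num.int.
Proof.
move=> sG dG GT rG GA0 c0 a0 iG; have [_ _ Gd GM GV] := sG.
set f := A0 i1 i0 in c0; set e := A0 i1 i1.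
have nat2 : (2 : R) \is a Num.int by exact: (rpred_nat _ 2).
have low E : G E -> 2 * (E i1 i0) ^+ 2 \is a Num.int by exact: lower_entry_integral.
have e2 : e ^+ 2 \is a Num.int by have := iG _ GA0; rewrite tr2E a0 add0r.
have [F FE] : exists F : nat, 2 * f ^+ 2 = F%:R.
  have /intrP[z zE] := low _ GA0; exists `|z|%N; rewrite -/f in zE; rewrite zE.
  by rewrite natr_absz ger0_norm// -(ler0z R) -zE mulr_ge0// sqr_ge0.
have f2 : 0 < f ^+ 2 by rewrite exprn_even_gt0.
have F0 : (0 < F)%N by rewrite -(ltr0n R) -FE mulr_gt0.
have intF : (F%:R : R) \is a Num.int by exact: rpred_nat.
have [_ ref rf] := rG _ GA0 c0; rewrite -/f -/e in ref rf.
exists (2 * F ^ 2)%N; first by rewrite muln_gt0 expn_gt0 F0.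
move=> E GE; have xy := entries_rational sG dG GT rG GA0 c0 GE.
have c2 := low _ GE.
(* The lower left entries of E A0, A0 E and A0 E A0 are f E11, f E00 + e E10 and f (f E01 + e
   E11). *)
have d2 : 2 * (E i1 i1 * f) ^+ 2 \is a Num.int.
  by have := low _ (GM _ _ GE GA0); rewrite mulmx2E a0 mulr0 add0r.
have ref' : israt (e * f) by have -> : e * f = f ^+ 2 * (e / f) by [field]; exact: isratM.
have re2 : israt (e ^+ 2) by have /intrP[z ->] := e2; exact: israt_int.
have a2 : 2 * (f * E i0 i0) ^+ 2 \is a Num.int.
  have -> : f * E i0 i0 = (f * E i0 i0 + e * E i1 i0) - e * E i1 i0 by rewrite addrK.
  apply: int_sqr_sub.
  - by have := low _ (GM _ _ GA0 GE); rewrite mulmx2E.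
  - by rewrite exprMn mulrCA; exact: rpredM.
  - have -> : (f * E i0 i0 + e * E i1 i0) * (e * E i1 i0) =
       e * f * (E i0 i0 * E i1 i0) + e ^+ 2 * (E i1 i0 * E i1 i0) by ring.
    by apply: isratD; exact: isratM.
have b2 : 2 * (f ^+ 2 * E i0 i1) ^+ 2 \is a Num.int.
  have -> : f ^+ 2 * E i0 i1 = (f * E i0 i1 + e * E i1 i1) * f - e * (E i1 i1 * f) by ring.
  apply: int_sqr_sub.
  - have := low _ (GM _ _ (GM _ _ GA0 GE) GA0); rewrite mulmx2E a0 mulr0 add0r.
    by rewrite mulmx2E.
  - by rewrite [(e * _) ^+ 2]exprMn mulrCA; exact: rpredM.
  - have -> : (f * E i0 i1 + e * E i1 i1) * f * (e * (E i1 i1 * f)) =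
       f ^+ 2 * (e * f) * (E i0 i1 * E i1 i1) + e ^+ 2 * f ^+ 2 * (E i1 i1 * E i1 i1) by ring.
    by apply: isratD; apply: isratM => //; exact: isratM.
pose S : R := 2 * F%:R ^+ 2.
have sq i j : S * (E i j) ^+ 2 \is a Num.int.
  case: (I2_cases i) => ->; case: (I2_cases j) => ->.
  - have -> : S * E i0 i0 ^+ 2 = 2 * F%:R * (2 * (f * E i0 i0) ^+ 2) by rewrite /S -FE; ring.
    by apply: rpredM => //; apply: rpredM.
  - have -> : S * E i0 i1 ^+ 2 = 2 * 2 * (2 * (f ^+ 2 * E i0 i1) ^+ 2) by rewrite /S -FE; ring.
    by apply: rpredM => //; apply: rpredM.
  - have -> : S * E i1 i0 ^+ 2 = F%:R * F%:R * (2 * E i1 i0 ^+ 2) by rewrite /S; ring.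
    by apply: rpredM => //; apply: rpredM.
  - have -> : S * E i1 i1 ^+ 2 = 2 * F%:R * (2 * (E i1 i1 * f) ^+ 2) by rewrite /S -FE; ring.
    by apply: rpredM => //; apply: rpredM.
move=> i j k l; rewrite natrM natrX -/S; apply: rat_sqr_int.
  by apply: isratM => //; rewrite /S -natrX -natrM; exact: israt_nat.
have -> : (S * (E i j * E k l)) ^+ 2 = (S * E i j ^+ 2) * (S * E k l ^+ 2) by ring.
exact: rpredM.
Qed.

Lemma Bezoutz4 (a b c d : int) : exists g u v w z : int,
  [/\ (g %| a)%Z, (g %| b)%Z, (g %| c)%Z, (g %| d)%Z & u * a + v * b + (w * c + z * d) = g].
Proof.
have [u [v uv]] := Bezoutz a b; have [w [z wz]] := Bezoutz c d.
have [s [t st]] := Bezoutz (gcdz a b) (gcdz c d).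
exists (gcdz (gcdz a b) (gcdz c d)), (s * u), (s * v), (t * w), (t * z); split.
- exact: dvdz_trans (dvdz_gcdl _ _) (dvdz_gcdl _ _).
- exact: dvdz_trans (dvdz_gcdl _ _) (dvdz_gcdr _ _).
- exact: dvdz_trans (dvdz_gcdr _ _) (dvdz_gcdl _ _).
- exact: dvdz_trans (dvdz_gcdr _ _) (dvdz_gcdr _ _).
by rewrite -st -uv -wz; ring.
Qed.

(* Here n is the determinant of the primitive integer matrix proportional to E. *)
Lemma primitive_form (S : nat) E : (0 < S)%N -> \det E = 1 ->
  (forall i j k l, S%:R * (E i j * E k l) \is a Num.int) ->
  exists (n : nat) (J : 'I_2 -> 'I_2 -> int), [/\ (0 < n)%N, (n <= S)%N &
    forall i j, E i j = (J i j)%:~R / Num.sqrt n%:R].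
Proof.
move=> S0 dE iE.
have [x [x0 [[p q] xE]]] : exists x : R, x != 0 /\ exists pq : 'I_2 * 'I_2, x = E pq.1 pq.2.
  have [a0|a0] := eqVneq (E i0 i0) 0; last by exists (E i0 i0); split => //; exists (i0, i0).
  exists (E i1 i0); split; last by exists (i1, i0).
  by apply: contraTneq (oner_neq0 R) => c0; rewrite -dE det2E a0 c0 mul0r mulr0 subr0 eqxx.
have /choice[K' KE'] : forall ij : 'I_2 * 'I_2, exists k : int, S%:R * (x * E ij.1 ij.2) = k%:~R.
  by move=> ij; rewrite xE /=; have /intrP := iE p q ij.1 ij.2.
pose K i j := K' (i, j).
have KE i j : S%:R * (x * E i j) = (K i j)%:~R by exact: KE' (i, j).
(* K = S x E is an integral multiple of E; dividing by the greatest common divisor of its entries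
   gives the primitive matrix J. *)
have [g [u [v [w [z [ga gb gc gd gE]]]]]] := Bezoutz4 (K i0 i0) (K i0 i1) (K i1 i0) (K i1 i1).
pose J i j := (K i j %/ g)%Z.
have KJ i j : K i j = J i j * g.
  by rewrite /J divzK//; case: (I2_cases i) => ->; case: (I2_cases j) => ->.
have Sx0 : S%:R * x != 0 by rewrite mulf_neq0// pnatr_eq0 -lt0n.
have EK i j : E i j = (K i j)%:~R / (S%:R * x).
  by rewrite -KE; field; rewrite x0 pnatr_eq0 -lt0n.
have g0 : g != 0.
  apply: contraTneq (oner_neq0 R) => g0.
  by rewrite -dE det2E !EK !KJ g0 !mulr0 !mul0r subr0 eqxx.
have gR : g%:~R != 0 :> R by rewrite intr_eq0.
have J1 : u * J i0 i0 + v * J i0 i1 + (w * J i1 i0 + z * J i1 i1) = 1.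
  by apply: (mulIf g0); rewrite mul1r -[RHS]gE !KJ; ring.
pose mu := g%:~R / (S%:R * x); have mu0 : mu != 0 by rewrite mulf_neq0// invr_neq0.
have EJ i j : E i j = (J i j)%:~R * mu by rewrite EK KJ rmorphM mulrA.
pose n := J i0 i0 * J i1 i1 - J i0 i1 * J i1 i0.
have nmu : n%:~R * mu ^+ 2 = 1 by rewrite -[RHS]dE det2E !EJ /n rmorphB !rmorphM/=; ring.
have mu2 : 0 < mu ^+ 2 by rewrite exprn_even_gt0.
have n0 : 0 < n by rewrite -(ltr0z R) -(pmulr_lgt0 _ mu2) nmu.
have nS i j k l : (n %| S%:Z * (J i j * J k l))%Z.
  have /intrP[y yE] := iE i j k l; apply/dvdzP; exists y; apply/eqP.
  rewrite -(eqr_int R) !rmorphM/= -yE !EJ; apply/eqP.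
  transitivity (S%:R * ((J i j)%:~R * (J k l)%:~R) * (n%:~R * mu ^+ 2)); last by ring.
  by rewrite nmu mulr1.
(* A Bezout relation between the entries of J turns n | S J_ij J_kl into n | S J_ij, and a second
   use gives n | S. *)
have nS' i j : (n %| S%:Z * J i j)%Z.
  rewrite -[S%:Z * _]mulr1 -J1.
  have -> : S%:Z * J i j * (u * J i0 i0 + v * J i0 i1 + (w * J i1 i0 + z * J i1 i1)) =
    u * (S%:Z * (J i j * J i0 i0)) + v * (S%:Z * (J i j * J i0 i1)) +
    (w * (S%:Z * (J i j * J i1 i0)) + z * (S%:Z * (J i j * J i1 i1))) by ring.
  by rewrite !rpredD//; apply: dvdz_mull.
have {nS'} nS1 : (n %| S%:Z)%Z.
  rewrite -[S%:Z]mulr1 -J1.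
  have -> : S%:Z * (u * J i0 i0 + v * J i0 i1 + (w * J i1 i0 + z * J i1 i1)) =
    u * (S%:Z * J i0 i0) + v * (S%:Z * J i0 i1) + (w * (S%:Z * J i1 i0) + z * (S%:Z * J i1 i1)) by ring.
  by rewrite !rpredD//; apply: dvdz_mull.
have nE : (`|n|%N%:R : R) = n%:~R by rewrite natr_absz gtr0_norm.
have sq : Num.sqrt (`|n|%N%:R : R) = `|mu|^-1.
  rewrite nE -(mulfK (lt0r_neq0 mu2) n%:~R) nmu mul1r -exprVn sqrtr_sqr normfV//.
exists `|n|%N, (fun i j => if 0 < mu then J i j else - J i j); split.
- by rewrite absz_gt0 gt_eqF.
- by apply: dvdn_leq => //; rewrite -[(_ %| _)%N]/((n %| S%:Z)%Z).
move=> i j; rewrite sq invrK EJ; case: ltrP => h.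
  by rewrite gtr0_norm.
by rewrite ler0_norm// rmorphN mulrNN.
Qed.

End integral_entries.

(** * Commensurability with SL(2,Z) *)

Section finite_index.
Context (R : realType).
Local Notation M := 'M[R]_2.
Implicit Types (G H K : set M) (A B E X Y h : M).

Lemma finite_index_key H K (T : finType) (key : M -> T) :
  (forall X Y, H X -> H Y -> key X = key Y -> K (X^-1 * Y)) -> finite_index H K.
Proof.
move=> HK; have /choice[rep repP] : forall t : T, exists X, (exists Y, H Y /\ key Y = t) -> H X /\ key X = t.
  by move=> t; have [[Y HY]|n] := pselect (exists Y, H Y /\ key Y = t); [exists Y|exists 0].
pose s := [seq rep t | t <- enum T].
exists s => X HX.
have lt : (index (key X) (enum T) < size s)%N by rewrite size_map index_mem mem_enum.
exists (Ordinal lt); rewrite /= (nth_map (key X)) ?index_mem ?mem_enum// nth_index ?mem_enum//.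
by have [] := repP (key X) (ex_intro _ X (conj HX erefl)) => HR KR; exact: HK.
Qed.

(** If no finite list of cosets suffices, representatives of new cosets can be added greedily beyond
    any bound. *)
Lemma finite_index_packing H K N :
  (forall m (d : nat -> M), (forall i, (i < m)%N -> H (d i)) ->
    (forall i j, (i < j < m)%N -> ~ K ((d i)^-1 * d j)) -> (m <= N)%N) -> finite_index H K.
Proof.
move=> Hm; apply: contrapT => nfi.
suff [s [sN sH sK]] : exists s : seq M, [/\ size s = N.+1, (forall i, (i < size s)%N -> H s`_i) &
    forall i j, (i < j < size s)%N -> ~ K ((s`_i)^-1 * s`_j)].
  by have := Hm _ _ sH sK; rewrite sN ltnn.
elim: N.+1 => [|m [s [sm sH sK]]]; first by exists [::]; split => // i j; rewrite andbF.
have [X HX nX] : exists2 X, H X & forall i : 'I_(size s), ~ K ((s`_i)^-1 * X).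
  apply: contrapT => h; apply: nfi; exists s => X HX.
  by apply: contrapT => h'; apply: h; exists X => // i Ki; apply: h'; exists i.
exists (rcons s X); rewrite size_rcons sm; split => //.
  move=> i; rewrite nth_rcons ltnS leq_eqVlt => /orP[/eqP->|im]; first by rewrite sm ltnn eqxx.
  by rewrite sm im; apply: sH; rewrite sm.
move=> i j /andP[ij]; rewrite !nth_rcons ltnS leq_eqVlt sm => /orP[/eqP jm|jm].
  have im : (i < m)%N by rewrite -jm.
  rewrite im jm ltnn eqxx; have is_ : (i < size s)%N by rewrite sm.
  exact: nX (Ordinal is_).
by rewrite jm (ltn_trans ij jm); apply: sK; rewrite ij sm.
Qed.

Definition intmx : set M := [set X | forall i j, X i j \is a Num.int].
Definition SLZ : set M := [set X | intmx X /\ \det X = 1].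

Lemma intmxM X Y : intmx X -> intmx Y -> intmx (X * Y).
Proof. by move=> hX hY i j; rewrite mulmx2E; apply: rpredD; apply: rpredM. Qed.

Lemma intmxV X : SLZ X -> SLZ X^-1.
Proof.
move=> [iX dX]; split; last exact: detV2.
move=> i j; rewrite (inv2E dX).
by case: (I2_cases i) => ->; case: (I2_cases j) => ->; rewrite !mx2E ?rpredN.
Qed.

Lemma intmx1 : intmx 1.
Proof.
by move=> i j; rewrite one2E; case: (I2_cases i) => ->; case: (I2_cases j) => ->; rewrite mx2E ?rpred0 ?rpred1.
Qed.

Definition prod_int (S : nat) X := forall i j k l, S%:R * (X i j * X k l) \is a Num.int.

Lemma prod_int_mull S X Y : intmx Y -> prod_int S X -> prod_int S (Y * X).
Proof.
move=> iY iX i j k l; rewrite !mulmx2E.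
have -> : S%:R * ((Y i i0 * X i0 j + Y i i1 * X i1 j) * (Y k i0 * X i0 l + Y k i1 * X i1 l)) =
  Y i i0 * Y k i0 * (S%:R * (X i0 j * X i0 l)) + Y i i0 * Y k i1 * (S%:R * (X i0 j * X i1 l)) +
  (Y i i1 * Y k i0 * (S%:R * (X i1 j * X i0 l)) + Y i i1 * Y k i1 * (S%:R * (X i1 j * X i1 l))) by ring.
by apply: rpredD; apply: rpredD; apply: rpredM => //; apply: rpredM.
Qed.

Lemma prod_int_mulr S X Y : intmx Y -> prod_int S X -> prod_int S (X * Y).
Proof.
move=> iY iX i j k l; rewrite !mulmx2E.
have -> : S%:R * ((X i i0 * Y i0 j + X i i1 * Y i1 j) * (X k i0 * Y i0 l + X k i1 * Y i1 l)) =
  Y i0 j * Y i0 l * (S%:R * (X i i0 * X k i0)) + Y i0 j * Y i1 l * (S%:R * (X i i0 * X k i1)) +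
  (Y i1 j * Y i0 l * (S%:R * (X i i1 * X k i0)) + Y i1 j * Y i1 l * (S%:R * (X i i1 * X k i1))) by ring.
by apply: rpredD; apply: rpredD; apply: rpredM => //; apply: rpredM.
Qed.

(** The key of J / sqrt n is n together with J modulo n. If X and Y have equal keys, Y = X + sqrt n
    L with L integral, so X^-1 Y = 1 + (sqrt n X^-1) L is integral. *)
Lemma finite_index_left G S : SL2_subgroup G -> (0 < S)%N -> (forall A, G A -> prod_int S A) ->
  finite_index G (G `&` SLZ).
Proof.
move=> sG S0 iG; have [_ _ Gd GM GV] := sG.
have /choice[nJ nJP] : forall A, exists nJ : nat * ('I_2 -> 'I_2 -> int), G A ->
    [/\ (0 < nJ.1)%N, (nJ.1 <= S)%N & forall i j, A i j = (nJ.2 i j)%:~R / Num.sqrt nJ.1%:R].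
  move=> A; have [GA|nGA] := pselect (G A); last by exists (0%N, fun _ _ => 0).
  by have [n [J H]] := primitive_form S0 (Gd _ GA) (iG _ GA); exists (n, J).
pose key A : 'I_S.+1 * {ffun 'I_2 * 'I_2 -> 'I_S.+1} :=
  (inord (nJ A).1, [ffun ij => inord `|((nJ A).2 ij.1 ij.2 %% (nJ A).1%:Z)%Z|]).
apply: (@finite_index_key _ _ _ key) => X Y GX GY [].
have [nX nXS XE] := nJP X GX; have [nY nYS YE] := nJP Y GY.
move=> /(congr1 val); rewrite /= !inordK ?ltnS// => nXY /ffunP JXY.
have GXY : G (X^-1 * Y) by apply: (GM) => //; exact: GV.
split => //; split; last exact: Gd.
move: (nJ X).1 (nJ X).2 (nJ Y).1 (nJ Y).2 nXY JXY nX nXS XE nY nYS YE => n J _ K <- JK n0 nS XE _ _ YE.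
have sn0 : 0 < Num.sqrt n%:R :> R by rewrite sqrtr_gt0 ltr0n.
have sn2 : Num.sqrt n%:R * Num.sqrt n%:R = n%:R :> R by rewrite -expr2 sqr_sqrtr ?ler0n.
have n0' : n%:Z != 0 by rewrite eqz_nat -lt0n.
have modE i j : exists l : int, K i j = J i j + l * n%:Z.
  have bd (x : int) : (`|(x %% n%:Z)%Z| < S.+1)%N.
    by rewrite ltnS (leq_trans _ nS)// ltnW// -ltz_nat gez0_abs ?modz_ge0// ltz_pmod.
  have := JK (i, j); rewrite !ffunE /= => /(congr1 val); rewrite /= !inordK//.
  move=> /(congr1 Posz); rewrite !gez0_abs ?modz_ge0// => h.
  exists ((K i j %/ n%:Z)%Z - (J i j %/ n%:Z)%Z)%R.
  by rewrite {1}(divz_eq (K i j) n) {1}(divz_eq (J i j) n) -h; ring.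
have /choice[L LE] : forall ij : 'I_2 * 'I_2, exists l : int, K ij.1 ij.2 = J ij.1 ij.2 + l * n%:Z.
  by move=> ij; exact: modE.
pose LM : M := \matrix_(i, j) (L (i, j))%:~R.
have YX : Y = X + Num.sqrt n%:R *: LM.
  apply/matrixP => i j; rewrite !mxE XE YE (LE (i, j)) /= rmorphD rmorphM/= mulrDl.
  congr (_ + _); rewrite [RHS]mulrC; apply: (mulIf (lt0r_neq0 sn0)).
  by rewrite mulfVK ?lt0r_neq0// -mulrA sn2.
have dX := Gd X GX.
have -> : X^-1 * Y = 1 + (Num.sqrt n%:R *: X^-1) * LM.
  by rewrite YX mulrDr mulVr ?det1_unit// -scalerAr scalerAl.
have nJE i j : Num.sqrt n%:R * X i j = (J i j)%:~R by rewrite XE mulrC mulfVK// gt_eqF.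
have i1 : intmx (Num.sqrt n%:R *: X^-1).
  move=> i j; rewrite (inv2E dX) mxE.
  by case: (I2_cases i) => ->; case: (I2_cases j) => ->; rewrite !mx2E ?mulrN nJE ?rpredN; apply/intrP; eexists.
have i2 : intmx LM by move=> i j; rewrite mxE; apply/intrP; eexists.
move=> i j; rewrite mxE; apply: rpredD; first exact: intmx1.
exact: intmxM.
Qed.

Lemma small_int (x : R) : x \is a Num.int -> 0 <= x -> x < 1 -> x = 0.
Proof.
move=> /intrP[z ->]; rewrite ler0z -[1]/(1%:~R) ltr_int => z0 z1.
by have -> : z = 0 by lia.
Qed.

(** The base point has height 2 s. A displacement below e there forces s c^2 < 1, then s (a - d)^2 <
    1, then s b^2 < 1; each is a nonnegative integer and so vanishes. *)
Lemma rigid_entries (s e : R) X (a := X i0 i0) (b := X i0 i1) (c := X i1 i0) (d := X i1 i1) :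
  1 <= s -> a * d - b * c = 1 -> e * (8 * (s * s * s)) = 1 ->
  s * (a * a) \is a Num.int -> s * (a * d) \is a Num.int -> s * (d * d) \is a Num.int ->
  s * (b * b) \is a Num.int -> s * (c * c) \is a Num.int ->
  (a - d) ^+ 2 + (b / (2 * s) + c * (2 * s)) ^+ 2 < e -> \det X = 1 -> X = 1 \/ X = -1.
Proof.
move=> s1 dE E8 iaa iad idd ibb icc h dX.
have s0 : 0 < s by lra.
have ss : s <= s * s * s.
  have : 1 * 1 <= s * s by apply: ler_pM; lra.
  by move=> ?; rewrite -[leLHS]mul1r ler_wpM2r//; lra.
have e0 : 0 < e by rewrite -(pmulr_lgt0 _ (_ : 0 < 8 * (s * s * s))) ?E8// !mulr_gt0.
have es : e * (8 * s) <= 1 by rewrite -[leRHS]E8 ler_wpM2l ?(ltW e0)// ler_wpM2l.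
have e1 : e <= 1 / 8 by have : e * 1 <= e * s by [rewrite ler_wpM2l// ltW]; lra.
have g2 : (a - d) ^+ 2 + (b / (2 * s) + c * (2 * s)) ^+ 2 =
  a ^+ 2 + d ^+ 2 + (b / (2 * s)) ^+ 2 + 4 * s * (s * (c * c)) - 2 * (a * d - b * c).
  by field; rewrite gt_eqF.
have sc0 : 0 <= s * (c * c) by rewrite mulr_ge0 ?(ltW s0)// -expr2 sqr_ge0.
have sc : s * (c * c) < 1.
  have h1 : s * (c * c) <= s * (s * (c * c)) by rewrite ler_peMl.
  move: h; rewrite g2 dE.
  have := sqr_ge0 a; have := sqr_ge0 d; have := sqr_ge0 (b / (2 * s)); lra.
have c0 : c = 0.
  move/eqP: (small_int icc sc0 sc); rewrite mulf_eq0 (gt_eqF s0)/= mulf_eq0 orbb => /eqP//.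
rewrite c0 mulr0 subr0 in dE; rewrite c0 mul0r addr0 in h.
have sad : s * (a - d) ^+ 2 = s * (a * a) + s * (d * d) - 2 * (s * (a * d)) by ring.
have ad : a = d.
  have i1 : s * (a - d) ^+ 2 \is a Num.int.
    by rewrite sad; apply: rpredB; [exact: rpredD|apply: rpredM => //; exact: (rpred_nat _ 2)].
  have i2 : s * (a - d) ^+ 2 < 1.
    apply: (@lt_le_trans _ _ (s * e)); last by lra.
    by rewrite ltr_pM2l//; have := sqr_ge0 (b / (2 * s)); lra.
  have i3 : 0 <= s * (a - d) ^+ 2 by rewrite mulr_ge0 ?sqr_ge0// ltW.
  move/eqP: (small_int i1 i3 i2); rewrite mulf_eq0 (gt_eqF s0)/= sqrf_eq0 subr_eq0 => /eqP//.
apply: scalar2_det1 => //; split => //; rewrite -/b.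
have b3 : s * (b * b) < 1.
  have -> : s * (b * b) = (b / (2 * s)) ^+ 2 * (4 * (s * s * s)) by field; rewrite gt_eqF.
  apply: (@lt_le_trans _ _ (e * (4 * (s * s * s)))); last by lra.
  by rewrite ltr_pM2r ?mulr_gt0//; have := sqr_ge0 (a - d); lra.
have b0 : 0 <= s * (b * b) by rewrite mulr_ge0 ?(ltW s0)// -expr2 sqr_ge0.
by move/eqP: (small_int ibb b0 b3); rewrite mulf_eq0 (gt_eqF s0)/= mulf_eq0 orbb => /eqP.
Qed.

(** Pack the points d_i^-1 q for representatives d_i. If A in G brings two of them together, X = d_i
    A d_j^-1 still has integral products S X_ij X_kl, so X is 1 or -1 by rigidity, and d_i^-1 d_j
    lies in G. *)
Lemma finite_index_right G S : SL2_subgroup G -> discrete_mx G -> finite_area G -> (0 < S)%N ->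
  (forall A, G A -> prod_int S A) -> finite_index SLZ (G `&` SLZ).
Proof.
move=> sG dG aG S0 iG; have [G1 GN1 Gd GM GV] := sG.
set s : R := S%:R; have s1 : 1 <= s by rewrite ler1n.
pose e : R := (8 * (s * s * s))^-1.
have sss : 1 <= s * s * s by rewrite !mulr_ege1.
have e0 : 0 < e by rewrite invr_gt0 mulr_gt0//; lra.
pose q : R * R := (0, 2 * s).
have q2 : H2 q by rewrite /H2/=; lra.
have rigid X : \det X = 1 -> prod_int S X -> hgap q (mobius X q) < e -> X = 1 \/ X = -1.
  move=> dX iX; rewrite gap_at_pt// /gap /at_pt !mx2E /= !mulr0 !subr0 !addr0 expr0n /= !mulr0 !subr0.
  move: (iX i0 i0 i0 i0) (iX i0 i0 i1 i1) (iX i1 i1 i1 i1) (iX i0 i1 i0 i1) (iX i1 i0 i1 i0).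
  rewrite -/s; move: (dX); rewrite det2E; set a := X i0 i0; set b := X i0 i1; set c := X i1 i0; set d := X i1 i1.
  move=> dE iaa iad idd ibb icc h.
  have s0 : s != 0 by rewrite gt_eqF//; exact: lt_le_trans s1.
  have E8 : e * (8 * (s * s * s)) = 1 by rewrite mulVf// !mulf_neq0.
  exact: (rigid_entries s1 dE E8 (iaa) iad idd ibb icc h dX).
have [N HN] := packing sG dG aG e0.
apply: (@finite_index_packing _ _ N) => m d dH dK.
have dd i : (i < m)%N -> \det (d i) = 1 by move=> /dH[].
apply: (HN m (fun i => mobius (d i)^-1 q)).
  by move=> i im; apply: mobius_H2 => //; apply: detV2; exact: dd.
move=> i j A im jm GA; have di := dd i im; have dj := dd j jm; have dA := Gd A GA.
have Vi := detV2 di; have Vj := detV2 dj.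
have ui := det1_unit di; have uj := det1_unit dj.
pose X := d i * A * (d j)^-1.
have dX : \det X = 1 by rewrite !detM2 di dA Vj !mulr1.
have -> : hgap (mobius (d i)^-1 q) (mobius A (mobius (d j)^-1 q)) = hgap q (mobius X q).
  have h1 : H2 (mobius (d i)^-1 q) by exact: mobius_H2.
  have h2 : H2 (mobius (d j)^-1 q) by exact: mobius_H2.
  rewrite -(hgap_mobius di h1 (mobius_H2 dA h2)) mobiusKV// /X -mulrA mobiusM ?mobiusM//.
  by rewrite detM2 dA Vj mulr1.
have iX : prod_int S X.
  apply: prod_int_mulr; last by apply: prod_int_mull; [have [] := dH i im|exact: iG].
  by have [] := intmxV (dH j jm).
move=> /(rigid X dX iX) X1.
have AE : A = (d i)^-1 * d j \/ A = - ((d i)^-1 * d j).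
  have AX : A = (d i)^-1 * X * d j by rewrite /X !mulrA mulVr// mul1r mulrVK.
  by rewrite AX; case: X1 => ->; [left; rewrite mulr1|right; rewrite mulrN1 mulNr].
have Gij : G ((d i)^-1 * d j).
  by case: AE => AE; [rewrite -AE|rewrite -[_ * _]opprK -AE; exact: group_opp].
have Zij : SLZ ((d i)^-1 * d j).
  by split; [apply: intmxM; [have [] := intmxV (dH i im)|have [] := dH j jm]|rewrite detM2 Vi dj mulr1].
have ij : i = j.
  apply: contrapT => /eqP; rewrite neq_ltn => /orP[lt|lt].
    by apply: (dK i j) => //; rewrite lt.
  apply: (dK j i); first by rewrite lt.
  have -> : (d j)^-1 * d i = ((d i)^-1 * d j)^-1 by rewrite invrM ?unitrV// invrK.
  by split; [exact: GV|exact: intmxV].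
split => //; case: AE; rewrite -ij mulVr// => ->; by [left|right].
Qed.

End finite_index.

From mathcomp.real_closed Require Import complex.

(** * Arithmeticity over the field of rationals *)

Section arithmetic.
Context (R : realType).
Local Notation M := 'M[R]_2.
Implicit Types (G H K : set M) (A B E X Y P : M).

Lemma embedding_rat (F : numFieldType) (s : R -> F) : s 1 = 1 ->
  (forall x y, israt x -> israt y -> s (x + y) = s x + s y /\ s (x * y) = s x * s y) ->
  forall q : rat, s (ratr q) = ratr q.
Proof.
move=> s1 sDM q; pose f (r : rat) := s (ratr r).
have fD : zmod_morphism f.
  have f0 : f 0 = 0.
    have [+ _] := sDM 0 0 (israt_nat R 0) (israt_nat R 0).
    by rewrite addr0 /f rmorph0 => e; apply: (addrI (s 0)); rewrite addr0 -e.
  have fD' x y : f (x + y) = f x + f y.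
    by rewrite /f rmorphD; apply: (sDM _ _ _ _).1; [exists x|exists y].
  move=> x y; apply: (addIr (f y)); rewrite -fD' !subrK//.
have fM : monoid_morphism f.
  split; first by rewrite /f rmorph1.
  by move=> x y; rewrite /f rmorphM; apply: (sDM _ _ _ _).2; [exists x|exists y].
pose fA := GRing.isZmodMorphism.Build rat F f fD.
pose fMm := GRing.isMonoidMorphism.Build rat F f fM.
pose fR : {rmorphism rat -> F} := HB.pack f fA fMm.
exact: (fmorph_eq_rat fR).
Qed.

Definition rat_set : set R := [set x | israt x].

Lemma rat_number_field : number_field_in_R rat_set.
Proof.
split.
- split; first exact: (israt_nat R 1).
    by move=> x y rx ry; split; [exact: isratB|exact: isratM].
  by move=> x; exact: isratV.
- exists [:: 1]; split; first by case=> -[|//] /= _; exact: (israt_nat R 1).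
  by move=> x [q ->]; exists (fun=> q); rewrite big_ord_recl big_ord0 addr0 mulr1.
- move=> s [s1 sDM] x [q ->]; rewrite (embedding_rat s1 sDM).
  by apply/Creal_ImP; exact: rpred_rat.
Qed.

Definition ent (X : M) (i : 'I_4) : R := nth 0 [:: X i0 i0; X i0 i1; X i1 i0; X i1 i1] i.

Definition unit_mx (i : 'I_4) : M :=
  mx2 ((i : nat) == 0%N)%:R ((i : nat) == 1%N)%:R ((i : nat) == 2%N)%:R ((i : nat) == 3%N)%:R.

Lemma sum4_mx (c : 'I_4 -> R) : \sum_i c i *: unit_mx i =
  mx2 (c ord0) (c (lift ord0 ord0)) (c (lift ord0 (lift ord0 ord0))) (c (lift ord0 (lift ord0 (lift ord0 ord0)))).
Proof.
rewrite !big_ord_recl big_ord0 /unit_mx /=.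
by apply: mx2P; rewrite !mxE /=; ring.
Qed.

Lemma ent_decomp X : X = \sum_i ent X i *: unit_mx i.
Proof. by rewrite sum4_mx /ent /= -mx2_eta. Qed.

Lemma ent_sum (c : 'I_4 -> R) i : ent (\sum_i c i *: unit_mx i) i = c i.
Proof.
rewrite sum4_mx /ent !mx2E; case: i => -[|[|[|[|//]]]] lti /=; congr c; exact: val_inj.
Qed.

Definition ent_closed (S : R -> Prop) X := forall i : 'I_4, S (ent X i).

Lemma ent_closedP (S : R -> Prop) X : (forall i j, S (X i j)) <-> ent_closed S X.
Proof.
split=> [h [[|[|[|[|//]]]] lti]|h i j]; rewrite /ent /=; try exact: h.
have h0 := h (inord 0); have h1 := h (inord 1); have h2 := h (inord 2); have h3 := h (inord 3).
rewrite /ent !inordK//= in h0 h1 h2 h3.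
by case: (I2_cases i) => ->; case: (I2_cases j) => ->.
Qed.

Lemma finite_index_conj P H K : \det P = 1 -> finite_index (conjG P H) (conjG P K) -> finite_index H K.
Proof.
move=> dP [s Hs]; have uP := det1_unit dP; pose f (x : M) : M := P * x * P^-1.
exists [seq f x | x <- s] => X HX.
have HX' : conjG P H (P^-1 * X * P) by rewrite /conjG/= !mulrA mulrV// mul1r mulrK.
have [i Ki] := Hs _ HX'.
have lt : (i < size [seq f x | x <- s])%N by rewrite size_map.
exists (Ordinal lt); rewrite /= (nth_map 0)//.
(* A listed representative may be singular; the inverse of a non-unit is then the element itself,
   and conjugation respects this convention. *)
have VE : (P * s`_i * P^-1)^-1 = P * (s`_i)^-1 * P^-1.
  have [us|us] := boolP (s`_i \is a GRing.unit).
    by rewrite !invrM ?unitrMl ?unitrV// invrK mulrA.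
  by rewrite (invr_out us) invr_out// unitrMl ?unitrV// unitrMr.
rewrite /f VE; move: Ki; rewrite /conjG/= !mulrA mulrK//.
Qed.

Lemma arithmetic_of_commensurable G P : \det P = 1 ->
  finite_index (conjG P G) (conjG P G `&` @SLZ R) -> finite_index (@SLZ R) (conjG P G `&` @SLZ R) ->
  arithmetic_fuchsian G.
Proof.
move=> dP f1 f2; have uP := det1_unit dP; have uV : P^-1 \is a GRing.unit by rewrite unitrV.
pose up X := P * X * P^-1; pose dn X := P^-1 * X * P.
have dnK X : up (dn X) = X by rewrite /up /dn !mulrA mulrV// mul1r mulrK.
have upK X : dn (up X) = X by rewrite /up /dn !mulrA mulVr// mul1r mulrVK.
have upM X Y : up (X * Y) = up X * up Y by exact: conjGM.
have upD X Y : up (X + Y) = up X + up Y by rewrite /up mulrDr mulrDl.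
have dnM X Y : dn (X * Y) = dn X * dn Y by rewrite -{1}(dnK X) -{1}(dnK Y) -upM upK.
have dnD X Y : dn (X + Y) = dn X + dn Y by rewrite -{1}(dnK X) -{1}(dnK Y) -upD upK.
have upZ (c : R) X : up (c *: X) = c *: up X by rewrite /up -scalerAr -scalerAl.
have dnZ (c : R) X : dn (c *: X) = c *: dn X by rewrite -{1}(dnK X) -upZ upK.
have up0 : up 0 = 0 by rewrite /up mulr0 mul0r.
have upsum (n : nat) (F : 'I_n -> M) : up (\sum_i F i) = \sum_i up (F i).
  exact: (big_morph up upD up0).
pose e i := up (unit_mx i).
have esum (c : 'I_4 -> R) : \sum_i c i *: e i = up (\sum_i c i *: unit_mx i).
  by rewrite upsum; apply: eq_bigr => i _; rewrite upZ.
have decomp X : X = \sum_i ent (dn X) i *: e i by rewrite esum -ent_decomp dnK.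
pose rmx : set M := [set X | forall i j, israt (X i j)].
have rM X Y : rmx X -> rmx Y -> rmx (X * Y).
  by move=> hX hY i j; rewrite mulmx2E; apply: isratD; exact: isratM.
have ru i : rmx (unit_mx i).
  by move=> k l; rewrite /unit_mx; case: (I2_cases k) => ->; case: (I2_cases l) => ->; rewrite mx2E; exact: israt_nat.
have iu i : @intmx R (unit_mx i).
  by move=> k l; rewrite /unit_mx; case: (I2_cases k) => ->; case: (I2_cases l) => ->; rewrite mx2E; exact: rpred_nat.
have ir X : @intmx R X -> rmx X by move=> h i j; have /intrP[z ->] := h i j; exact: israt_int.
have dn1 : dn 1 = 1 by rewrite /dn mulr1 mulVr.
pose c i j l := ent (unit_mx i * unit_mx j) l.
(* The algebra is P M_2(Q) P^-1 and the order is P M_2(Z) P^-1; c holds the structure constants of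
   the matrix units. *)
exists rat_set, [set X | rmx (dn X)], [set X | @intmx R (dn X)], e, c; split.
- split; first exact: rat_number_field.
  split; rewrite /=.
  + by rewrite dn1; apply: ir; exact: intmx1.
  + move=> X Y hX hY; rewrite dnD dnM; split; last exact: rM.
    by move=> i j; rewrite mxE; exact: isratD.
  + by move=> x X hx hX; rewrite dnZ => i j; rewrite mxE; exact: isratM.
- split.
  + split; rewrite /=.
    * by move=> i; rewrite upK.
    * move=> X hX; exists (ent (dn X)); split => //.
      by have hh := (ent_closedP (@israt R) (dn X)).1 hX; move=> i; exact: (hh i).
    * move=> x _ E i; rewrite esum in E; have := congr1 dn E; rewrite upK /dn mulr0 mul0r => E'.
      by rewrite -(ent_sum x i) E' /ent; case: i => -[|[|[|[|//]]]] lti /=; rewrite mxE.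
  + by move=> X; exists (ent (dn X)).
  + split; last by move=> i j; rewrite /c esum -ent_decomp upM.
    by move=> i j l; have hh := (ent_closedP (@israt R) _).1 (rM _ _ (ru i) (ru j)); exact: (hh l).
(* Every embedding of Q is the identity, which contradicts the assumed x with s x <> x. *)
- move=> s [s1 sDM] [x [[q ->]]]; rewrite (embedding_rat s1 sDM) => /eqP; by [].
- split.
  + by move=> X; exact: ir.
  + by rewrite /= dn1; exact: intmx1.
  + move=> X Y hX hY; rewrite /= dnM; split; last exact: intmxM.
    have -> : dn (X - Y) = dn X - dn Y by rewrite -scaleN1r dnD dnZ scaleN1r.
    by move: hX hY => /=; move: (dn X) (dn Y) => A B hA hB i j; rewrite !mxE; exact: rpredB.
  + have sz : size [seq e i | i <- enum 'I_4] = 4%N by rewrite size_map size_enum_ord.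
    have nE (i : 'I_(size [seq e i | i <- enum 'I_4])) : [seq e i | i <- enum 'I_4]`_i = e (cast_ord sz i).
      have i4 : (i < 4)%N by exact: leq_trans (ltn_ord i) (eq_leq sz).
      rewrite (nth_map ord0) ?size_enum_ord//; congr e; apply: val_inj.
      by rewrite /= nth_enum_ord.
    exists [seq e i | i <- enum 'I_4]; split.
      by move=> i; rewrite nE /= /e upK.
    move=> X hX; have h i : exists z : int, ent (dn X) i = z%:~R.
      by have hh := (ent_closedP (fun x : R => x \is a Num.int) (dn X)).1 hX; apply/intrP; exact: (hh i).
    have [z zE] := choice h.
    exists (fun i => z (cast_ord sz i)); rewrite {1}(decomp X).
    rewrite (reindex (cast_ord sz)) /=; last first.
      by exists (cast_ord (esym sz)) => i _; rewrite ?cast_ordK ?cast_ordKV.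
    by apply: eq_bigr => i _; rewrite nE -zE.
  + move=> X hX; have h i : exists q : rat, ent (dn X) i = ratr q.
      by have hh := (ent_closedP (@israt R) (dn X)).1 hX; exact: (hh i).
    have [q qE] := choice h.
    exists 4%N, q, e; split; first by move=> i; rewrite /= /e upK.
    by rewrite {1}(decomp X); apply: eq_bigr => i _; rewrite qE.
have cap : conjG P (G `&` [set X | [set X | @intmx R (dn X)] X /\ \det X = 1]) = conjG P G `&` @SLZ R.
  apply/seteqP; split => X; rewrite /conjG/= -/(up X) upK => -[GX [iX dX]]; split => //; split => //.
    by move: dX; rewrite !detM2 detV2// dP mul1r mulr1.
  by rewrite !detM2 detV2// dP mul1r mulr1.
have capZ : conjG P [set X | [set X | @intmx R (dn X)] X /\ \det X = 1] = @SLZ R.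
  apply/seteqP; split => X; rewrite /conjG/= -/(up X) upK => -[iX dX]; split => //.
    by move: dX; rewrite !detM2 detV2// dP mul1r mulr1.
  by rewrite !detM2 detV2// dP mul1r mulr1.
by split; apply: (finite_index_conj dP); rewrite cap// capZ.
Qed.

End arithmetic.

Lemma integral_traces (R : realType) (G : set 'M[R]_2) : surface_group G -> G (umx 1) -> few_traces G ->
  rational_cusp G -> forall E, G E -> (\tr E) ^+ 2 \is a Num.int.
Proof.
move=> sG GT fG rG E GE; have [sG' dG tG] := sG; have [_ _ Gd _ _] := sG'.
have [cE|cE] := eqVneq (E i1 i0) 0; last first.
  by apply/intrP; exact: integral_trace sG GT fG rG GE cE.
have dE := Gd E GE; rewrite det2E cE mulr0 subr0 in dE; rewrite tr2E.
have [aE|aE] := triangular_unipotent sG' dG GT GE cE.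
  by move: dE; rewrite aE mul1r => ->; rewrite rpredX// rpredD// rpred1.
by move: dE; rewrite aE mulN1r => dE; rewrite -(opprK (E i1 i1)) dE rpredX// rpredD// rpredN rpred1.
Qed.

Unset Implicit Arguments.

Theorem theorem1p3 (R : realType) (G : set 'M[R]_2) :
  surface_group G -> finite_area G -> ~ compact_quotient G ->
  (fun n : nat => ((count_lengths G n)%:R : R) /
       (expR (n%:R / 2) * ln (ln (n%:R : R)))) @ \oo --> (0 : R) ->
  arithmetic_fuchsian G.
Proof.
move=> sG aG ncG few; have [sG' dG tG] := sG; have [_ _ Gd _ GV] := sG'.
have fG := few_tracesP sG aG few.
have [P [GP tP P1]] := exists_parabolic sG aG ncG.
have [h [dh hP]] := parabolic_conj (Gd _ GP) tP P1.
have sG1 := conjG_surface dh sG; have [sG1' dG1 _] := sG1.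
have aG1 := conjG_area dh Gd aG.
have GT1 : conjG h G (umx 1).
  by rewrite /conjG/=; case: hP => <- //; exact: GV.
have [A GA cA] := exists_lower sG1' dG1 aG1 GT1.
(* Translating by t preserves T and moves the image of infinity under A to 0. So the conjugate B of
   A has upper left entry 0, as [rational_cuspP] and [entries_integral] require. *)
set t := A i0 i0 / A i1 i0; have dt := det_umx t.
have dht : \det (h * umx t) = 1 by rewrite detM2 dh dt mulr1.
pose G2 := conjG (h * umx t) G.
have sG2 : surface_group G2 := conjG_surface dht sG; have [sG2' dG2 _] := sG2.
have aG2 : finite_area G2 := conjG_area dht Gd aG.
have fG2 : few_traces G2 := few_traces_conj dht fG.
have G2E : G2 = conjG (umx t) (conjG h G) by rewrite conjG_comp.
have GT2 : G2 (umx 1).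
  by rewrite G2E /conjG/= umxV !umxD addrAC subrr add0r; exact: GT1.
pose B := umx (- t) * A * umx t.
have BA : umx t * B * (umx t)^-1 = A.
  by rewrite umxV /B !mulrA umxD subrr umx0 mul1r -mulrA umxD subrr umx0 mulr1.
have GB : G2 B by rewrite G2E /conjG/= BA; exact: GA.
have BE : B = mx2 0 ((A i0 i0 - t * A i1 i0) * t + (A i0 i1 - t * A i1 i1)) (A i1 i0) (A i1 i0 * t + A i1 i1).
  rewrite /B {1}(mx2_eta A) /umx !mulmx2; congr mx2; [by rewrite /t; field|ring|ring|ring].
have cB : B i1 i0 != 0 by rewrite BE mx2E.
have aB : B i0 i0 = 0 by rewrite BE mx2E.
have rG2 := rational_cuspP sG2' GT2 fG2 GB cB aB.
have [S S0 HS] := entries_integral sG2' dG2 GT2 rG2 GB cB aB (integral_traces sG2 GT2 fG2 rG2).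
apply: (arithmetic_of_commensurable dht).
  exact: finite_index_left sG2' S0 HS.
exact: finite_index_right sG2' dG2 aG2 S0 HS.
Qed.
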